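(* Let $E\in\{\mathscr D,\mathscr S\}$, $U\in\mathcal N(E)$ and $\gamma\in C(0)$. Let $\{f_k\}\subset E'$ be a sequence of usual distributions such that $f_k(\xi)\to f(\xi)$ at each $\xi\in E$ (then $f\in E'$) and there is a bounded $G\subset\mathbb R^n$ such that $\operatorname{supp}f_k\subseteq G$ for all $k\in\mathbb N$. If $g,g_k\in E^{(\gamma,U)}$ for all $k$ and $g_k(\xi)\to g(\xi)$ at each $\xi\in E$, then for every bounded $B\subset E$, $$\lim_{k,m\to+\infty}(f_k\ast g_m)(\xi)=(f\ast g)(\xi)\quad\text{uniformly for }\xi\in B;$$ in particular $\lim_k(f_k\ast g_k)(\xi)=(f\ast g)(\xi)$ uniformly for $\xi\in B$, and $(f_k\ast g_k)(\xi_k)\to(f\ast g)(\xi)$ whenever $\xi_k\to\xi$ in $E$.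
   Context: Test function spaces on $\mathbb R^n$ ($n\ge1$), over $\mathbb C$: for $m\in\mathbb N$, $\mathscr D_m$ is the Fréchet space of infinitely differentiable $\xi:\mathbb R^n\to\mathbb C$ with $\xi(x)=0$ for $|x|>m$, with norms $\|\xi\|_p=\sup_{|x|\le m}\max_{|q|\le p}|D^q\xi(x)|$; $\mathscr D=\bigcup_{m\ge1}\mathscr D_m$ is the strict inductive limit; $\mathscr S$ is the Fréchet space of infinitely differentiable rapidly decreasing functions with norms $\|\xi\|_p=\sup_{|k|,|q|\le p,\,x\in\mathbb R^n}|x^kD^q\xi(x)|$. $E'$ is the space of continuous linear functionals on $E$ (usual distributions). $\mathcal N(E)$ is the family of neighborhoods of $0$ in $E$. $C(0)$ is the set of functions $\gamma:\mathbb C\to\mathbb C$ with $\lim_{t\to0}\gamma(t)=\gamma(0)=0$ and $|\gamma(t)|\ge|t|$ for $|t|\le1$. For $\gamma\in C(0)$ and $U\in\mathcal N(E)$, $E^{(\gamma,U)}$ (demi-distributions) is the set of continuous $f:E\to\mathbb C$ with $f(0)=0$ such that for all $x\in E$, $u\in U$ and scalars $|t|\le1$ there are scalars $r,s$ with $|r-1|\le|\gamma(t)|$, $|s|\le|\gamma(t)|$ and $f(x+tu)=rf(x)+sf(u)$. The support of $f\in E'$ is the complement in $\mathbb R^n$ of the union of all open $O\subset\mathbb R^n$ such that $f(\xi)=0$ for every $\xi\in E$ with $\operatorname{supp}\xi\subset O$. $f_0\in E'$ is a convolution multiplier on $E$ if (i) for each $\xi\in E$ the function $f_0\ast\xi:\mathbb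 R^n\to\mathbb C$, $(f_0\ast\xi)(x)=f_0(\xi(x+\cdot))$, belongs to $E$; and (ii) $f_0\ast\xi_k\to0$ in $E$ whenever $\xi_k\to0$ in $E$ (sequences). Every $f_0\in E'$ with bounded support is a convolution multiplier (known fact); this applies to all $f_k$ and to the limit $f$. For a convolution multiplier $f_0$ and $g\in E^{(\gamma,U)}$, $f_0\ast g:E\to\mathbb C$ is defined by $(f_0\ast g)(\xi)=g(f_0\ast\xi)$. $\lim_{k,m\to+\infty}$ denotes the joint (double) limit. *)

(* Defs.v *)
From HB Require Import structures.
From mathcomp Require Import all_boot all_order all_algebra.
From mathcomp Require Import all_classical all_reals all_analysis.
From mathcomp Require Import complex.
From mathcomp Require Import ring lra.

Set Implicit Arguments.
Unset Strict Implicit.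
Unset Printing Implicit Defensive.

Import Order.TTheory GRing.Theory Num.Theory.
Import numFieldNormedType.Exports.

Local Open Scope classical_set_scope.
Local Open Scope ring_scope.
Local Open Scope complex_scope.

Notation normc := ComplexField.Normc.normc.

Section derivatives.
Variables (R : realType) (n : nat).
Local Notation Rn := 'rV[R]_n.
Local Notation C := (R[i]^o).
Implicit Types (f : Rn -> C) (x : Rn).

Definition euclid x : R := Num.sqrt (\sum_i x 0 i ^+ 2).

(* R[i] carries no normed R-module structure in the library: a C-valued
   function is differentiated through its real and imaginary parts. *)
Definition partial (i : 'I_n) f : Rn -> C := fun x =>
  ('D_(delta_mx 0 i) (@complex.Re R \o f) x) +i*
  ('D_(delta_mx 0 i) (@complex.Im R \o f) x).

Definition mpartial (s : seq 'I_n) f : Rn -> C := foldr partial f s.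

Definition cdifferentiable f x :=
  differentiable (@complex.Re R \o f) x /\ differentiable (@complex.Im R \o f) x.

Definition smooth f := forall (s : seq 'I_n) x, cdifferentiable (mpartial s f) x.

Definition multiindex := {ffun 'I_n -> nat}.

Definition msize (q : multiindex) : nat := \sum_i q i.

(* D^q = d_0^(q 0) o d_1^(q 1) o ... *)
Definition mderiv (q : multiindex) f : Rn -> C :=
  mpartial (flatten [seq nseq (q i) i | i <- enum 'I_n]) f.

Definition monomial (k : multiindex) x : R := \prod_i x 0 i ^+ k i.

Definition supp f : set Rn := closure [set x | f x != 0].

Definition in_Dm (m : nat) f := smooth f /\ forall x, m%:R < euclid x -> f x = 0.

Definition normD (m p : nat) f : R :=
  sup [set r | exists x q,
    [/\ euclid x <= m%:R, (msize q <= p)%N & r = normc (mderiv q f x)]].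

Definition in_S f := smooth f /\
  forall k q, exists M : R, forall x, normc ((monomial k x)%:C * mderiv q f x) <= M.

Definition normS (p : nat) f : R :=
  sup [set r | exists x k q, [/\ (msize k <= p)%N, (msize q <= p)%N &
    r = normc ((monomial k x)%:C * mderiv q f x)]].


Lemma Re_lin (a : R[i]) (u v : Rn -> C) : @complex.Re R \o (a *: u + v) =
  complex.Re a *: (@complex.Re R \o u) + (- complex.Im a) *: (@complex.Im R \o u)
  + (@complex.Re R \o v).
Proof.
apply/funext => x; rewrite /= !fctE /=.
case: a => a b; case: (u x) => c d; case: (v x) => e f.
by rewrite /GRing.scale /= mulNr.
Qed.

Lemma Im_lin (a : R[i]) (u v : Rn -> C) : @complex.Im R \o (a *: u + v) =
  complex.Re a *: (@complex.Im R \o u) + complex.Im a *: (@complex.Re R \o u)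
  + (@complex.Im R \o v).
Proof.
apply/funext => x; rewrite /= !fctE /=.
by case: a => a b; case: (u x) => c d; case: (v x) => e f.
Qed.

Lemma differentiable_lin2 (c d : R) (g h k : Rn -> R) x :
  differentiable g x -> differentiable h x -> differentiable k x ->
  differentiable (c *: g + d *: h + k) x.
Proof.
move=> dg dh dk; apply: (differentiableD _ dk).
exact: (differentiableD (differentiableZ c dg) (differentiableZ d dh)).
Qed.

Lemma derive_lin2 (c d : R) (g h k : Rn -> R) x v :
  differentiable g x -> differentiable h x -> differentiable k x ->
  'D_v (c *: g + d *: h + k) x = c * 'D_v g x + d * 'D_v h x + 'D_v k x.
Proof.
move=> /diff_derivable-/(_ v) dg /diff_derivable-/(_ v) dh.
move=> /diff_derivable-/(_ v) dk.
have dg' := derivableZ (k:=c) dg; have dh' := derivableZ (k:=d) dh.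
have -> := deriveD (derivableD dg' dh') dk.
have -> := deriveD dg' dh'.
by have -> := deriveZ c dg; have -> := deriveZ d dh.
Qed.

Lemma cdifferentiable_lin (a : R[i]) (u v : Rn -> C) x :
  cdifferentiable u x -> cdifferentiable v x -> cdifferentiable (a *: u + v) x.
Proof.
move=> [u1 u2] [v1 v2]; split.
  by rewrite Re_lin; exact: differentiable_lin2.
by rewrite Im_lin; exact: differentiable_lin2.
Qed.

Lemma partial_lin i (a : R[i]) (u v : Rn -> C) :
  (forall x, cdifferentiable u x) -> (forall x, cdifferentiable v x) ->
  partial i (a *: u + v) = a *: partial i u + partial i v.
Proof.
move=> du dv; apply/funext => x.
have [u1 u2] := du x; have [v1 v2] := dv x.
rewrite {1}/partial Re_lin Im_lin !derive_lin2//.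
rewrite !fctE /partial /GRing.scale /=.
by case: a => a b /=; rewrite mulNr.
Qed.

Lemma mpartial_lin s (a : R[i]) (u v : Rn -> C) : smooth u -> smooth v ->
  mpartial s (a *: u + v) = a *: mpartial s u + mpartial s v.
Proof.
move=> su sv; elim: s => //= i s ->; apply: partial_lin => x.
- exact: su.
- exact: sv.
Qed.

Lemma mderiv_lin q (a : R[i]) (u v : Rn -> C) : smooth u -> smooth v ->
  mderiv q (a *: u + v) = a *: mderiv q u + mderiv q v.
Proof. exact: mpartial_lin. Qed.

Lemma smooth_lin (a : R[i]) (u v : Rn -> C) : smooth u -> smooth v ->
  smooth (a *: u + v).
Proof.
by move=> su sv s x; rewrite mpartial_lin//; apply: cdifferentiable_lin.
Qed.

Lemma partial0 i : partial i (0 : Rn -> C) = 0.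
Proof.
apply/funext => x; rewrite /partial.
have -> : @complex.Re R \o (0 : Rn -> C) = cst 0 by apply/funext.
have -> : @complex.Im R \o (0 : Rn -> C) = cst 0 by apply/funext.
by rewrite !derive_cst.
Qed.

Lemma mpartial0 s : mpartial s (0 : Rn -> C) = 0.
Proof. by elim: s => //= i s ->; exact: partial0. Qed.

Lemma smooth0 : smooth (0 : Rn -> C).
Proof.
move=> s x; rewrite mpartial0; split.
- have -> : @complex.Re R \o (0 : Rn -> C) = cst 0 by apply/funext.
  exact: differentiable_cst.
- have -> : @complex.Im R \o (0 : Rn -> C) = cst 0 by apply/funext.
  exact: differentiable_cst.
Qed.

Definition shiftf (x : Rn) f : Rn -> C := fun y => f (x + y).

Lemma derive_shift (h : Rn -> R) x v :
  'D_v (fun y => h (x + y)) = (fun y => 'D_v h (x + y)).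
Proof.
apply/funext => y; rewrite /derive.
set F := (X in lim (X @ _)); set G := (X in _ = lim (X @ _)).
suff -> : F = G by [].
by apply/funext => t; rewrite /F /G /= addrCA.
Qed.

Lemma partial_shift i x f : partial i (shiftf x f) = shiftf x (partial i f).
Proof.
apply/funext => y; congr (_ +i* _).
- exact: (congr1 (@^~ y) (derive_shift (@complex.Re R \o f) x _)).
- exact: (congr1 (@^~ y) (derive_shift (@complex.Im R \o f) x _)).
Qed.

Lemma mpartial_shift s x f : mpartial s (shiftf x f) = shiftf x (mpartial s f).
Proof. by elim: s => //= i s ->; exact: partial_shift. Qed.

Lemma mderiv_shift q x f : mderiv q (shiftf x f) = shiftf x (mderiv q f).
Proof. exact: mpartial_shift. Qed.

Lemma differentiable_shift (h : Rn -> R) x y :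
  differentiable h (x + y) -> differentiable (fun y => h (x + y)) y.
Proof.
move=> dh; have d : differentiable (fun y : Rn => x + y) y.
  by apply: (differentiableD (f := cst x) (g := id)); [exact: differentiable_cst|exact: ex_diff].
exact: (differentiable_comp d dh).
Qed.

Lemma smooth_shift x f : smooth f -> smooth (shiftf x f).
Proof.
move=> sf s y; rewrite mpartial_shift; have [h1 h2] := sf s (x + y).
by split; [exact: differentiable_shift h1|exact: differentiable_shift h2].
Qed.


Lemma normc_ge0 (z : R[i]) : 0 <= normc z.
Proof. by case: z => a b; exact: sqrtr_ge0. Qed.

Lemma normcD (z w : R[i]) : normc (z + w) <= normc z + normc w.
Proof. by have := ler_normD (z : Rcomplex R) (w : Rcomplex R). Qed.

Lemma normc_real (r : R) : normc (r%:C : R[i]) = `|r|.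
Proof. by rewrite /= expr0n /= addr0 sqrtr_sqr. Qed.

Lemma normcM (z w : R[i]) : normc (z * w) = normc z * normc w.
Proof. exact: ComplexField.Normc.normcM. Qed.

Lemma normc_le (z : R[i]) : normc z <= `|complex.Re z| + `|complex.Im z|.
Proof.
case: z => a b /=; rewrite -[leRHS]ger0_norm ?addr_ge0// -sqrtr_sqr.
rewrite ler_sqrt ?sqr_ge0// sqrrD !real_normK ?num_real// lerD2r lerDl.
by rewrite mulrn_wge0// mulr_ge0.
Qed.

Lemma fin_bound p (S : multiindex -> R -> Prop) :
  (forall q, exists M, forall r, S q r -> r <= M) ->
  exists M, forall q r, (msize q <= p)%N -> S q r -> r <= M.
Proof.
move=> /choice[F FP].
pose toq (t : {ffun 'I_n -> 'I_p.+1}) : multiindex := [ffun i => nat_of_ord (t i)].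
exists (\sum_t `|F (toq t)|) => q r qp /FP; move/le_trans; apply.
have -> : q = toq [ffun i => inord (q i)].
  apply/ffunP => i; rewrite !ffunE inordK// ltnS (leq_trans _ qp)//.
  by rewrite /msize (bigD1 i)//= leq_addr.
apply: (le_trans (ler_norm _)).
by rewrite (bigD1 [ffun i => inord (q i)])//= lerDl sumr_ge0.
Qed.

Lemma euclid_ball (m : R) x : euclid x <= m -> `|x| <= m.
Proof.
move=> xm; have m0 : 0 <= m by rewrite (le_trans _ xm)// sqrtr_ge0.
rewrite /Num.norm /= mx_normrE; apply/bigmax_leP; split => // -[i j] _ /=.
rewrite (le_trans _ xm)// (ord1 i) -sqrtr_sqr ler_sqrt ?sumr_ge0// => *.
  by rewrite (bigD1 j)//= lerDl sumr_ge0// => k _; exact: sqr_ge0.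
exact: sqr_ge0.
Qed.

Lemma euclid0 : euclid 0 = 0.
Proof. by rewrite /euclid big1 ?sqrtr0// => i _; rewrite mxE expr0n. Qed.

Lemma bounded_on_ball (m : R) (h : Rn -> R) : (forall x, differentiable h x) ->
  exists M, forall x, `|x| <= m -> `|h x| <= M.
Proof.
move=> dh; pose A : set Rn := [set x | `|x| <= m].
have cA : compact A.
  apply: bounded_closed_compact.
    by exists m; split; [exact: num_real|move=> M mM x /le_trans; apply; exact: ltW].
  apply: (@closed_comp _ _ (fun x : Rn => `|x|) [set r | r <= m]); last exact: closed_le.
  by move=> x _; exact: norm_continuous.
have ch : continuous h by move=> x; exact: differentiable_continuous.
have cB : compact (h @` A).
  by apply: continuous_compact => //; exact: continuous_subspaceT.
have [M [_ MP]] := @compact_bounded R R^o _ cB.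
exists (M + 1) => x xm; apply: (MP (M + 1)); first by rewrite ltrDl.
by exists x.
Qed.

Lemma mderiv_bounded (m : R) q f : smooth f ->
  exists M, forall x, euclid x <= m -> normc (mderiv q f x) <= M.
Proof.
move=> sf.
have [M1 H1] := @bounded_on_ball m (@complex.Re R \o mderiv q f) (fun x => (sf _ x).1).
have [M2 H2] := @bounded_on_ball m (@complex.Im R \o mderiv q f) (fun x => (sf _ x).2).
exists (M1 + M2) => x /euclid_ball xm.
by apply: (le_trans (normc_le _)); apply: lerD; [exact: H1|exact: H2].
Qed.

Lemma normD_ub m p q f x : smooth f -> euclid x <= m%:R -> (msize q <= p)%N ->
  normc (mderiv q f x) <= normD m p f.
Proof.
move=> sf xm qp; apply: ub_le_sup; last by exists x, q.
have [|M MP] := @fin_bound p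
    (fun q r => exists2 x, euclid x <= m%:R & r = normc (mderiv q f x)).
  move=> q'; have [M MP] := mderiv_bounded m%:R q' sf.
  by exists M => r [y ym ->]; exact: MP.
by exists M => r [y [q' [ym q'p ->]]]; apply: (MP q') => //; exists y.
Qed.

Lemma normD_le m p f M :
  (forall x q, euclid x <= m%:R -> (msize q <= p)%N -> normc (mderiv q f x) <= M) ->
  normD m p f <= M.
Proof.
move=> H; apply: ge_sup; last by move=> r [x [q [xm qp ->]]]; exact: H.
exists (normc (mderiv [ffun=> 0%N] f 0)), 0, [ffun=> 0%N]; split=> //.
  by rewrite euclid0.
by rewrite /msize big1// => i _; rewrite ffunE.
Qed.

Lemma normS_ub p k q f x : in_S f -> (msize k <= p)%N -> (msize q <= p)%N ->
  normc ((monomial k x)%:C * mderiv q f x) <= normS p f.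
Proof.
move=> [sf Sf] kp qp; apply: ub_le_sup; last by exists x, k, q.
have [|M MP] := @fin_bound p (fun k r => exists x q, (msize q <= p)%N /\
    r = normc ((monomial k x)%:C * mderiv q f x)).
  move=> k'; have [|M MP] := @fin_bound p (fun q r => exists x,
      r = normc ((monomial k' x)%:C * mderiv q f x)).
    by move=> q'; have [M MP] := Sf k' q'; exists M => r [y ->].
  by exists M => r [y [q' [q'p ->]]]; apply: (MP q') => //; exists y.
by exists M => r [y [k' [q' [k'p q'p ->]]]]; apply: (MP k') => //; exists y, q'.
Qed.

Lemma normS_le p f M :
  (forall x k q, (msize k <= p)%N -> (msize q <= p)%N ->
    normc ((monomial k x)%:C * mderiv q f x) <= M) ->
  normS p f <= M.
Proof.
move=> H; apply: ge_sup; last by move=> r [x [k [q [kp qp ->]]]]; exact: H.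
have m0 : msize [ffun=> 0%N] = 0%N by rewrite /msize big1// => i _; rewrite ffunE.
exists (normc ((monomial [ffun=> 0%N] 0)%:C * mderiv [ffun=> 0%N] f 0)).
by exists 0, [ffun=> 0%N], [ffun=> 0%N]; rewrite m0.
Qed.

Lemma normD_lin m p (a : R[i]) (u v : Rn -> C) : smooth u -> smooth v ->
  normD m p (a *: u + v) <= normc a * normD m p u + normD m p v.
Proof.
move=> su sv; apply: normD_le => x q xm qp; rewrite mderiv_lin//.
apply: (le_trans (normcD _ _)); apply: lerD; last exact: normD_ub.
by rewrite normcM ler_wpM2l ?normc_ge0// normD_ub.
Qed.

Lemma in_Dm_lin m (a : R[i]) (u v : Rn -> C) : in_Dm m u -> in_Dm m v ->
  in_Dm m (a *: u + v).
Proof.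
move=> [su hu] [sv hv]; split; first exact: smooth_lin.
by move=> x mx; rewrite !fctE hu// hv// scaler0 addr0.
Qed.

Lemma in_S_lin (a : R[i]) (u v : Rn -> C) : in_S u -> in_S v -> in_S (a *: u + v).
Proof.
move=> [su hu] [sv hv]; split; first exact: smooth_lin.
move=> k q; have [M MP] := hu k q; have [N NP] := hv k q.
exists (normc a * M + N) => x; rewrite mderiv_lin// mulrDr.
apply: (le_trans (normcD _ _)); apply: lerD => //.
by rewrite mulrCA normcM ler_wpM2l ?normc_ge0.
Qed.

Lemma normS_lin p (a : R[i]) (u v : Rn -> C) : in_S u -> in_S v ->
  normS p (a *: u + v) <= normc a * normS p u + normS p v.
Proof.
move=> su sv; apply: normS_le => x k q kp qp.
rewrite mderiv_lin; [|exact: su.1|exact: sv.1].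
rewrite mulrDr; apply: (le_trans (normcD _ _)); apply: lerD; last exact: normS_ub.
by rewrite mulrCA normcM ler_wpM2l ?normc_ge0// normS_ub.
Qed.

Lemma normD_mono m p p' f : smooth f -> (p <= p')%N -> normD m p f <= normD m p' f.
Proof.
by move=> sf pp; apply: normD_le => x q xm qp; apply: normD_ub => //; exact: leq_trans pp.
Qed.

Lemma normS_mono p p' f : in_S f -> (p <= p')%N -> normS p f <= normS p' f.
Proof.
move=> sf pp; apply: normS_le => x k q kp qp.
by apply: normS_ub => //; exact: leq_trans pp.
Qed.

Lemma in_Dm_shift m x f : in_Dm m f -> exists m' : nat, in_Dm m'.+1 (shiftf x f).
Proof.
move=> [sf hf]; pose c : R := m%:R + `|x|.
have c0 : 0 <= c by rewrite addr_ge0.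
pose K := Num.sqrt (\sum_(i < n) c ^+ 2).
exists (Num.truncn K); split; first exact: smooth_shift.
move=> y Ky; apply: hf; rewrite ltNge; apply/negP => /euclid_ball xym.
have yc : `|y| <= c.
  by rewrite -(addKr x y) addrC (le_trans (ler_normB _ _))// lerD.
have : K < euclid y by apply: lt_trans Ky; exact: truncnS_gt.
rewrite ltNge => /negP; apply.
rewrite ler_sqrt; last by rewrite sumr_ge0// => i _; exact: sqr_ge0.
apply: ler_sum => i _; rewrite -real_normK ?num_real// lerXn2r ?nnegrE//.
apply: le_trans yc; rewrite [leRHS]/Num.norm /= mx_normrE.
by apply/bigmax_geP; right; exists (0, i).
Qed.

Lemma monomial_flatten k x :
  monomial k x = \prod_(i <- flatten [seq nseq (k i) i | i <- enum 'I_n]) x 0 i.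
Proof.
rewrite big_flatten big_map big_enum/=; apply: eq_bigr => i _.
by rewrite big_nseq; elim: (k i) => //= d <-; rewrite exprS.
Qed.

Lemma prod_monomial (t : seq 'I_n) x :
  \prod_(i <- t) x 0 i = monomial [ffun i => count_mem i t] x.
Proof.
elim: t => [|i t IH].
  by rewrite big_nil /monomial big1// => i _; rewrite ffunE.
rewrite big_cons IH /monomial [in RHS](bigD1 i)// [in LHS](bigD1 i)//= mulrA.
rewrite !ffunE /= eqxx add1n exprS; congr (_ * _).
by apply: eq_bigr => j ji; rewrite !ffunE /= eq_sym (negbTE ji).
Qed.

Lemma in_S_shift x f : in_S f -> in_S (shiftf x f).
Proof.
move=> [sf Sf]; split; first exact: smooth_shift.
move=> k q; rewrite mderiv_shift.
suff H : forall s t : seq 'I_n, exists M, forall y : Rn,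
    `|\prod_(i <- s) y 0 i| * (`|\prod_(i <- t) (x + y) 0 i| *
      normc (mderiv q f (x + y))) <= M.
  have [M MP] := H (flatten [seq nseq (k i) i | i <- enum 'I_n]) [::].
  exists M => y; rewrite normcM normc_real monomial_flatten.
  by have := MP y; rewrite big_nil normr1 mul1r.
elim=> [|i s IH] t.
  have [M MP] := Sf [ffun i => count_mem i t] q; exists M => y.
  by rewrite big_nil normr1 mul1r prod_monomial -normc_real -normcM.
have [M MP] := IH (i :: t); have [N NP] := IH t.
exists (M + `|x 0 i| * N) => y.
have yi : `|y 0 i| <= `|(x + y) 0 i| + `|x 0 i|.
  have {1}-> : y 0 i = (x + y) 0 i - x 0 i by rewrite mxE addrC addKr.
  exact: ler_normB.
rewrite big_cons normrM -mulrA.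
have := MP y; have := NP y; rewrite big_cons normrM.
set A := `|\prod_(_ <- s) _|; set B := `|\prod_(_ <- t) _|; set D := normc _ => h1 h2.
have ABD : 0 <= A * (B * D).
  by apply: mulr_ge0; rewrite ?normr_ge0//; apply: mulr_ge0; rewrite ?normr_ge0 ?normc_ge0.
apply: (le_trans (ler_wpM2r ABD yi)); rewrite mulrDl; apply: lerD.
  by apply: le_trans h2; rewrite mulrCA !mulrA.
exact: ler_wpM2l.
Qed.

End derivatives.

Arguments normD {R n}.
Arguments normS {R n}.

Variant test_space := Dspace | Sspace.

Definition mem_test (R : realType) (n : nat) (E : test_space)
    (f : 'rV[R]_n -> R[i]^o) : Prop :=
  match E with
  | Dspace => exists2 m, (0 < m)%N & in_Dm m f
  | Sspace => in_S f
  end.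

Lemma in_Dm_leq (R : realType) n m m' (f : 'rV[R]_n -> R[i]^o) :
  (m <= m')%N -> in_Dm m f -> in_Dm m' f.
Proof.
move=> mm [sf hf]; split => // x mx; apply: hf; apply: le_lt_trans mx.
by rewrite ler_nat.
Qed.

Lemma mem_test0 (R : realType) n E : mem_test E (0 : 'rV[R]_n -> R[i]^o).
Proof.
case: E; first by exists 1%N => //; split; [exact: smooth0|].
split; first exact: smooth0.
move=> k q; exists 0 => x; rewrite /mderiv mpartial0 mulr0.
by rewrite ComplexField.Normc.normc0.
Qed.

Lemma mem_test_lin (R : realType) n E (a : R[i]) (u v : 'rV[R]_n -> R[i]^o) :
  mem_test E u -> mem_test E v -> mem_test E (a *: u + v).
Proof.
case: E => [[m m0 hu] [m' _ hv]|]; last exact: in_S_lin.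
exists (maxn m m'); first by rewrite leq_max m0.
by apply: in_Dm_lin; [apply: in_Dm_leq hu|apply: in_Dm_leq hv];
  rewrite leq_max leqnn ?orbT.
Qed.

Lemma mem_test_shift (R : realType) n E x (f : 'rV[R]_n -> R[i]^o) :
  mem_test E f -> mem_test E (shiftf x f).
Proof.
case: E; last exact: in_S_shift.
by move=> [m _ /(in_Dm_shift x)[m' hm']]; exists m'.+1.
Qed.

Section test_functions.
Variables (R : realType) (n : nat) (E : test_space).
Local Notation Rn := 'rV[R]_n.
Local Notation C := (R[i]^o).

Definition test_pred : {pred (Rn -> C)} := [pred f | `[< mem_test E f >]].

Record testfun := TestFun {
  testfun_val :> Rn -> C;
  testfun_prop : testfun_val \in test_pred }.

HB.instance Definition _ := [isSub for testfun_val].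
HB.instance Definition _ := [Choice of testfun by <:].

Lemma test_pred_submod_closed : submod_closed test_pred.
Proof.
split; first exact/asboolP/mem_test0.
by move=> a u v /asboolP hu /asboolP hv; exact/asboolP/mem_test_lin.
Qed.

HB.instance Definition _ := GRing.isSubmodClosed.Build _ _ test_pred
  test_pred_submod_closed.
HB.instance Definition _ := [SubChoice_isSubLmodule of testfun by <:].

Lemma testfunP (f : testfun) : mem_test E f.
Proof. by have /asboolP := testfun_prop f. Qed.

(* x + V, for V as below, are a basis of neighborhoods of x.
   D: the strict inductive limit of the D_m, m >= 1, i.e. V is convex and
      meets each D_m in a neighborhood of 0 of D_m;
   S: V contains a ball {normS p < e}. *)
Definition nbhs0_base (V : set testfun) : Prop :=
  match E with
  | Dspace => convex_set V /\ forall m, (0 < m)%N -> exists p, exists2 e : R, 0 < e &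
      forall f : testfun, in_Dm m f -> normD m p f < e -> V f
  | Sspace => exists p, exists2 e : R, 0 < e &
      forall f : testfun, normS p f < e -> V f
  end.

Definition nbhs_test (f : testfun) (A : set testfun) : Prop :=
  exists2 V, nbhs0_base V & forall v, V v -> A (f + v).

HB.instance Definition _ := hasNbhs.Build testfun nbhs_test.

Local Notation base := nbhs0_base.

Lemma normD_Z m p (a : R[i]) (u : Rn -> C) : smooth u ->
  normD m p (a *: u) <= normc a * normD m p u.
Proof.
move=> su; apply: normD_le => x q xm qp.
have := mderiv_lin q a su (@smooth0 R n); rewrite addr0 => ->.
rewrite /mderiv mpartial0 addr0 normcM ler_wpM2l ?normc_ge0//.
exact: normD_ub.
Qed.

Lemma normS_Z p (a : R[i]) (u : Rn -> C) : in_S u ->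
  normS p (a *: u) <= normc a * normS p u.
Proof.
move=> su; apply: normS_le => x k q kp qp.
have := mderiv_lin q a su.1 (@smooth0 R n); rewrite addr0 => ->.
rewrite /mderiv mpartial0 addr0 mulrCA normcM ler_wpM2l ?normc_ge0//.
exact: normS_ub.
Qed.

Lemma normD0 m p : normD m p (0 : Rn -> C) <= 0.
Proof.
apply: normD_le => x q _ _.
by rewrite /mderiv mpartial0 ComplexField.Normc.normc0.
Qed.

Lemma normS0 p : normS p (0 : Rn -> C) <= 0.
Proof.
apply: normS_le => x k q _ _.
by rewrite /mderiv mpartial0 mulr0 ComplexField.Normc.normc0.
Qed.

Lemma in_Dm0 m : in_Dm m (0 : Rn -> C).
Proof. by split; [exact: smooth0|]. Qed.

Lemma in_Dm_Z m (a : R[i]) (u : Rn -> C) : in_Dm m u -> in_Dm m (a *: u).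
Proof. by move=> /in_Dm_lin-/(_ a _ (in_Dm0 m)); rewrite addr0. Qed.

Lemma small_scale (N e c : R) : 0 <= c -> 0 < e -> N < e / (c + 1) -> c * N < e.
Proof.
move=> c0 e0; have c1 : 0 < c + 1 by rewrite ltr_wpDl.
rewrite ltr_pdivlMr// => h; have [N0|N0] := leP N 0.
  by apply: le_lt_trans e0; rewrite mulr_ge0_le0.
by apply: le_lt_trans h; rewrite mulrC ler_pM2l// lerDl.
Qed.

Lemma test_valP (a : R[i]) (u v : testfun) :
  testfun_val (a *: u + v) = a *: testfun_val u + testfun_val v.
Proof. by []. Qed.

Lemma convE (f g : testfun) (l : {i01 R[i]}) :
  conv l (f : convex_lmodType testfun) g = l%:num *: f + (1 - l%:num) *: g.
Proof. by []. Qed.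

Lemma normc_num (l : R[i]) : 0 <= l -> exists2 r : R, 0 <= r & l = r%:C.
Proof.
by case: l => a b; rewrite lecE/= => /andP[/eqP-> a0]; exists a.
Qed.

Lemma base0 V : base V -> V 0.
Proof.
rewrite /nbhs0_base; case: E => [[_ /(_ 1%N isT)[p [e e0]]]|[p [e e0]]]; apply.
- exact: in_Dm0.
- exact: le_lt_trans (normD0 _ p) e0.
- exact: le_lt_trans (normS0 p) e0.
Qed.

Lemma baseT : base setT.
Proof.
rewrite /nbhs0_base; case: E; last by exists 0%N, 1.
split; last by move=> m _; exists 0%N, 1.
by move=> x y l _ _; rewrite in_setT.
Qed.

Lemma baseI V W : base V -> base W -> base (V `&` W).
Proof.
have := testfunP; rewrite /nbhs0_base; case: E => [_|fS].
  move=> [cV bV] [cW bW]; split.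
    move=> x y l /set_mem[Vx Wx] /set_mem[Vy Wy]; apply/mem_set; split.
      by apply/set_mem/cV; exact/mem_set.
    by apply/set_mem/cW; exact/mem_set.
  move=> m m0; have [p [e e0 He]] := bV m m0; have [q [d d0 Hd]] := bW m m0.
  exists (maxn p q), (Num.min e d); first by rewrite lt_min e0.
  move=> f fm; rewrite lt_min => /andP[fe fd]; split.
    by apply: He => //; apply: le_lt_trans fe; apply: normD_mono fm.1 _; exact: leq_maxl.
  by apply: Hd => //; apply: le_lt_trans fd; apply: normD_mono fm.1 _; exact: leq_maxr.
move=> [p [e e0 He]] [q [d d0 Hd]].
exists (maxn p q), (Num.min e d); first by rewrite lt_min e0.
move=> f; rewrite lt_min => /andP[fe fd]; split.
  by apply: He; apply: le_lt_trans fe; apply: normS_mono (fS f) _; exact: leq_maxl.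
by apply: Hd; apply: le_lt_trans fd; apply: normS_mono (fS f) _; exact: leq_maxr.
Qed.

Lemma base_preim (P : R[i] -> Prop) c V : (forall t, P t -> normc t <= c) ->
  base V -> base [set v | forall t, P t -> V (t *: v)].
Proof.
move=> Pc; have [c0|c0] := ltP c 0.
  move=> _; suff -> : [set v | forall t, P t -> V (t *: v)] = setT by exact: baseT.
  by apply/seteqP; split => // v _ t /Pc /le_lt_trans/(_ c0); rewrite ltNge normc_ge0.
have small e (e0 : 0 < e) (t : R[i]) (Pt : P t) (r N : R) : r <= normc t * N ->
    N < e / (c + 1) -> r < e.
  move=> rN Ne; apply: le_lt_trans rN _; apply: small_scale => //.
    exact: normc_ge0.
  apply: lt_le_trans Ne _; rewrite ler_pM2l// lef_pV2 ?posrE ?ltr_wpDl ?normc_ge0//.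
  by rewrite lerD2r; exact: Pc.
have ec e : 0 < e -> 0 < e / (c + 1) by move=> e0; rewrite divr_gt0// ltr_wpDl.
have := testfunP; rewrite /nbhs0_base; case: E => [_|fS].
  move=> [cV bV]; split.
    move=> x y l /set_mem Vx /set_mem Vy; apply/mem_set => t Pt.
    rewrite convE scalerDr !scalerA !(mulrC t) -!scalerA -convE.
    by apply/set_mem/cV; apply/mem_set; [exact: Vx|exact: Vy].
  move=> m m0; have [p [e e0 He]] := bV m m0.
  exists p, (e / (c + 1)); first exact: ec.
  move=> f fm fe t Pt; apply: He; first exact: in_Dm_Z.
  exact: (small e e0 t Pt _ _ (normD_Z m p t fm.1) fe).
move=> [p [e e0 He]]; exists p, (e / (c + 1)); first exact: ec.
move=> f fe t Pt; apply: He.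
exact: (small e e0 t Pt _ _ (normS_Z p t (fS f)) fe).
Qed.

Lemma base_scale (c : R[i]) V : base V -> base [set v | V (c *: v)].
Proof.
move=> bV; rewrite (_ : mkset _ = [set v | forall t, t = c -> V (t *: v)]).
  by apply: (@base_preim _ (normc c)) => // t ->.
by apply/seteqP; split => v /= => [Vv t ->//|]; exact.
Qed.

Lemma normS_convex p (e : R) (fS : forall f : testfun, in_S f) :
  convex_set [set v : testfun | normS p v < e].
Proof.
apply/convex_setW => x y /set_mem/= xe /set_mem/= ye l l0 l1; apply/mem_set.
rewrite convE /mkset; move: (l%:num) l0 l1 => {}l l0 l1.
have [r r0 lr] := normc_num (ltW l0).
have {}r0 : 0 < r by move: l0; rewrite lr ltcR.
have r1 : r < 1 by move: l1; rewrite lr ltcR.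
rewrite test_valP; apply: (le_lt_trans (normS_lin p l (fS x) (fS _))).
have := normS_Z p (1 - l) (fS y).
have -> : normc (1 - l) = 1 - r.
  by rewrite lr -(rmorphB (real_complex R)) normc_real ger0_norm// subr_ge0 ltW.
have -> : normc l = r by rewrite lr normc_real gtr0_norm.
by move=> h; nra.
Qed.

Lemma base_convex V : base V -> exists W, [/\ base W, W `<=` V & convex_set W].
Proof.
have := testfunP; rewrite /nbhs0_base; case: E => [_ [cV bV]|fS [p [e e0 He]]].
  by exists V; split; [split| |].
exists [set v | normS p v < e]; split => //; last exact: normS_convex.
by exists p, e.
Qed.

Lemma base_half V : base V ->
  exists2 W, base W & forall v w, W v -> W w -> V (v + w).
Proof.
move=> /base_convex[V' [bV V'V cV]].
exists [set v | V' (2 *: v)]; first exact: base_scale.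
move=> v w Vv Vw; apply: V'V.
have h1 : 0 <= 2^-1 :> R[i] by rewrite invr_ge0.
have h2 : 2^-1 <= 1 :> R[i] by rewrite invf_le1// ler1n.
pose l : {i01 R[i]} := Itv01 h1 h2.
have -> : v + w = conv l (2 *: v : convex_lmodType testfun) (2 *: w).
  rewrite convE /= !scalerA mulVf// ?pnatr_eq0// mulrBl mul1r mulVf ?pnatr_eq0//.
  by rewrite (_ : 2 - 1 = 1) ?scale1r//; ring.
by apply/set_mem/cV; exact/mem_set.
Qed.

Lemma base_absorb V x : base V ->
  exists2 d : R, 0 < d & forall t : R[i], normc t < d -> V (t *: x).
Proof.
have small (e N : R) (t : R[i]) : 0 < e -> normc t < e / (`|N| + 1) ->
    normc t * N < e.
  move=> e0 te; apply: le_lt_trans (small_scale (normr_ge0 N) e0 te).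
  by rewrite mulrC ler_wpM2r ?normc_ge0// ler_norm.
have := testfunP x; rewrite /nbhs0_base; case: E => [[m m0 xm] [_ /(_ m m0)]|xS].
  move=> [p [e e0 He]]; exists (e / (`|normD m p x| + 1)).
    by rewrite divr_gt0// ltr_wpDl.
  move=> t te; apply: He; first exact: in_Dm_Z.
  by apply: le_lt_trans (normD_Z m p t xm.1) _; exact: small.
move=> [p [e e0 He]]; exists (e / (`|normS p x| + 1)).
  by rewrite divr_gt0// ltr_wpDl.
move=> t te; apply: He.
by apply: le_lt_trans (normS_Z p t xS) _; exact: small.
Qed.

Lemma test_nbhs_filter (f : testfun) : ProperFilter (nbhs f).
Proof.
split; first by move=> [V bV] /(_ 0 (base0 bV)).
split.
- by exists setT => //; exact: baseT.
- move=> A B [V bV VA] [W bW WB]; exists (V `&` W); first exact: baseI.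
  by move=> v [Vv Wv]; split; [exact: VA|exact: WB].
- by move=> A B AB [V bV VA]; exists V => // v /VA; exact: AB.
Qed.

Lemma test_nbhs_singleton (f : testfun) (A : set testfun) : nbhs f A -> A f.
Proof. by move=> [V bV VA]; have := VA 0 (base0 bV); rewrite addr0. Qed.

Lemma test_nbhs_nbhs (f : testfun) (A : set testfun) :
  nbhs f A -> nbhs f (nbhs^~ A).
Proof.
move=> [V bV VA]; have [W bW WV] := base_half bV.
exists W => // v Wv; exists W => // w Ww.
by rewrite -addrA; apply: VA; exact: WV.
Qed.

HB.instance Definition _ := Nbhs_isNbhsTopological.Build testfun
  test_nbhs_filter test_nbhs_singleton test_nbhs_nbhs.

Lemma test_nbhs0 V : base V -> nbhs (0 : testfun) V.
Proof. by move=> bV; exists V => // v; rewrite add0r. Qed.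

Lemma test_add_continuous : continuous (fun x : testfun * testfun => x.1 + x.2).
Proof.
move=> [x y] A [V bV VA]; have [W bW WV] := base_half bV.
exists ([set x + w | w in W], [set y + w | w in W]).
  by split; exists W => // w Ww; exists w.
move=> [_ _] /= [[v Vv <-] [w Ww <-]]; rewrite addrACA.
by apply: VA; exact: WV.
Qed.

Lemma test_scale_continuous :
  continuous (fun z : R[i]^o * testfun => z.1 *: z.2).
Proof.
move=> [l x] A [V bV VA]; have [W bW WV] := base_half bV.
have [d d0 Hd] := base_absorb x bW.
pose c := normc l + 1.
pose X := [set v | forall t, normc t <= c -> W (t *: v)].
have bX : base X by exact: (@base_preim (fun t => normc t <= c) c).
pose r := Num.min d 1.
have r0 : 0 < r by rewrite lt_min d0 /=.
exists ([set k | normc (k - l) < r], [set x + v | v in X]).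
  split; last by exists X => // v Xv; exists v.
  exists (r%:C) => /=; first by rewrite ltcR.
  move=> k /=; rewrite distrC => h; move: h.
  by rewrite (_ : `|k - l| = (normc (k - l))%:C)// ltcR.
move=> [k _] /= [kl [v Xv <-]].
have -> : k *: (x + v) = l *: x + ((k - l) *: x + k *: v).
  by rewrite addrA -scalerDl subrKC scalerDr.
apply/VA/WV.
  by apply: Hd; apply: lt_le_trans kl _; rewrite ge_min lexx.
apply: Xv; rewrite -[k](subrK l) addrC; apply: (le_trans (normcD _ _)).
rewrite lerD2l (le_trans (ltW kl))// ge_min lexx orbT//.
Qed.

Lemma test_locally_convex : exists2 B : set_system testfun,
  (forall b, b \in B -> convex_set b) & basis B.
Proof.
exists [set A | open A /\ convex_set A].
  by move=> A /set_mem[].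
split; first by move=> A [].
move=> x A [V /base_convex[W [bW WV cW]] VA].
pose S : set testfun := [set y : testfun | nbhs y [set z | W (z - x)]].
have Sx : S x by exists W => // w Ww /=; rewrite addrC addKr.
exists S; last first.
  move=> y /test_nbhs_singleton/= Wy; rewrite -(subrKC x y).
  exact/VA/WV.
split => //; split.
  by rewrite openE => y; exact: test_nbhs_nbhs.
move=> y z l /set_mem[Y bY HY] /set_mem[Z bZ HZ]; apply/mem_set.
exists (Y `&` Z); first exact: baseI.
move=> v [Yv Zv] /=.
have shiftE (a b : R[i]) (w : testfun) : a + b = 1 ->
    a *: y + b *: z + w = a *: (y + w) + b *: (z + w).
  by move=> ab; rewrite !scalerDr [RHS]addrACA -(scalerDl w) ab scale1r.
have -> : conv l (y : convex_lmodType testfun) z + v - x =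
    conv l (y + v - x : convex_lmodType testfun) (z + v - x).
  rewrite -[LHS]addrA -(addrA y) -(addrA z).
  by apply: (shiftE (l%:num) (1 - l%:num)); rewrite subrKC.
by apply/set_mem/cW; apply/mem_set; [exact: HY|exact: HZ].
Qed.

HB.instance Definition _ := PreTopologicalLmod_isTvs.Build R[i] testfun
  test_add_continuous test_scale_continuous test_locally_convex.
(* in this version of the library the factory above only builds the uniform
   structure *)
HB.instance Definition _ :=
  PreTopologicalNmodule_isTopologicalNmodule.Build testfun test_add_continuous.
HB.instance Definition _ :=
  TopologicalNmodule_isTopologicalLmodule.Build R[i] testfun test_scale_continuous.
HB.instance Definition _ := Uniform_isTvs.Build R[i] testfun test_locally_convex.

End test_functions.

Definition tvs_bounded (K : numDomainType) (T : tvsType K) (B : set T) : Prop :=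
  forall V : set T, nbhs 0 V ->
    exists2 s : K, 0 < s & forall t : K, s < t -> B `<=` [set t *: v | v in V].

Definition C0 (R : realType) (gamma : R[i]^o -> R[i]^o) : Prop :=
  [/\ gamma t @[t --> (0 : R[i]^o)] --> (0 : R[i]^o), gamma 0 = 0 &
      forall t, `|t| <= 1 -> `|t| <= `|gamma t|].

Section distributions.
Variables (R : realType) (n : nat) (E : test_space).
Local Notation Rn := 'rV[R]_n.
Local Notation C := (R[i]^o).
Local Notation T := (testfun R n E).

Definition usual_distribution (f : T -> C) : Prop := linear f /\ continuous f.

Definition demi_distribution (gamma : C -> C) (U : set T) (f : T -> C) : Prop :=
  [/\ continuous f, f 0 = 0 &
      forall (x u : T) (t : C), U u -> `|t| <= 1 ->
        exists r s : C, [/\ `|r - 1| <= `|gamma t|, `|s| <= `|gamma t| &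
          f (x + t *: u) = r * f x + s * f u]].

Definition distr_support (f : T -> C) : set Rn :=
  ~` \bigcup_(O in [set O : set Rn | open O /\
       forall xi : T, supp xi `<=` O -> f xi = 0]) O.

Lemma translate_subproof (x : Rn) (xi : T) : shiftf x xi \in test_pred E.
Proof. by apply/asboolP/mem_test_shift; exact: testfunP. Qed.

Definition translate (x : Rn) (xi : T) : T := TestFun (translate_subproof x xi).

Definition conv_fun (f : T -> C) (xi : T) : Rn -> C := fun x => f (translate x xi).

(* h itself if h belongs to the test space, and 0 otherwise *)
Definition to_test (h : Rn -> C) : T := insubd (0 : T) h.

Definition convolution_multiplier (f : T -> C) : Prop :=
  (forall xi : T, mem_test E (conv_fun f xi)) /\
  (forall xi_ : nat -> T, xi_ @ \oo --> (0 : T) ->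
    to_test (conv_fun f (xi_ k)) @[k --> \oo] --> (0 : T)).

(* only meaningful when f is a convolution multiplier *)
Definition conv_demi (f g : T -> C) : T -> C := fun xi => g (to_test (conv_fun f xi)).

End distributions.

(* Main.v *)
(* The f_k form a pointwise bounded sequence of functionals supported in a fixed ball.  Multiplying
   by a cutoff function and applying Banach-Steinhaus on the Frechet space of test functions
   supported in a larger ball gives an estimate |f_k v| <= c * A, uniform in k, as soon as A bounds
   the derivatives of v up to some order on that ball.  Hence the convolutions f_k * xi are bounded
   in E by seminorms of xi, uniformly in k, and since the translates of derivatives of the
   functions of a bounded set B, suitably weighted, have finite nets for the local seminorms
   (the functions and their derivatives are equi-Lipschitz), f_k * xi -> f * xi in E uniformly for
   xi in B.
   On the other side, Baire's theorem applies to demi-distributions as well: the g_m are uniformly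
   bounded on a neighborhood of 0, and g (x + t u) = r g x + s g u turns this into the
   equicontinuity estimate |g (x + t u) - g x| <= |gamma t| (|g x| + |g u|).  A finite net of
   f * B then upgrades the pointwise convergence of g_m to uniform convergence along
   f_k * xi -> f * xi.

   All functions of D or S are measured by the bounds (1 + |x|)^p |d^s u x| <= A, for |s| <= p,
   where |x| is the sup norm and s a list of directions: by the symmetry of second derivatives
   these are equivalent to the seminorms normS, and on each D_m to the seminorms normD m. *)
Require Import Defs.
From HB Require Import structures.
From mathcomp Require Import all_boot all_order all_algebra.
From mathcomp Require Import all_classical all_reals all_analysis.
From mathcomp Require Import complex.
From mathcomp Require Import ring lra.

Set Implicit Arguments.
Unset Strict Implicit.
Unset Printing Implicit Defensive.

Import Order.TTheory GRing.Theory Num.Theory.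
Import numFieldNormedType.Exports.

Local Open Scope classical_set_scope.
Local Open Scope ring_scope.
Local Open Scope complex_scope.

(** * Calculus on R^n *)

(** The space D is not metrizable, so Baire's theorem is not applied to D itself but inside one
    [stage]: some D_m when E is D, all of S when E is S. One stage is enough, because a bounded set
    of D lies in a single D_m and convolution with functionals supported in a fixed ball carries D_m
    into a single D_m'. The estimate for the f_k must not depend on the stage of its argument, since
    f_k * xi evaluates f_k at all translates of xi; this is the purpose of the cutoff. A
    demi-distribution is not homogeneous, so a bound near 0 does not rescale to a seminorm estimate.
    Increments are controlled only relative to |g x|, and a bound of the g_m on f * B, uniform in m,
    has to be secured before any increment can be made small. Differentiability of limits and of
    convolutions rests on Taylor remainders bounded by an explicit multiple of |v|^2: such bounds
    pass to pointwise limits and through functionals, which a bare o(v) would not. *)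

Section calculus.
Variables (R : realType) (n : nat).
Local Notation Rn := 'rV[R]_n.
Local Notation C := (R[i]^o).
Local Notation ee i := (delta_mx 0 i : Rn) (only parsing).
Implicit Types (h : Rn -> R) (u w : Rn -> C) (x v : Rn).

Lemma derive_coord h x v : differentiable h x ->
  'D_v h x = \sum_i v 0 i * 'D_(ee i) h x.
Proof.
move=> dh; rewrite deriveE// {1}(row_sum_delta v) linear_sum/=.
by apply: eq_bigr => i _; rewrite linearZ/= deriveE.
Qed.

Lemma is_derive_line h x v (t : R) : differentiable h (x + t *: v) ->
  is_derive t 1 (fun t => h (x + t *: v)) ('D_v h (x + t *: v)).
Proof.
move=> /diff_derivable-/(_ v) dh.
have E : (fun s : R => s^-1 *: (h (x + (s *: 1 + t) *: v) - h (x + t *: v))) =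
         (fun s => s^-1 *: (h (s *: v + (x + t *: v)) - h (x + t *: v))).
  by apply/funext => s; rewrite scalerDl addrCA -[s *: 1]/(s * 1) mulr1.
apply: DeriveDef; first by rewrite /derivable E.
by rewrite /derive E.
Qed.

Lemma segment_MVT h x v : (forall y, differentiable h y) ->
  exists2 t : R, 0 <= t <= 1 & h (x + v) - h x = 'D_v h (x + t *: v).
Proof.
move=> dh.
have [||t t01] := @MVT_segment R (fun t => h (x + t *: v))
    (fun t => 'D_v h (x + t *: v)) 0 1 ler01.
- by move=> t _; exact: is_derive_line.
- apply: derivable_within_continuous => t _.
  by have [] := is_derive_line (dh (x + t *: v)).
rewrite scale1r scale0r addr0 subr0 mulr1 => ->.
by exists t => //; move: t01; rewrite in_itv.
Qed.

Lemma coord_le_norm x i : `|x 0 i| <= `|x|.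
Proof.
rewrite [leRHS]/Num.norm /= mx_normrE.
by apply/bigmax_geP; right; exists (0, i).
Qed.

Lemma norm_rV_le x (M : R) : 0 <= M -> (forall i, `|x 0 i| <= M) -> `|x| <= M.
Proof.
move=> M0 H; rewrite /Num.norm /= mx_normrE; apply/bigmax_leP; split => //.
by move=> -[i j] _ /=; rewrite ord1.
Qed.

Lemma derive_le h x v (K : R) : differentiable h x ->
  (forall i, `|'D_(ee i) h x| <= K) -> `|'D_v h x| <= n%:R * K * `|v|.
Proof.
move=> dh hK; rewrite derive_coord//.
apply: (le_trans (ler_norm_sum _ _ _)).
apply: (@le_trans _ _ (\sum_(i < n) K * `|v|)).
  by apply: ler_sum => i _; rewrite normrM mulrC ler_pM// coord_le_norm.
by rewrite sumr_const card_ord -[leLHS]mulr_natl mulrA.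
Qed.

Lemma real_lipschitz h x v (K : R) : (forall y, differentiable h y) ->
  (forall (t : R) i, 0 <= t <= 1 -> `|'D_(ee i) h (x + t *: v)| <= K) ->
  `|h (x + v) - h x| <= n%:R * K * `|v|.
Proof.
move=> dh hK; have [t t01 ->] := segment_MVT x v dh.
by apply: derive_le => // i; exact: hK.
Qed.

(** The remainder is the sum of v_i times the increment of the i-th partial derivative over part of
    the segment, and the mean value theorem bounds that increment once more. The constant involves
    only [n] and [K], hence serves whole sequences of functions. *)
Lemma real_taylor2 h x v (K : R) : (forall y, differentiable h y) ->
  (forall i y, differentiable ('D_(ee i) h) y) ->
  (forall i j y, `|'D_(ee j) ('D_(ee i) h) y| <= K) ->
  `|h (x + v) - h x - \sum_i v 0 i * 'D_(ee i) h x| <= n%:R * (n%:R * K) * `|v| ^+ 2.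
Proof.
move=> dh ddh hK; have [t /andP[t0 t1] ->] := segment_MVT x v dh.
rewrite derive_coord// -sumrB; apply: (le_trans (ler_norm_sum _ _ _)).
apply: (@le_trans _ _ (\sum_(i < n) `|v| * (n%:R * K * `|v|))); last first.
  rewrite sumr_const card_ord -[leLHS]mulr_natl expr2 -!mulrA ler_wpM2l//.
  by rewrite mulrCA ler_wpM2l// mulrCA.
apply: ler_sum => i _; rewrite -mulrBr normrM.
apply: ler_pM => //; first exact: coord_le_norm.
apply: (@le_trans _ _ (n%:R * K * `|t *: v|)).
  have H := @real_lipschitz ('D_(ee i) h) x (t *: v) K (ddh i).
  by apply: H => s j _; exact: hK.
have K0 : 0 <= K by apply: le_trans (hK i i 0).
rewrite ler_wpM2l ?mulr_ge0// normrZ ger0_norm//.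
by rewrite ler_piMl.
Qed.

End calculus.

(** A remainder O(|v|^2) is o(v). This gives differentiability where the rules of calculus do not
    reach: for [flat_exp] at 0, for limits of smooth functions and for convolutions. *)
Lemma differentiable_of_quadratic_remainder (K : realFieldType) (V W : normedModType K)
    (h : V -> W) (L : {linear V -> W}) (x : V) (c : K) : continuous L ->
  (forall v, `|v| <= 1 -> `|h (x + v) - h x - L v| <= c * `|v| ^+ 2) ->
  differentiable h x /\ 'd h x = L :> (V -> W).
Proof.
move=> cL H.
have E : h \o shift x = cst (h x) + L +o_ 0 id.
  apply/eqaddoP => _/posnumP[e].
  near=> v; rewrite !fctE/=.
  have v1 : `|v| <= 1.
    by near: v; apply/nbhs_normP; exists 1 => //= v; rewrite /= sub0r normrN => /ltW.
  rewrite [v + x]addrC opprD addrA; apply: (le_trans (H v v1)).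
  have ve : `|v| <= e%:num / (`|c| + 1).
    near: v; apply/nbhs_normP; exists (e%:num / (`|c| + 1)) => /=.
      by rewrite divr_gt0// ltr_wpDl.
    by move=> v; rewrite /= sub0r normrN => /ltW.
  rewrite expr2 mulrA ler_wpM2r//.
  apply: (@le_trans _ _ ((`|c| + 1) * `|v|)).
    by rewrite ler_wpM2r// ler_wpDr// ler_norm.
  by rewrite mulrC -ler_pdivlMr// ltr_wpDl.
have dE : 'd h x = L :> (V -> W) by exact: diff_unique.
by split => //; apply/diff_locallyP; rewrite dE.
Unshelve. all: by end_near. Qed.

Section quadratic_remainder.
Variables (R : realType) (n : nat).
Local Notation Rn := 'rV[R]_n.
Local Notation C := (R[i]^o).
Local Notation ee i := (delta_mx 0 i : Rn) (only parsing).
Implicit Types (h : Rn -> R) (u w : Rn -> C) (x v : Rn).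

Definition coord_form (k : 'I_n -> R) v : R := \sum_i v 0 i * k i.

Lemma coord_form_is_linear k : linear (coord_form k).
Proof.
move=> a x y; rewrite /coord_form scaler_sumr -big_split/=.
by apply: eq_bigr => i _; rewrite !mxE mulrDl -mulrA.
Qed.

HB.instance Definition _ k :=
  GRing.isLinear.Build R Rn R *:%R (coord_form k) (coord_form_is_linear k).

Lemma coord_form_continuous k : continuous (coord_form k).
Proof.
move=> x; apply: (@differentiable_continuous R Rn R).
have -> : coord_form k = \sum_(i < n) (fun v => v 0 i * k i).
  by apply/funext => v; rewrite fct_sumE.
by apply: differentiable_sum => i; apply: differentiableM => //; exact: differentiable_coord.
Qed.

Lemma coord_form_delta k i : coord_form k (ee i) = k i.
Proof.
rewrite /coord_form (bigD1 i)//= mxE !eqxx mul1r big1 ?addr0// => j ji.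
by rewrite mxE (negbTE ji) andbF mul0r.
Qed.

Lemma differentiable_quadratic h x (k : 'I_n -> R) (c : R) :
  (forall v, `|v| <= 1 -> `|h (x + v) - h x - \sum_i v 0 i * k i| <= c * `|v| ^+ 2) ->
  differentiable h x /\ forall i, 'D_(ee i) h x = k i.
Proof.
move=> H; have [dh dE] := @differentiable_of_quadratic_remainder R Rn R h
  (coord_form k) x c (@coord_form_continuous k) H.
by split=> // i; rewrite deriveE// dE; exact: coord_form_delta.
Qed.

End quadratic_remainder.

Section complex_valued.
Variables (R : realType) (n : nat).
Local Notation Rn := 'rV[R]_n.
Local Notation C := (R[i]^o).
Local Notation Re := (@complex.Re R).
Local Notation Im := (@complex.Im R).
Implicit Types (u w : Rn -> C) (x v : Rn) (z : R[i]).

Lemma Re_normc z : `|Re z| <= normc z.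
Proof.
by case: z => a b /=; rewrite -sqrtr_sqr ler_sqrt ?addr_ge0 ?sqr_ge0// lerDl sqr_ge0.
Qed.

Lemma Im_normc z : `|Im z| <= normc z.
Proof.
by case: z => a b /=; rewrite -sqrtr_sqr ler_sqrt ?addr_ge0 ?sqr_ge0// lerDr sqr_ge0.
Qed.

Lemma normc_normr z : `|z| = (normc z)%:C.
Proof. by []. Qed.

Lemma normcN z : normc (- z) = normc z.
Proof. by apply: (@complexI R); rewrite -!normc_normr normrN. Qed.

Lemma normcB z1 z2 : normc (z1 - z2) = normc (z2 - z1).
Proof. by rewrite -normcN opprB. Qed.

Lemma normc_sum (I : Type) (r : seq I) (P : pred I) (F : I -> R[i]) :
  normc (\sum_(i <- r | P i) F i) <= \sum_(i <- r | P i) normc (F i).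
Proof.
elim/big_ind2: _ => [|a b c d h1 h2|//]; first by rewrite ComplexField.Normc.normc0.
by apply: (le_trans (normcD _ _)); exact: lerD.
Qed.

Lemma ReB z1 z2 : Re (z1 - z2) = Re z1 - Re z2.
Proof. by case: z1; case: z2. Qed.

Lemma ImB z1 z2 : Im (z1 - z2) = Im z1 - Im z2.
Proof. by case: z1; case: z2. Qed.

Lemma Re_sumZ (a : 'I_n -> R) (k : 'I_n -> R[i]) :
  Re (\sum_i (a i)%:C * k i) = \sum_i a i * Re (k i).
Proof.
apply: (big_ind2 (fun z r => Re z = r)) => [//|[? ?] ? [? ?] ? /= <- <- //|i _].
by case: (k i) => b c /=; rewrite mul0r subr0.
Qed.

Lemma Im_sumZ (a : 'I_n -> R) (k : 'I_n -> R[i]) :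
  Im (\sum_i (a i)%:C * k i) = \sum_i a i * Im (k i).
Proof.
apply: (big_ind2 (fun z r => Im z = r)) => [//|[? ?] ? [? ?] ? /= <- <- //|i _].
by case: (k i) => b c /=; rewrite mul0r addr0.
Qed.

Lemma complex_lipschitz u x v (K : R) : (forall y, cdifferentiable u y) ->
  (forall (t : R) i, 0 <= t <= 1 -> normc (partial i u (x + t *: v)) <= K) ->
  normc (u (x + v) - u x) <= 2 * (n%:R * K * `|v|).
Proof.
move=> du uK; apply: (le_trans (normc_le _)); rewrite mulr2n mulrDl mul1r ReB ImB.
apply: lerD.
- apply: (@real_lipschitz R n (Re \o u)) => [y|t i t01]; first exact: (du y).1.
  exact: le_trans (Re_normc _) (uK t i t01).
- apply: (@real_lipschitz R n (Im \o u)) => [y|t i t01]; first exact: (du y).2.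
  exact: le_trans (Im_normc _) (uK t i t01).
Qed.

Lemma complex_taylor2 u x v (K : R) : smooth u ->
  (forall i j y, normc (partial j (partial i u) y) <= K) ->
  normc (u (x + v) - u x - \sum_i (v 0 i)%:C * partial i u x) <=
    2 * (n%:R * (n%:R * K)) * `|v| ^+ 2.
Proof.
move=> su uK; apply: (le_trans (normc_le _)); rewrite -mulrA mulr2n mulrDl mul1r.
apply: lerD.
- rewrite !ReB Re_sumZ; apply: (@real_taylor2 R n (Re \o u)) => [y|i y|i j y].
  + exact: (su [::] y).1.
  + exact: (su [:: i] y).1.
  + exact: le_trans (Re_normc _) (uK i j y).
- rewrite !ImB Im_sumZ; apply: (@real_taylor2 R n (Im \o u)) => [y|i y|i j y].
  + exact: (su [::] y).2.
  + exact: (su [:: i] y).2.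
  + exact: le_trans (Im_normc _) (uK i j y).
Qed.

Lemma cdifferentiable_quadratic u x (k : 'I_n -> R[i]) (c : R) :
  (forall v, `|v| <= 1 ->
    normc (u (x + v) - u x - \sum_i (v 0 i)%:C * k i) <= c * `|v| ^+ 2) ->
  cdifferentiable u x /\ forall i, partial i u x = k i.
Proof.
move=> H.
have [v v1|dR kR] := @differentiable_quadratic R n (Re \o u) x (Re \o k) c.
  by rewrite /= -Re_sumZ -!ReB; apply: le_trans (Re_normc _) (H v v1).
have [v v1|dI kI] := @differentiable_quadratic R n (Im \o u) x (Im \o k) c.
  by rewrite /= -Im_sumZ -!ImB; apply: le_trans (Im_normc _) (H v v1).
by split => // i; rewrite /partial kR kI /=; case: (k i).
Qed.

End complex_valued.

(** * Symmetry of second derivatives *)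

Section schwarz.
Variables (R : realType) (n : nat).
Local Notation Rn := 'rV[R]_n.
Local Notation C := (R[i]^o).
Local Notation ee i := (delta_mx 0 i : Rn) (only parsing).
Implicit Types (h : Rn -> R) (u w : Rn -> C) (x v : Rn).

Lemma derive_scale_dir h x v (t : R) : differentiable h x ->
  'D_(t *: v) h x = t * 'D_v h x.
Proof. by move=> dh; rewrite !deriveE// linearZ. Qed.

Lemma norm_delta_le i : `|(ee i)| <= 1.
Proof.
apply: norm_rV_le => // j; rewrite mxE eqxx/=.
by case: (j == i); rewrite ?normr1 ?normr0.
Qed.

(** The second difference of [h] over a square of side [t]. The mean value theorem is used twice:
    along e_i for the difference function [phi], then along e_j for the i-th partial derivative of
    [h]. *)
Lemma mixed_increment h x i j (t : R) : (forall y, differentiable h y) ->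
  (forall y, differentiable ('D_(ee i) h) y) ->
  exists2 y, `|y - x| <= 2 * `|t| &
    h (t *: (ee j) + (x + t *: (ee i))) - h (x + t *: (ee i)) - (h (t *: (ee j) + x) - h x) =
    t * (t * 'D_(ee j) ('D_(ee i) h) y).
Proof.
move=> dh ddh; pose phi y := h (t *: (ee j) + y) - h y.
have dsh y : differentiable (fun y => h (t *: (ee j) + y)) y.
  exact: Defs.differentiable_shift.
have dphi y : differentiable phi y by exact: differentiableB.
have Dphi v y : 'D_v phi y = 'D_v h (t *: (ee j) + y) - 'D_v h y.
  have d1 : derivable (fun y => h (t *: (ee j) + y)) y v by exact: diff_derivable.
  have d2 : derivable h y v by exact: diff_derivable.
  rewrite [LHS](deriveB d1 d2); congr (_ - _).
  exact: (congr1 (@^~ y) (Defs.derive_shift h (t *: (ee j)) v)).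
have [a /andP[a0 a1]] := segment_MVT x (t *: (ee i)) dphi.
rewrite derive_scale_dir// Dphi; set z := x + a *: _.
have [b /andP[b0 b1]] := segment_MVT z (t *: (ee j)) ddh.
rewrite derive_scale_dir// addrC [z + _]addrC addrC => Eb Ea.
exists (z + b *: (t *: (ee j))); last by rewrite -Eb -Ea.
rewrite /z addrAC [x + _]addrC addrK mulr2n mulrDl mul1r.
have small (c : R) (k : 'I_n) : 0 <= c -> c <= 1 -> `|c *: (t *: (ee k))| <= `|t|.
  move=> c0 c1; rewrite !normrZ ger0_norm//.
  apply: (le_trans (ler_piMl _ c1)) => //.
  by apply: ler_piMr => //; exact: norm_delta_le.
by apply: (le_trans (ler_normD _ _)); apply: lerD; exact: small.
Qed.

(** The second difference over the square is symmetric in the two directions, so the two mixed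
    derivatives agree at two points within 2t of x; both are continuous at x. *)
Lemma real_schwarz h x i j : (forall y, differentiable h y) ->
  (forall k y, differentiable ('D_(ee k) h) y) ->
  (forall k l, differentiable ('D_(ee l) ('D_(ee k) h)) x) ->
  'D_(ee j) ('D_(ee i) h) x = 'D_(ee i) ('D_(ee j) h) x.
Proof.
move=> dh ddh dddh; apply/eqP; rewrite eq_le; apply/andP.
suff H k l : 'D_(ee l) ('D_(ee k) h) x <= 'D_(ee k) ('D_(ee l) h) x by split; exact: H.
apply/ler_addgt0Pr => e e0.
have c (a b : 'I_n) : exists2 d : R, 0 < d & forall y, `|y - x| <= d ->
    `|'D_(ee b) ('D_(ee a) h) y - 'D_(ee b) ('D_(ee a) h) x| <= e / 2.
  have /differentiable_continuous/cvgrPdist_le/(_ (e / 2)) := dddh a b.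
  rewrite divr_gt0// => /(_ isT)/nbhs_normP[d /= d0 H].
  exists (d / 2); first by rewrite divr_gt0.
  move=> y yd; rewrite distrC; apply: H => /=; rewrite distrC.
  by apply: le_lt_trans yd _; rewrite ltr_pdivrMr// mulr2n mulrDr mulr1 ltrDl.
have [d d0 Hd] := c k l; have [d' d'0 Hd'] := c l k.
pose t := Num.min d d' / 2; have t0 : 0 < t by rewrite divr_gt0// lt_min d0.
have tE : 2 * `|t| = Num.min d d'.
  by rewrite gtr0_norm// mulrC divfK.
have [y yx Ey] := @mixed_increment h x k l t dh (ddh k).
have [y' y'x Ey'] := @mixed_increment h x l k t dh (ddh l).
have E : 'D_(ee l) ('D_(ee k) h) y = 'D_(ee k) ('D_(ee l) h) y'.
  apply: (mulfI (lt0r_neq0 t0)); apply: (mulfI (lt0r_neq0 t0)).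
  apply: (etrans (esym Ey)); apply: (etrans _ Ey').
  have -> : t *: ee l + (x + t *: ee k) = t *: ee k + (x + t *: ee l).
    by rewrite addrC addrAC addrC.
  by rewrite (addrC x (t *: ee k)) (addrC x (t *: ee l)); ring.
have yd : `|y - x| <= d.
  by apply: (le_trans yx); rewrite tE; rewrite ge_min lexx.
have y'd : `|y' - x| <= d'.
  by apply: (le_trans y'x); rewrite tE; rewrite ge_min lexx orbT.
have {}Hd := Hd y yd; have {}Hd' := Hd' y' y'd; move: Hd Hd'; rewrite -E.
move: ('D_(ee l) ('D_(ee k) h) y) ('D_(ee l) ('D_(ee k) h) x)
  ('D_(ee k) ('D_(ee l) h) x) => p q r.
by rewrite !ler_norml => /andP[h1 h2] /andP[h3 h4]; lra.
Qed.

Lemma partialC i j u : smooth u -> partial j (partial i u) = partial i (partial j u).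
Proof.
move=> su; apply/funext => x.
have ReE k w : @complex.Re R \o partial k w = 'D_(ee k) (@complex.Re R \o w) by [].
have ImE k w : @complex.Im R \o partial k w = 'D_(ee k) (@complex.Im R \o w) by [].
rewrite {1}/partial {2}/partial !ReE !ImE.
have -> := @real_schwarz (@complex.Re R \o u) x i j (fun y => (su [::] y).1)
  (fun k y => (su [:: k] y).1) (fun k l => (su [:: l; k] x).1).
by have -> := @real_schwarz (@complex.Im R \o u) x i j (fun y => (su [::] y).2)
  (fun k y => (su [:: k] y).2) (fun k l => (su [:: l; k] x).2).
Qed.

Lemma mpartial_cat s t u : mpartial (s ++ t) u = mpartial s (mpartial t u).
Proof. exact: foldr_cat. Qed.

Lemma mpartial_rcons s i u : mpartial (rcons s i) u = mpartial s (partial i u).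
Proof. by rewrite -cats1 mpartial_cat. Qed.

Lemma smooth_mpartial s u : smooth u -> smooth (mpartial s u).
Proof. by move=> su t x; rewrite -mpartial_cat; exact: su. Qed.

Lemma smooth_partial i u : smooth u -> smooth (partial i u).
Proof. exact: (@smooth_mpartial [:: i]). Qed.

Lemma mpartial_partial s i u : smooth u ->
  mpartial s (partial i u) = partial i (mpartial s u).
Proof.
by move=> su; elim: s => //= j s ->; rewrite partialC//; exact: smooth_mpartial.
Qed.

Lemma mpartial_perm s t u : smooth u -> perm_eq s t -> mpartial s u = mpartial t u.
Proof.
move=> su; elim: s t => [|i s IH] t.
  by rewrite perm_sym => /perm_nilP ->.
move=> /[dup] /perm_mem/(_ i); rewrite mem_head => /esym/splitPr[t1 t2] st.
have {}st : perm_eq s (t1 ++ t2).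
  by rewrite -(perm_cons i) (perm_trans st)// perm_catC cat_cons perm_cons perm_catC.
rewrite /= (IH _ st) !mpartial_cat /= mpartial_partial//; exact: smooth_mpartial.
Qed.

(** Sorting a list of directions gives the block form in which [mderiv] differentiates. *)
Lemma perm_flatten_count (s : seq 'I_n) :
  perm_eq s (flatten [seq nseq (count_mem i s) i | i <- enum 'I_n]).
Proof.
apply/allP => j _ /=; rewrite count_flatten -map_comp sumnE big_map big_enum/=.
rewrite (bigD1 j)//= count_nseq /= eqxx mul1n big1 ?addn0// => i ij.
by rewrite count_nseq /= (negbTE ij).
Qed.

Lemma mpartial_mderiv s u : smooth u ->
  mpartial s u = mderiv [ffun i => count_mem i s] u.
Proof.
move=> su; apply: mpartial_perm => //; apply: (perm_trans (perm_flatten_count s)).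
by under [X in perm_eq _ (flatten X)]eq_map do rewrite ffunE.
Qed.

Lemma size_flatten_nseq (q : multiindex n) :
  size (flatten [seq nseq (q i) i | i <- enum 'I_n]) = msize q.
Proof.
rewrite size_flatten /shape -map_comp sumnE big_map big_enum/=.
by apply: eq_bigr => i _; rewrite size_nseq.
Qed.

Lemma msize_count (s : seq 'I_n) : msize [ffun i => count_mem i s] = size s.
Proof.
rewrite (perm_size (perm_flatten_count s)) -size_flatten_nseq.
by under eq_map do rewrite ffunE.
Qed.

End schwarz.

(** * Products and dilations of smooth functions *)

Section smooth_operations.
Variables (R : realType) (n : nat).
Local Notation Rn := 'rV[R]_n.
Local Notation C := (R[i]^o).
Local Notation ee i := (delta_mx 0 i : Rn) (only parsing).
Implicit Types (h : Rn -> R) (u w : Rn -> C) (x v : Rn).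

(** Iterated derivatives never leave [A]. Smoothness of products and of bump functions is thereby
    reduced to finding a class stable under one differentiation. *)
Lemma smooth_closure (A : (Rn -> C) -> Prop) u :
  (forall w, A w -> (forall x, cdifferentiable w x) /\ forall i, A (partial i w)) ->
  A u -> smooth u.
Proof.
move=> HA Au s; suff /HA[] : A (mpartial s u) by [].
by elim: s => //= i s /HA[_]; apply.
Qed.

Lemma mpartial_near_eq (O : set Rn) u w s : open O ->
  (forall y, O y -> u y = w y) -> forall y, O y -> mpartial s u y = mpartial s w y.
Proof.
move=> oO uw; elim: s => //= i s IH y Oy.
have nO : \near y, O y by apply: open_nbhs_nbhs.
by congr (_ +i* _); apply: near_eq_derive; apply: filterS nO => z /IH /= ->.
Qed.

Lemma mpartial_near0 (O : set Rn) u s : open O ->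
  (forall y, O y -> u y = 0) -> forall y, O y -> mpartial s u y = 0.
Proof.
by move=> oO u0 y Oy; rewrite (mpartial_near_eq (w := 0) s oO)// mpartial0.
Qed.

Lemma Re_mul u w : @complex.Re R \o (fun x => u x * w x) =
  (@complex.Re R \o u) * (@complex.Re R \o w) - (@complex.Im R \o u) * (@complex.Im R \o w).
Proof. by apply/funext => x; rewrite !fctE /=; case: (u x) (w x) => ? ? [? ?]. Qed.

Lemma Im_mul u w : @complex.Im R \o (fun x => u x * w x) =
  (@complex.Re R \o u) * (@complex.Im R \o w) + (@complex.Im R \o u) * (@complex.Re R \o w).
Proof. by apply/funext => x; rewrite !fctE /=; case: (u x) (w x) => ? ? [? ?]. Qed.

Lemma cdifferentiableM u w x : cdifferentiable u x -> cdifferentiable w x ->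
  cdifferentiable (fun x => u x * w x) x.
Proof.
move=> [u1 u2] [w1 w2]; split.
  by rewrite Re_mul; apply: differentiableB; apply: differentiableM.
by rewrite Im_mul; apply: differentiableD; apply: differentiableM.
Qed.

Lemma partialM i u w : (forall x, cdifferentiable u x) -> (forall x, cdifferentiable w x) ->
  partial i (fun x => u x * w x) = (fun x => partial i u x * w x) + (fun x => u x * partial i w x).
Proof.
move=> du dw; apply/funext => x.
have [/diff_derivable-/(_ (ee i)) u1 /diff_derivable-/(_ (ee i)) u2] := du x.
have [/diff_derivable-/(_ (ee i)) w1 /diff_derivable-/(_ (ee i)) w2] := dw x.
rewrite {1}/partial Re_mul Im_mul.
have -> := deriveB (derivableM u1 w1) (derivableM u2 w2).
have -> := deriveD (derivableM u1 w2) (derivableM u2 w1).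
have -> := deriveM u1 w1; have -> := deriveM u2 w2.
have -> := deriveM u1 w2; have -> := deriveM u2 w1.
rewrite !fctE /partial /GRing.scale /=.
move: ('D_ _ _ _) ('D_ _ _ _) ('D_ _ _ _) ('D_ _ _ _) => a b c d /=.
case: (u x) => p q; case: (w x) => r s.
by congr (_ +i* _) => /=; ring.
Qed.

(** One differentiation turns a product of smooth functions into a sum of two such products;
    allowing sums makes the class stable. *)
Inductive sum_of_products : (Rn -> C) -> Prop :=
| SumProd_mul u w : smooth u -> smooth w -> sum_of_products (fun x => u x * w x)
| SumProd_add u w : sum_of_products u -> sum_of_products w -> sum_of_products (u + w).

Lemma smoothM u w : smooth u -> smooth w -> smooth (fun x => u x * w x).
Proof.
move=> su sw; apply: (smooth_closure (A := sum_of_products)); last exact: SumProd_mul.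
move=> {u w su sw} z; elim=> {z} [u w su sw|u w _ [du Au] _ [dw Aw]].
  split=> [x|i]; first by apply: cdifferentiableM; [exact: (su [::])|exact: (sw [::])].
  rewrite partialM; [|exact: (su [::])|exact: (sw [::])].
  by apply: SumProd_add; apply: SumProd_mul => //; exact: smooth_partial.
rewrite -[u]scale1r; split=> [x|i]; first exact: cdifferentiable_lin.
by rewrite partial_lin// scale1r; exact: SumProd_add.
Qed.

Lemma mpartialD s u w : smooth u -> smooth w ->
  mpartial s (u + w) = mpartial s u + mpartial s w.
Proof. by move=> su sw; rewrite -[u]scale1r mpartial_lin// !scale1r. Qed.

Lemma mpartialZ s (a : R[i]) u : smooth u -> mpartial s (a *: u) = a *: mpartial s u.
Proof.
by move=> su; rewrite -[a *: u]addr0 mpartial_lin ?mpartial0 ?addr0//; exact: smooth0.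
Qed.

(** Each differentiation doubles the number of products, whence the power of 2. *)
Lemma leibniz_bound s u w x (a b : R) : smooth u -> smooth w ->
  (forall t, (size t <= size s)%N -> normc (mpartial t u x) <= a) ->
  (forall t, (size t <= size s)%N -> normc (mpartial t w x) <= b) ->
  normc (mpartial s (fun x => u x * w x) x) <= 2 ^+ size s * (a * b).
Proof.
(* The last direction of the list is the innermost derivative, the one that meets the product
   itself. Splitting it off leaves a shorter derivative of two products, with new factors. *)
elim/last_ind: s u w => [|s i IH] u w su sw ua wb.
  by rewrite /= mul1r normcM ler_pM ?normc_ge0//; [exact: (ua [::])|exact: (wb [::])].
rewrite size_rcons in ua wb *.
have [su' sw'] := (smooth_partial i su, smooth_partial i sw).
rewrite mpartial_rcons partialM; [|exact: (su [::])|exact: (sw [::])].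
rewrite mpartialD; [|exact: smoothM|exact: smoothM].
rewrite exprS -mulrA mulr2n mulrDl mul1r.
apply: (le_trans (normcD _ _)); apply: lerD; apply: IH => // t ts.
- by rewrite -mpartial_rcons; apply: ua; rewrite size_rcons ltnS.
- by apply: wb; exact: leqW.
- by apply: ua; exact: leqW.
- by rewrite -mpartial_rcons; apply: wb; rewrite size_rcons ltnS.
Qed.

Lemma derive_dilation h (a : R) x v : differentiable h (a *: x) ->
  'D_v (fun y => h (a *: y)) x = a * 'D_v h (a *: x).
Proof.
move=> dh; rewrite -derive_scale_dir// /derive.
set F := (X in lim (X @ _)); set G := (X in _ = lim (X @ _)).
suff -> : F = G by [].
by apply/funext => t; rewrite /F /G /=; congr (_ *: (h _ - _)); rewrite scalerDr !scalerA mulrC.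
Qed.

Lemma cdifferentiable_dilation u (a : R) x : cdifferentiable u (a *: x) ->
  cdifferentiable (fun y => u (a *: y)) x.
Proof.
move=> [u1 u2].
have d : differentiable (fun y : Rn => a *: y) x by exact: ex_diff.
by split; [exact: (differentiable_comp d u1)|exact: (differentiable_comp d u2)].
Qed.

Lemma mpartial_dilation s u (a : R) : smooth u ->
  mpartial s (fun y => u (a *: y)) = fun y => ((a ^+ size s)%:C : R[i]) * mpartial s u (a *: y).
Proof.
move=> su; elim: s => [|i s IH]; first by apply/funext => y; rewrite /= mul1r.
have D : forall y, cdifferentiable (fun y => mpartial s u (a *: y)) y.
  by move=> y; apply: cdifferentiable_dilation; exact: su.
rewrite /= IH; apply/funext => y.
have -> : (fun y => ((a ^+ size s)%:C : R[i]) * mpartial s u (a *: y)) =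
    ((a ^+ size s)%:C : R[i]) *: (fun y => mpartial s u (a *: y)) + 0.
  by rewrite addr0.
rewrite partial_lin//; last by move=> z; exact: (@smooth0 R n [::] z).
rewrite partial0 addr0 !fctE exprSr rmorphM /GRing.scale/= -mulrA; congr (_ * _).
rewrite /partial (derive_dilation (h := @complex.Re R \o mpartial s u)); last exact: (su s _).1.
rewrite (derive_dilation (h := @complex.Im R \o mpartial s u)); last exact: (su s _).2.
by congr (_ +i* _) => /=; rewrite mul0r ?subr0 ?addr0.
Qed.

Lemma smooth_dilation u (a : R) : smooth u -> smooth (fun y => u (a *: y)).
Proof.
move=> su s x; rewrite mpartial_dilation//.
have -> : (fun y => ((a ^+ size s)%:C : R[i]) * mpartial s u (a *: y)) =
    ((a ^+ size s)%:C : R[i]) *: (fun y => mpartial s u (a *: y)) + 0.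
  by rewrite addr0.
apply: cdifferentiable_lin; last exact: (@smooth0 R n [::]).
by apply: cdifferentiable_dilation; exact: su.
Qed.

End smooth_operations.

(** * Bump functions *)

Section bump.
Variables (R : realType).

(** The function exp(-1/t) extended by 0, with an extra pole of order [k]: the family is stable
    under differentiation, the derivative at index k being a combination of the indices k+1 and
    k+2. *)
Definition flat_exp (k : nat) (t : R) : R :=
  if 0 < t then t^-1 ^+ k * expR (- t^-1) else 0.

Lemma flat_exp_ge0 k t : 0 <= flat_exp k t.
Proof.
rewrite /flat_exp; case: ifP => // t0.
by rewrite mulr_ge0// ?expR_ge0// exprn_ge0// invr_ge0 ltW.
Qed.

(** With y = 1/t, exp y dominates the single term y^(k+2)/(k+2)! of its series. The quadratic bound
    is what gives derivative 0 at the origin. *)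
Lemma flat_exp_le k t : flat_exp k t <= (k.+2)`!%:R * t ^+ 2.
Proof.
rewrite /flat_exp; case: ifP => [t0|_]; last by rewrite mulr_ge0 ?sqr_ge0.
have y0 : 0 < t^-1 by rewrite invr_gt0.
have := expR_ge1Dxn k.+1 (ltW y0); set y := t^-1 => H.
have {}H : y ^+ k.+2 / k.+2`!%:R <= expR y by apply: le_trans H; rewrite lerDr.
have f0 : 0 < k.+2`!%:R :> R by rewrite ltr0n fact_gt0.
have -> : t = y^-1 by rewrite /y invrK.
rewrite expRN ler_pdivrMr ?expR_gt0//.
have c0 : 0 <= (k.+2)`!%:R * y^-1 ^+ 2 by rewrite mulr_ge0 ?sqr_ge0.
apply: le_trans (ler_wpM2l c0 H).
have alg (a b c : R) : b != 0 -> c != 0 -> b * c^-1 ^+ 2 * (a * c ^+ 2 / b) = a.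
  by move=> b0 c0'; field; rewrite b0 c0'.
by rewrite -addn2 exprD alg// gt_eqF// addn2.
Qed.

Lemma is_derive_flat_exp k (t : R) :
  is_derive t (1 : R) (flat_exp k) (flat_exp k.+2 t - k%:R * flat_exp k.+1 t).
Proof.
have [t0|t0|->] := ltgtP t 0.
- have tF : (0 < t) = false by rewrite ltNge ltW.
  rewrite [flat_exp k.+2 t]/flat_exp [flat_exp k.+1 t]/flat_exp tF mulr0 subr0.
  apply: (near_eq_is_derive (f := cst (0 : R))).
  near=> s; have s0 : s < 0 by near: s; exact: lt_nbhsl.
  by rewrite /cst /flat_exp ltNge ltW.
- have dV : is_derive t (1 : R) (fun s : R => s^-1) (- t ^- 2 *: 1).
    by apply: is_deriveV; rewrite gt_eqF.
  have dX := is_deriveX k dV.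
  have dE := @is_derive1_comp _ expR (fun s => - s^-1) t _ _
    (is_derive_expR (- t^-1)) (is_deriveN dV).
  have D : is_derive t (1 : R) (fun s => s^-1 ^+ k * expR (- s^-1))
      (flat_exp k.+2 t - k%:R * flat_exp k.+1 t).
    have := is_deriveM dX dE; rewrite ?fctE/= /GRing.scale/= => D.
    apply: (is_derive_eq D); rewrite /flat_exp t0 !mulr1 opprK -exprVn !exprS expr0 !mulr1.
    case: k {D dX} => [|k] /=; first by rewrite !mul0r !mulr0; ring.
    by rewrite -mulr_natl exprS; ring.
  apply: (near_eq_is_derive _ D).
  near=> s; have s0 : 0 < s by near: s; exact: lt_nbhsr.
  by rewrite /flat_exp s0.
- rewrite /flat_exp ltxx mulr0 subr0.
  have [v v1|d0 dE] := @differentiable_of_quadratic_remainder R R R (flat_exp k)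
    (\0 : {linear R -> R}) 0 (k.+2)`!%:R (@cst_continuous _ _ 0).
    rewrite add0r /flat_exp ltxx !subr0 -/(flat_exp k v) ger0_norm ?flat_exp_ge0//.
    by rewrite real_normK ?num_real//; exact: flat_exp_le.
  by apply: DeriveDef; [exact: diff_derivable|rewrite deriveE// dE].
Unshelve. all: by end_near. Qed.

(** A class closed under differentiation that contains the cutoffs of one variable: inverses serve
    the quotient in [smooth_step], affine substitutions its reflections and shifts. *)
Inductive step_algebra : (R -> R) -> Prop :=
| StepAlg_cst c : step_algebra (fun=> c)
| StepAlg_flat k : step_algebra (flat_exp k)
| StepAlg_affine h a b : step_algebra h -> step_algebra (fun t => h (a * t + b))
| StepAlg_add g h : step_algebra g -> step_algebra h -> step_algebra (fun t => g t + h t)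
| StepAlg_mul g h : step_algebra g -> step_algebra h -> step_algebra (fun t => g t * h t)
| StepAlg_inv h : step_algebra h -> (forall t, h t != 0) -> step_algebra (fun t => (h t)^-1).

Lemma step_algebra_derive h : step_algebra h ->
  exists2 h', step_algebra h' & forall t : R, is_derive t (1 : R) h (h' t).
Proof.
elim=> {h} [c|k|h a b _ [h' Ah' dh]|g h Ag [g' Ag' dg] Ah [h' Ah' dh]|
    g h Ag [g' Ag' dg] Ah [h' Ah' dh]|h Ah [h' Ah' dh] h0].
- by exists (fun=> 0) => [|t]; [exact: StepAlg_cst|exact: is_derive_cst].
- exists (fun t => flat_exp k.+2 t + - k%:R * flat_exp k.+1 t).
    apply: StepAlg_add; first exact: StepAlg_flat.
    by apply: StepAlg_mul; [exact: StepAlg_cst|exact: StepAlg_flat].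
  by move=> t; rewrite mulNr; exact: is_derive_flat_exp.
- exists (fun t => h' (a * t + b) * a).
    by apply: StepAlg_mul; [exact: StepAlg_affine|exact: StepAlg_cst].
  move=> t; apply: is_derive1_comp.
  have := is_deriveD (is_deriveZ a (is_derive_id t (1 : R))) (is_derive_cst b t 1).
  by rewrite ?fctE/= /GRing.scale/= => D; apply: (is_derive_eq D); rewrite addr0 mulr1.
- exists (fun t => g' t + h' t); first exact: StepAlg_add.
  by move=> t; exact: is_deriveD.
- exists (fun t => g t * h' t + h t * g' t).
    by apply: StepAlg_add; exact: StepAlg_mul.
  by move=> t; exact: is_deriveM.
- exists (fun t => (-1) * ((h t)^-1 * (h t)^-1) * h' t).
    apply: StepAlg_mul => //; apply: StepAlg_mul; first exact: StepAlg_cst.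
    by apply: StepAlg_mul; exact: StepAlg_inv.
  move=> t; apply: (is_derive_eq (is_deriveV (h0 t) (dh t))).
  by rewrite -[_ *: _]/(_ * _) expr2 invfM mulN1r.
Qed.

(** A smooth transition from 0 for t <= 0 to 1 for t >= 1; the denominator is positive because [t]
    or [1 - t] is. *)
Definition smooth_step (t : R) : R :=
  flat_exp 0 t / (flat_exp 0 t + flat_exp 0 (1 - t)).

Lemma flat_exp_gt0 k t : 0 < t -> 0 < flat_exp k t.
Proof. by move=> t0; rewrite /flat_exp t0 mulr_gt0 ?expR_gt0// exprn_gt0 ?invr_gt0. Qed.

Lemma smooth_step_denom t : flat_exp 0 t + flat_exp 0 (1 - t) != 0.
Proof.
have [t0|t0] := ltP 0 t; first by rewrite gt_eqF// ltr_wpDr ?flat_exp_ge0 ?flat_exp_gt0.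
by rewrite gt_eqF// ltr_wpDl ?flat_exp_ge0 ?flat_exp_gt0//; lra.
Qed.

Lemma smooth_step0 t : t <= 0 -> smooth_step t = 0.
Proof. by move=> t0; rewrite /smooth_step {1}/flat_exp ltNge t0 mul0r. Qed.

Lemma smooth_step1 t : 1 <= t -> smooth_step t = 1.
Proof.
move=> t1; rewrite /smooth_step [flat_exp 0 (1 - t)]/flat_exp.
rewrite [0 < _](_ : _ = false) ?addr0 ?divff//; last by rewrite ltNge subr_le0 t1.
by rewrite gt_eqF// flat_exp_gt0//; lra.
Qed.

Definition plateau (t : R) : R := smooth_step (2 - t) * smooth_step (2 + t).

Lemma step_algebra_smooth_step : step_algebra smooth_step.
Proof.
apply: StepAlg_mul; first exact: StepAlg_flat.
apply: StepAlg_inv; last exact: smooth_step_denom.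
apply: StepAlg_add; first exact: StepAlg_flat.
rewrite (_ : (fun t => _) = (fun t => flat_exp 0 ((-1) * t + 1))).
  by apply: StepAlg_affine; exact: StepAlg_flat.
by apply/funext => t; rewrite mulN1r addrC.
Qed.

Lemma step_algebra_plateau : step_algebra plateau.
Proof.
rewrite (_ : plateau = (fun t => smooth_step ((-1) * t + 2) * smooth_step (1 * t + 2))).
  by apply: StepAlg_mul; apply: StepAlg_affine; exact: step_algebra_smooth_step.
by apply/funext => t; rewrite mulN1r mul1r [- t + _]addrC [t + _]addrC.
Qed.

Lemma plateau1 t : `|t| <= 1 -> plateau t = 1.
Proof.
by rewrite ler_norml => /andP[t1 t2]; rewrite /plateau !smooth_step1 ?mulr1//; lra.
Qed.

Lemma plateau0 t : 2 < `|t| -> plateau t = 0.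
Proof.
rewrite lter_normr => /orP[t2|t2].
  by rewrite /plateau smooth_step0 ?mul0r//; lra.
by rewrite /plateau [smooth_step (2 + t)]smooth_step0 ?mulr0//; lra.
Qed.

End bump.

Section bump_rV.
Variables (R : realType) (n : nat).
Local Notation Rn := 'rV[R]_n.
Local Notation C := (R[i]^o).
Local Notation ee i := (delta_mx 0 i : Rn) (only parsing).

(** The j-th derivative of a function of the i-th coordinate is a Kronecker delta times another such
    function, which is why constants are generators. *)
Inductive bump_algebra : (Rn -> R) -> Prop :=
| BumpAlg_coord h i : step_algebra h -> bump_algebra (fun x => h (x 0 i))
| BumpAlg_cst c : bump_algebra (cst c)
| BumpAlg_add g h : bump_algebra g -> bump_algebra h -> bump_algebra (g + h)
| BumpAlg_mul g h : bump_algebra g -> bump_algebra h -> bump_algebra (g * h).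

Lemma bump_algebra_derive h : bump_algebra h ->
  (forall x, differentiable h x) /\ forall i, bump_algebra ('D_(ee i) h).
Proof.
elim=> {h} [h i /step_algebra_derive[h' Ah' dh]|c|g h Ag [dg Ag'] Ah [dh Ah']|
  g h Ag [dg Ag'] Ah [dh Ah']].
- split=> [x|j].
    apply: (differentiable_comp (f := fun x : Rn => x 0 i) (g := h)).
      exact: differentiable_coord.
    by apply/derivable1_diffP; have [] := dh (x 0 i).
  rewrite (_ : 'D__ _ = (cst ((i == j)%:R) * (fun x : Rn => h' (x 0 i)))).
    by apply: BumpAlg_mul; [exact: BumpAlg_cst|exact: BumpAlg_coord].
  apply/funext => x; rewrite fctE /=.
  have -> : 'D_(ee j) (fun x : Rn => h (x 0 i)) x = 'D_((i == j)%:R : R) h (x 0 i).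
    rewrite /derive; set F := (X in lim (X @ _)); set G := (X in _ = lim (X @ _)).
    suff -> : F = G by [].
    by apply/funext => t; rewrite /F /G /= !mxE eqxx (eq_sym i).
  case: eqP => _; last by rewrite derive0 mul0r.
  by have D := dh (x 0 i); rewrite (@derive_val _ _ _ _ _ _ _ D) mul1r.
- split=> [x|i]; first exact: differentiable_cst.
  rewrite (_ : 'D__ _ = cst 0); first exact: BumpAlg_cst.
  by apply/funext => x; rewrite derive_cst.
- split=> [x|i]; first exact: differentiableD.
  rewrite (_ : 'D__ _ = 'D_(ee i) g + 'D_(ee i) h); first exact: BumpAlg_add.
  apply/funext => x.
  exact: (deriveD (diff_derivable (dg x)) (diff_derivable (dh x))).
- split=> [x|i]; first exact: differentiableM.
  rewrite (_ : 'D__ _ = g * 'D_(ee i) h + h * 'D_(ee i) g).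
    by apply: BumpAlg_add; exact: BumpAlg_mul.
  apply/funext => x.
  exact: (deriveM (diff_derivable (dg x)) (diff_derivable (dh x))).
Qed.

Lemma smooth_bump_algebra h : bump_algebra h -> smooth (fun x => (h x)%:C : C).
Proof.
move=> Ah.
apply: (smooth_closure (A := fun u => exists2 h, bump_algebra h & u = fun x => (h x)%:C)).
  move=> _ [{Ah} {}h /bump_algebra_derive[dh Ah] ->].
  split=> [x|i]; first by split=> //; exact: differentiable_cst.
  exists ('D_(ee i) h) => //; apply/funext => x.
  congr (_ +i* _); exact: (derive_cst (0 : R)).
by exists h.
Qed.

(** A product of plateaus over the coordinates fits the sup norm: |x| <= 1 constrains every
    coordinate, and |x| > 2 pushes at least one coordinate beyond 2. *)
Lemma exists_bump : exists phi : Rn -> C, [/\ smooth phi,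
  forall x, `|x| <= 1 -> phi x = 1 & forall x, 2 < `|x| -> phi x = 0].
Proof.
exists (fun x => (\prod_i plateau (x 0 i))%:C); split=> [|x x1|x x2].
- apply: smooth_bump_algebra; elim: (index_enum _) => [|i r IH].
    rewrite (_ : (fun x => _) = cst 1); first exact: BumpAlg_cst.
    by apply/funext => x; rewrite big_nil.
  rewrite (_ : (fun x => _) = (fun x : Rn => plateau (x 0 i)) *
      (fun x : Rn => \prod_(i <- r) plateau (x 0 i))).
    by apply: BumpAlg_mul => //; apply: BumpAlg_coord; exact: step_algebra_plateau.
  by apply/funext => x; rewrite big_cons.
- rewrite big1// => i _; apply: plateau1.
  by apply: le_trans x1; exact: coord_le_norm.
- have [i xi] : exists i, 2 < `|x 0 i|.
    apply: contrapT => /forallNP H; suff : `|x| <= 2 by rewrite leNgt x2.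
    by apply: norm_rV_le => // i; rewrite leNgt; apply/negP/H.
  by rewrite (bigD1 i)//= plateau0// mul0r.
Qed.

End bump_rV.

(** * Seminorms and the topology of test functions *)

Section linear_maps.
Variables (K : nzRingType) (V W : lmodType K) (f : V -> W).
Hypothesis lf : linear f.

Let F : {linear V -> W} := HB.pack f (GRing.isLinear.Build K V W *:%R f lf).

Lemma linear_mapD x y : f (x + y) = f x + f y.
Proof. exact: (linearD F). Qed.

Lemma linear_mapB x y : f (x - y) = f x - f y.
Proof. exact: (linearB F). Qed.

Lemma linear_mapZ a x : f (a *: x) = a *: f x.
Proof. exact: (linearZ_LR F). Qed.

Lemma linear_map_sum (I : Type) (r : seq I) (P : pred I) (v : I -> V) :
  f (\sum_(i <- r | P i) v i) = \sum_(i <- r | P i) f (v i).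
Proof. exact: (linear_sum F). Qed.

End linear_maps.

Section weighted_bounds.
Variables (R : realType) (n : nat).
Local Notation Rn := 'rV[R]_n.
Local Notation C := (R[i]^o).
Implicit Types (u w : Rn -> C) (x y v : Rn).

(** A bound rather than a supremum, so that no finiteness has to be known beforehand. One index [p]
    limits both the weight and the order of derivatives, which makes these bounds increase with
    [p]. *)
Definition wbound (p : nat) (A : R) u := forall x s, (size s <= p)%N ->
  (1 + `|x|) ^+ p * normc (mpartial s u x) <= A.

Definition lbound (M : R) (p : nat) (A : R) u := forall x s, `|x| <= M ->
  (size s <= p)%N -> normc (mpartial s u x) <= A.

Lemma weight_ge1 x p : 1 <= (1 + `|x|) ^+ p.
Proof. by rewrite exprn_ege1// lerDl. Qed.

Lemma weight_gt0 x p : 0 < (1 + `|x|) ^+ p.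
Proof. exact: lt_le_trans ltr01 (weight_ge1 x p). Qed.

Lemma weight_ge0 x p : 0 <= (1 + `|x|) ^+ p.
Proof. exact: ltW (weight_gt0 x p). Qed.

Lemma wbound_pointwise p A u x s : wbound p A u -> (size s <= p)%N ->
  normc (mpartial s u x) <= A.
Proof.
move=> uA sp; apply: le_trans (uA x s sp).
by rewrite ler_peMl ?normc_ge0// weight_ge1.
Qed.

Lemma wbound_ge0 p A u : wbound p A u -> 0 <= A.
Proof.
by move=> uA; apply: le_trans (wbound_pointwise 0 uA (leq0n _) (s := [::])); exact: normc_ge0.
Qed.

Lemma wbound_lbound M p A u : wbound p A u -> lbound M p A u.
Proof. by move=> uA x s _; exact: wbound_pointwise. Qed.

Lemma wbound_le p A B u : A <= B -> wbound p A u -> wbound p B u.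
Proof. by move=> AB uA x s sp; exact: le_trans (uA x s sp) AB. Qed.

Lemma wbound_order p q A u : (p <= q)%N -> wbound q A u -> wbound p A u.
Proof.
move=> pq uA x s sp; apply: le_trans (uA x s (leq_trans sp pq)).
by rewrite ler_wpM2r ?normc_ge0// ler_weXn2l// lerDl.
Qed.

Lemma mpartialB s u w : smooth u -> smooth w ->
  mpartial s (u - w) = mpartial s u - mpartial s w.
Proof.
move=> su sw; rewrite mpartialD//; last by rewrite -scaleN1r -[_ *: _]addr0;
  apply: smooth_lin => //; exact: smooth0.
by rewrite -[- w]scaleN1r mpartialZ// scaleN1r.
Qed.

Lemma wboundD p A B u w : smooth u -> smooth w ->
  wbound p A u -> wbound p B w -> wbound p (A + B) (u + w).
Proof.
move=> su sw uA wB x s sp; rewrite mpartialD//.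
apply: le_trans (lerD (uA x s sp) (wB x s sp)).
by rewrite -mulrDr; apply: ler_wpM2l; [exact: weight_ge0|exact: normcD].
Qed.

Lemma wboundB p A B u w : smooth u -> smooth w ->
  wbound p A u -> wbound p B w -> wbound p (A + B) (u - w).
Proof.
move=> su sw uA wB x s sp; rewrite mpartialB//.
apply: le_trans (lerD (uA x s sp) (wB x s sp)).
rewrite -mulrDr; apply: ler_wpM2l; first exact: weight_ge0.
by apply: (le_trans (normcD _ _)); rewrite normcN.
Qed.

Lemma wboundZ p A (a : R[i]) u : smooth u -> wbound p A u -> wbound p (normc a * A) (a *: u).
Proof.
move=> su uA x s sp; rewrite mpartialZ// [X in normc X](_ : _ = a * mpartial s u x)//.
by rewrite normcM mulrCA ler_wpM2l ?normc_ge0// uA.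
Qed.

Lemma monomial_le (k : multiindex n) x : `|monomial k x| <= (1 + `|x|) ^+ msize k.
Proof.
rewrite /monomial normr_prod /msize -prodrXr.
apply: ler_prod => i _; rewrite normr_ge0/= normrX lerXn2r ?nnegrE ?addr_ge0//.
by apply: (le_trans (coord_le_norm _ _)); rewrite lerDr.
Qed.

Lemma wbound_normS p A u : wbound p A u -> normS p u <= A.
Proof.
move=> uA; apply: normS_le => x k q kp qp; rewrite normcM normc_real.
apply: le_trans (uA x (flatten [seq nseq (q i) i | i <- enum 'I_n]) _).
  rewrite ler_wpM2r ?normc_ge0//; apply: (le_trans (monomial_le _ _)).
  by rewrite ler_weXn2l// lerDl.
by rewrite size_flatten_nseq.
Qed.

Lemma wbound_normD m p A u : wbound p A u -> normD m p u <= A.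
Proof.
move=> uA; apply: normD_le => x q _ qp.
by apply: (wbound_pointwise x uA); rewrite size_flatten_nseq.
Qed.

Lemma exists_norm_coord x : 1 <= `|x| -> exists i, `|x| <= `|x 0 i|.
Proof.
move=> x1; apply: contrapT => /forallNP H.
have : `|x| < `|x|; last by rewrite ltxx.
rewrite [ltLHS]/Num.norm /= mx_normrE; apply/bigmax_ltP; split.
  exact: lt_le_trans ltr01 x1.
by move=> -[i j] _ /=; rewrite ltNge ord1; apply/negP/H.
Qed.

(** Where |x| <= 1 the weight is at most 2^p and the trivial monomial suffices. Elsewhere 1 + |x| <=
    2|x|, and |x|^p is attained by the monomial x_i^p of a largest coordinate. *)
Lemma normS_wbound p u : in_S u -> wbound p (2 ^+ p * normS p u) u.
Proof.
move=> Su x s sp; rewrite mpartial_mderiv; last exact: Su.1.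
have qp : (msize [ffun i => count_mem i s] <= p)%N by rewrite msize_count.
have m0 : msize ([ffun=> 0%N] : multiindex n) = 0%N by rewrite /msize big1// => i _; rewrite ffunE.
have [x1|x1] := lerP `|x| 1.
  have := @normS_ub _ _ p [ffun=> 0%N] _ u x Su _ qp; rewrite m0 => /(_ isT).
  rewrite /monomial big1 => [|i _]; last by rewrite ffunE.
  rewrite normcM normc_real normr1 mul1r => H.
  apply: ler_pM; [exact: weight_ge0|exact: normc_ge0| |exact: H].
  by rewrite lerXn2r ?nnegrE ?addr_ge0// [leRHS]mulr2n lerD2l.
have [i xi] := exists_norm_coord (ltW x1).
pose k : multiindex n := [ffun j => if j == i then p else 0%N].
have kp : (msize k <= p)%N.
  by rewrite /msize (bigD1 i)//= ffunE eqxx big1 ?addn0// => j ji; rewrite ffunE (negbTE ji).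
have := @normS_ub _ _ p k _ u x Su kp qp; rewrite normcM normc_real => H.
have mk : monomial k x = x 0 i ^+ p.
  rewrite /monomial (bigD1 i)//= ffunE eqxx big1 ?mulr1// => j ji.
  by rewrite ffunE (negbTE ji) expr0.
rewrite mk normrX in H; apply: (@le_trans _ _ (2 ^+ p * (`|x 0 i| ^+ p *
    normc (mderiv [ffun i => count_mem i s] u x)))); last by rewrite ler_wpM2l.
rewrite mulrA -exprMn ler_wpM2r ?normc_ge0// lerXn2r ?nnegrE ?addr_ge0 ?mulr_ge0//.
by rewrite mulr2n mulrDl mul1r lerD// (le_trans (ltW x1)).
Qed.

Lemma open_euclid_gt (m : R) : 0 <= m -> open [set x : Rn | m < euclid x].
Proof.
move=> m0; pose q (x : Rn) := \sum_i x 0 i ^+ 2.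
rewrite (_ : mkset _ = q @^-1` [set r | m ^+ 2 < r]).
  apply: open_comp; last exact: open_gt.
  move=> x _; apply: (@differentiable_continuous R Rn R).
  rewrite (_ : q = \sum_(i < n) (fun x : Rn => x 0 i * x 0 i)).
    by apply: differentiable_sum => i; apply: differentiableM; exact: differentiable_coord.
  by apply/funext => y; rewrite fct_sumE.
apply/funext => x; apply/propext.
have E : (m < Num.sqrt (q x)) = (m ^+ 2 < q x).
  by rewrite !ltNge -{1}(ger0_norm m0) -sqrtr_sqr ler_sqrt ?sqr_ge0.
by rewrite /= /euclid -/(q x) E.
Qed.

Lemma in_Dm_mpartial0 m u s x : in_Dm m u -> m%:R < euclid x -> mpartial s u x = 0.
Proof.
move=> [su u0] mx.
by apply: (@mpartial_near0 _ _ [set x : Rn | m%:R < euclid x]) => //; exact: open_euclid_gt.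
Qed.

Lemma normD_ge0 m p u : smooth u -> 0 <= normD m p u.
Proof.
move=> su; have e0 : euclid (0 : Rn) <= m%:R by rewrite euclid0.
have q0 : (msize ([ffun=> 0%N] : multiindex n) <= p)%N.
  by rewrite /msize big1// => i _; rewrite ffunE.
exact: le_trans (normc_ge0 _) (normD_ub su e0 q0).
Qed.

Lemma in_Dm_bound m u k q x : in_Dm m u ->
  normc ((monomial k x)%:C * mderiv q u x) <= (1 + m%:R) ^+ msize k * normD m (msize q) u.
Proof.
move=> mu; have N0 := normD_ge0 m (msize q) mu.1.
have [xm|xm] := lerP (euclid x) m%:R; last first.
  rewrite /mderiv (in_Dm_mpartial0 _ mu xm) mulr0 ComplexField.Normc.normc0.
  by rewrite mulr_ge0// exprn_ge0// addr_ge0.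
rewrite normcM normc_real; apply: ler_pM; [by []|exact: normc_ge0| |exact: normD_ub mu.1 xm _].
apply: (le_trans (monomial_le _ _)); rewrite lerXn2r ?nnegrE ?addr_ge0//.
by rewrite lerD2l; exact: euclid_ball.
Qed.

Lemma in_Dm_in_S m u : in_Dm m u -> in_S u.
Proof.
move=> mu; split; first exact: mu.1.
by move=> k q; exists ((1 + m%:R) ^+ msize k * normD m (msize q) u) => x; exact: in_Dm_bound.
Qed.

Lemma normS_le_normD m p u : in_Dm m u -> normS p u <= (1 + m%:R) ^+ p * normD m p u.
Proof.
move=> mu; apply: normS_le => x k q kp qp; apply: (le_trans (in_Dm_bound _ _ _ mu)).
have N0 := normD_ge0 m (msize q) mu.1.
have m0 : 0 <= 1 + m%:R :> R by rewrite addr_ge0.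
apply: ler_pM; [exact: exprn_ge0|exact: N0| |exact: normD_mono mu.1 qp].
by rewrite ler_weXn2l// lerDl.
Qed.

Lemma mem_test_in_S E u : mem_test E u -> in_S u.
Proof. by case: E => // -[m _]; exact: in_Dm_in_S. Qed.

Lemma norm_euclid x (m : R) : n%:R * `|x| <= m -> euclid x <= m.
Proof.
move=> xm; have m0 : 0 <= m by rewrite (le_trans _ xm)// mulr_ge0.
rewrite -(ger0_norm m0) -sqrtr_sqr ler_sqrt ?sqr_ge0//.
apply: (@le_trans _ _ ((n%:R * `|x|) ^+ 2)); last by rewrite lerXn2r ?nnegrE// mulr_ge0.
apply: (@le_trans _ _ (\sum_(i < n) `|x| ^+ 2)).
  by apply: ler_sum => i _; rewrite -real_normK ?num_real// lerXn2r ?nnegrE// coord_le_norm.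
rewrite sumr_const card_ord -[leLHS]mulr_natl exprMn ler_wpM2r ?sqr_ge0//.
by rewrite -natrX ler_nat; case: (n) => // k; rewrite leq_pmulr.
Qed.

End weighted_bounds.

(** * Neighborhoods and bounded sets in D and S *)

Section test_topology.
Variables (R : realType) (n : nat).
Local Notation Rn := 'rV[R]_n.
Local Notation C := (R[i]^o).

(** Balls of [R[i]] have radii in [R[i]]; positive ones are real, and the estimates use real
    radii. *)
Lemma nbhs_complexP (z : C) (A : set C) :
  nbhs z A <-> exists2 e : R, 0 < e & forall w : C, normc (w - z) < e -> A w.
Proof.
split=> [[e /= e0 H]|[e e0 H]].
  have [r r0 er] := normc_num (ltW e0); exists r.
    by move: e0; rewrite /= er ltcR.
  move=> w wz; apply: H; rewrite /= distrC er.
  by rewrite (_ : `|w - z| = (normc (w - z))%:C)// ltcR.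
exists (e%:C) => /=; first by rewrite ltcR.
move=> w; rewrite /= distrC => h; apply: H; move: h.
by rewrite (_ : `|w - z| = (normc (w - z))%:C)// ltcR.
Qed.

Lemma cvg_complexP (z_ : nat -> C) (z : C) : z_ @ \oo --> z <->
  forall e : R, 0 < e -> exists N, forall k, (N <= k)%N -> normc (z_ k - z) < e.
Proof.
split=> [zc e e0|H A /nbhs_complexP[e e0 HA]].
  have /zc[N _ HN] : nbhs z [set w | normc (w - z) < e].
    by apply/nbhs_complexP; exists e.
  by exists N => k /HN.
by have [N HN] := H e e0; exists N => // k /HN; exact: HA.
Qed.

(** On S the condition is void, so that one argument serves both spaces: inside a stage,
    neighborhoods can be tested by [wbound]. *)
Definition stage E (m : nat) (u : Rn -> C) : Prop :=
  if E is Dspace then in_Dm m u else True.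

Lemma testfun_in_S E (u : testfun R n E) : in_S u.
Proof. exact: mem_test_in_S (testfunP u). Qed.

Lemma testfun_smooth E (u : testfun R n E) : smooth u.
Proof. exact: (testfun_in_S u).1. Qed.

Lemma stage_testfun E (u : testfun R n E) : exists2 m, (0 < m)%N & stage E m u.
Proof. by have := testfunP u; case: E u => [u [m m0 um]|u _]; [exists m|exists 1%N]. Qed.

Lemma nbhs_wbound E (f : testfun R n E) (A : set (testfun R n E)) m :
  nbhs f A -> (0 < m)%N -> exists p, exists2 e : R, 0 < e &
    forall v : testfun R n E, stage E m v -> wbound p e v -> A (f + v).
Proof.
case: E f A => f A [V bV VA] m0.
  (* Halving turns the non-strict [wbound] into the strict inequality of the basis. *)
  have [p [e e0 He]] := bV.2 m m0; exists p, (e / 2); first by rewrite divr_gt0.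
  move=> v vm vw; apply/VA/He => //; apply: le_lt_trans (wbound_normD m vw) _.
  by rewrite ltr_pdivrMr// mulr2n mulrDr mulr1 ltrDl.
have [p [e e0 He]] := bV; exists p, (e / 2); first by rewrite divr_gt0.
move=> v vm vw; apply/VA/He => //; apply: le_lt_trans (wbound_normS vw) _.
by rewrite ltr_pdivrMr// mulr2n mulrDr mulr1 ltrDl.
Qed.

(** The seminorms of S are continuous on D too: on D_m the weights are at most (1 + m)^p. *)
Lemma nbhs0_base_normS E p (e : R) : 0 < e ->
  nbhs0_base [set v : testfun R n E | normS p v < e].
Proof.
case: E => e0; last by exists p, e.
split; first by apply: normS_convex; exact: testfun_in_S.
move=> m m0; have c0 : 0 < (1 + m%:R) ^+ p :> R by rewrite exprn_gt0// ltr_pwDl.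
exists p, (e / (1 + m%:R) ^+ p); first by rewrite divr_gt0.
move=> v vm ve /=; apply: le_lt_trans (normS_le_normD p vm) _.
by rewrite mulrC -ltr_pdivlMr.
Qed.

Lemma continuous_of_lbound E (f : testfun R n E -> C) M p (c : R) : linear f ->
  (forall A (v : testfun R n E), lbound M p A v -> normc (f v) <= c * A) -> continuous f.
Proof.
move=> lf H x A /nbhs_complexP[e e0 HA].
pose d := e / (`|c| * 2 ^+ p + 1).
have d0 : 0 < d by rewrite divr_gt0// ltr_wpDl// mulr_ge0// exprn_ge0.
exists [set v : testfun R n E | normS p v < d]; first exact: nbhs0_base_normS.
move=> v /= vd; apply: HA.
have -> : f (x + v) - f x = f v by rewrite (linear_mapD lf) addrC addKr.
apply: (le_lt_trans (H _ _ (wbound_lbound (normS_wbound (p := p) (testfun_in_S v))))).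
have [N0|N0] := ltP (normS p v) 0.
  have := wbound_ge0 (normS_wbound (p := p) (testfun_in_S v)).
  by rewrite pmulr_rge0 ?exprn_gt0// leNgt N0.
apply: (@le_lt_trans _ _ (`|c| * 2 ^+ p * normS p v)).
  by rewrite mulrA !ler_wpM2r// ?exprn_ge0// ler_norm.
move: vd; rewrite /d ltr_pdivlMr; last by rewrite ltr_wpDl// mulr_ge0// exprn_ge0.
by apply: le_lt_trans; rewrite mulrC ler_wpM2l// lerDl.
Qed.

Lemma tvs_bounded_normS E (B : set (testfun R n E)) p : tvs_bounded B ->
  exists A : R, forall v, B v -> normS p v <= A.
Proof.
move=> bB; have [|s s0 Hs] := bB [set v : testfun R n E | normS p v < 1].
  by apply: test_nbhs0; exact: nbhs0_base_normS.
exists (normc (s + 1)) => v Bv.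
have [|w /= w1 <-] := Hs (s + 1) _ v Bv; first by rewrite ltrDl.
apply: (le_trans (normS_Z p (s + 1) (testfun_in_S w))).
by rewrite -[leRHS]mulr1 ler_wpM2l ?normc_ge0// ltW.
Qed.

Lemma exists_min_pos (c : nat -> R) m : (forall j, 0 < c j) ->
  exists2 e : R, 0 < e & forall j, (j < m)%N -> e <= c j.
Proof.
move=> c0; elim: m => [|m [e e0 IH]]; first by exists 1.
exists (Num.min e (c m)); first by rewrite lt_min e0 c0.
move=> j; rewrite ltnS leq_eqVlt => /predU1P[->|/IH je]; first by rewrite ge_min lexx orbT.
by rewrite ge_min je.
Qed.

Lemma testfun_scaleE E (a : R[i]) (v : testfun R n E) x : (a *: v) x = a * v x.
Proof. by []. Qed.

Lemma testfun_convE E (l : {i01 R[i]}) (v w : testfun R n E) x :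
  conv l (v : convex_lmodType (testfun R n E)) w x = l%:num * v x + (1 - l%:num) * w x.
Proof. by []. Qed.

Lemma convex_pointwise_bound E (x_ : nat -> Rn) (c : nat -> R) :
  convex_set [set v : testfun R n E | forall j, normc (v (x_ j)) <= c j].
Proof.
apply/convex_setW => v w /set_mem/= vc /set_mem/= wc l l0 l1; apply/mem_set => j.
rewrite testfun_convE; have {vc} := vc j; have {wc} := wc j.
move: (l%:num) l0 l1 => {}l l0 l1 wc vc.
have [r r0 lr] := normc_num (ltW l0).
have {}r0 : 0 < r by move: l0; rewrite lr ltcR.
have r1 : r < 1 by move: l1; rewrite lr ltcR.
apply: (le_trans (normcD _ _)); rewrite !normcM.
have -> : normc (1 - l) = 1 - r.
  by rewrite lr -(rmorphB (real_complex R)) normc_real ger0_norm// subr_ge0 ltW.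
have -> : normc l = r by rewrite lr normc_real gtr0_norm.
nra.
Qed.

(** A function of D_m vanishes at x_j as soon as |x_j| > m, so on each D_m only finitely many of the
    conditions are active. *)
Lemma nbhs0_base_pointwise_bound (x_ : nat -> Rn) (c : nat -> R) :
  (forall j, j.+1%:R < euclid (x_ j)) -> (forall j, 0 < c j) ->
  nbhs0_base [set v : testfun R n Dspace | forall j, normc (v (x_ j)) <= c j].
Proof.
move=> xj c0; split; first exact: convex_pointwise_bound.
move=> m m0; have [e e0 He] := exists_min_pos m c0.
exists 0%N, e => // v vm ve j.
have [mx|xm] := ltP m%:R (euclid (x_ j)).
  by rewrite vm.2// ComplexField.Normc.normc0 ltW.
have jm : (j < m)%N.
  by rewrite -(ltr_nat R); apply: le_lt_trans (lt_le_trans (xj j) xm); rewrite ler_nat.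
apply: (le_trans _ (He j jm)); apply: (le_trans _ (ltW ve)).
pose q0 : multiindex n := [ffun=> 0%N].
have q00 : msize q0 = 0%N by rewrite /msize big1// => i _; rewrite ffunE.
have := @normD_ub _ _ m 0 q0 v (x_ j) vm.1 xm; rewrite q00 => /(_ isT).
by rewrite /mderiv; move: (size_flatten_nseq q0); rewrite q00 => /size0nil ->.
Qed.

(* If B contained, for every j, some xi_j with xi_j x_j != 0 and |x_j| > j, then the
   neighborhood {v : |v x_j| <= |xi_j x_j| / j for all j} would not absorb B. *)
Lemma tvs_bounded_Dm (B : set (testfun R n Dspace)) : tvs_bounded B ->
  exists2 m, (0 < m)%N & forall v, B v -> in_Dm m v.
Proof.
move=> bB; apply: contrapT => /forall2NP nB.
have {nB} : forall j : nat, exists vx : testfun R n Dspace * Rn,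
    [/\ B vx.1, j.+1%:R < euclid vx.2 & 0 < normc (vx.1 vx.2)].
  move=> j; have [//|] := nB j.+1; move=> /existsNP[v /not_implyP[Bv nv]].
  have [x jx vx] : exists2 x, j.+1%:R < euclid x & v x != 0.
    apply: contrapT => /forall2NP nx; apply: nv; split; first exact: testfun_smooth.
    by move=> x jx; have [//|/negP] := nx x; rewrite negbK => /eqP.
  exists (v, x); split=> //=; rewrite lt_neqAle normc_ge0 andbT eq_sym.
  by apply: contra vx => /eqP/ComplexField.Normc.eq0_normc ->.
move=> /choice[F FP].
pose c j := normc ((F j).1 (F j).2) / j.+1%:R.
have c0 j : 0 < c j by rewrite divr_gt0//; have [] := FP j.
have xj j : j.+1%:R < euclid (F j).2 by have [] := FP j.
have [s s0 Hs] := bB _ (test_nbhs0 (nbhs0_base_pointwise_bound xj c0)).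
have [r r0 sr] := normc_num (ltW s0).
have [N rN] : exists N : nat, r < N%:R by exists (Num.truncn r).+1; exact: truncnS_gt.
have sN : s < (N%:R : R)%:C by rewrite sr ltcR.
have [BF _ F0] := FP N.
have [v Vv vF] := Hs _ sN _ BF.
have := Vv N; rewrite /c -vF testfun_scaleE normcM normc_real ger0_norm//.
move: F0; rewrite -vF testfun_scaleE normcM normc_real ger0_norm//.
move: (normc (v _)) => a; have [->|N0] := eqVneq N 0%N; first by rewrite mul0r ltxx.
rewrite pmulr_rgt0 ?ltr0n ?lt0n// => a0.
by rewrite ler_pdivlMr// mulrC ler_pM2r// ler_nat ltnn.
Qed.

Lemma tvs_bounded_wbound E (B : set (testfun R n E)) : tvs_bounded B ->
  (exists2 m, (0 < m)%N & forall v, B v -> stage E m v) /\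
  forall p, exists A : R, forall v, B v -> wbound p A v.
Proof.
move=> bB; split.
  by case: E B bB => B bB; [exact: tvs_bounded_Dm|exists 1%N].
move=> p; have [A HA] := tvs_bounded_normS p bB; exists (2 ^+ p * A) => v Bv.
apply: wbound_le (normS_wbound (testfun_in_S v)).
by rewrite ler_wpM2l ?exprn_ge0// HA.
Qed.

(** Finitely many terms are absorbed one by one. The tail is v + (v_k - v): the single vector v is
    absorbed, and the differences already lie in a convex neighborhood. *)
Lemma cvg_tvs_bounded E (v_ : nat -> testfun R n E) (v : testfun R n E) :
  v_ @ \oo --> v -> tvs_bounded (range v_).
Proof.
move=> vc V [V0 bV0 V0V].
have [W0 bW0 W0V] := base_half bV0.
have [W [bW WW0 cW]] := base_convex bW0.
have [N _ HN] : \forall k \near \oo, W (v_ k - v).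
  by apply: (vc [set w | W (w - v)]); exists W => // w Ww /=; rewrite addrC addKr.
have [d d0 Hd] := base_absorb v bW.
have /choice[b Hb] : forall k, exists e : R,
    0 < e /\ forall t : R[i], normc t < e -> V0 (t *: v_ k).
  by move=> k; have [e e0 He] := base_absorb (v_ k) bV0; exists e.
have [e e0 He] := exists_min_pos N (fun k => (Hb k).1).
pose r := Num.min 1 (Num.min d e).
have r0 : 0 < r by rewrite !lt_min ltr01 d0.
exists ((r^-1)%:C); first by rewrite ltcR invr_gt0.
move=> t rt _ [k _ <-].
have t0 : 0 < t by apply: lt_trans rt; rewrite ltcR invr_gt0.
have [a a0 ta] := normc_num (ltW t0).
have ra : r^-1 < a by move: rt; rewrite ta ltcR.
have {}a0 : 0 < a by apply: lt_trans ra; rewrite invr_gt0.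
have tV : normc t^-1 < r.
  rewrite ta -fmorphV normc_real gtr0_norm ?invr_gt0//.
  by rewrite -[ltRHS]invrK ltf_pV2// posrE invr_gt0.
exists (t^-1 *: v_ k); last by rewrite scalerA divff ?gt_eqF// scale1r.
rewrite -[_ *: v_ k]add0r; apply: V0V.
have [Nk|kN] := leqP N k; last first.
  apply: (Hb k).2; apply: lt_le_trans tV _; apply: le_trans (He k kN).
  by rewrite !ge_min lexx !orbT.
have -> : t^-1 *: v_ k = t^-1 *: v + t^-1 *: (v_ k - v).
  by rewrite -scalerDr subrKC.
apply: W0V; apply: WW0; first by apply: Hd; apply: lt_le_trans tV _; rewrite !ge_min lexx !orbT.
(* Since [r <= 1], the scalar t^-1 is at most 1, and t^-1 (v_k - v) is a convex combination of v_k -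
   v and 0, both in [W]. *)
have h1 : 0 <= t^-1 by rewrite invr_ge0 ltW.
have h2 : t^-1 <= 1.
  rewrite invf_le1// ta lecR; apply: ltW; apply: le_lt_trans ra.
  by rewrite -[leLHS]invr1 lef_pV2 ?posrE// ge_min lexx.
pose l : {i01 R[i]} := Itv01 h1 h2.
have -> : t^-1 *: (v_ k - v) = conv l (v_ k - v : convex_lmodType (testfun R n E)) 0.
  by rewrite convE /= scaler0 addr0.
by apply/set_mem/cW; apply/mem_set; [exact: HN|exact: base0].
Qed.

End test_topology.

Section weighted_bounds_testfun.
Variables (R : realType) (n : nat).
Local Notation Rn := 'rV[R]_n.
Local Notation C := (R[i]^o).

Lemma wbound_in_S (u : Rn -> C) : smooth u -> (forall p, exists A, wbound p A u) -> in_S u.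
Proof.
move=> su uA; split=> // k q.
have [A HA] := uA (maxn (msize k) (msize q)); exists A => x.
rewrite normcM normc_real.
apply: le_trans (HA x (flatten [seq nseq (q i) i | i <- enum 'I_n]) _).
  rewrite ler_wpM2r ?normc_ge0//; apply: (le_trans (monomial_le _ _)).
  by rewrite ler_weXn2l ?leq_maxl// lerDl.
by rewrite size_flatten_nseq leq_maxr.
Qed.

Lemma testfun_wbound E p (u : testfun R n E) : exists A, wbound p A u.
Proof. by exists (2 ^+ p * normS p u); apply: normS_wbound; exact: testfun_in_S. Qed.

End weighted_bounds_testfun.

(** * Completeness and uniform boundedness *)

Section completeness.
Variables (R : realType) (n : nat).
Local Notation Rn := 'rV[R]_n.
Local Notation C := (R[i]^o).

Lemma half_pow_small (c e : R) : 0 < e ->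
  exists N, forall j, (N <= j)%N -> c * 2^-1 ^+ j <= e.
Proof.
move=> e0; exists (Num.truncn (c / e)).+1 => j Nj.
rewrite -ler_pdivlMr ?exprn_gt0// exprVn invrK mulrC -ler_pdivrMr//.
apply: (le_trans (ltW (truncnS_gt _))); apply: (@le_trans _ _ j%:R).
  by rewrite ler_nat.
by rewrite -natrX ler_nat ltnW// ltn_expl.
Qed.

Lemma geometric_telescope (a : nat -> R) (c : R) J :
  (forall j, (J <= j)%N -> `|a j.+1 - a j| <= c * 2^-1 ^+ j) ->
  forall j, (J <= j)%N -> `|a j - a J| <= 2 * c * 2^-1 ^+ J.
Proof.
move=> H j Jj.
have c0 : 0 <= c.
  by have := le_trans (normr_ge0 _) (H J (leqnn J)); rewrite pmulr_lge0// exprn_gt0.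
(* The exact geometric sum goes through induction, unlike the bound of the statement. *)
suff : `|a j - a J| <= 2 * c * (2^-1 ^+ J - 2^-1 ^+ j).
  move=> /le_trans; apply; rewrite ler_wpM2l ?mulr_ge0// gerBl exprn_ge0//.
rewrite -(subnKC Jj); elim: (j - J)%N => [|i IH]; first by rewrite addn0 !subrr normr0 mulr0.
rewrite addnS -(subrKA (a (J + i)%N)); apply: (le_trans (ler_normD _ _)).
apply: (le_trans (lerD (H _ (leq_addr _ _)) IH)).
by rewrite exprS; move: (2^-1 ^+ J) (2^-1 ^+ _) => p q; lra.
Qed.

(** The rate comes after the limit, for every [c] and [J]: one and the same limit inherits any
    faster rate known later, in particular the weighted one with c = (1 + |x|)^-J. *)
Lemma geometric_limit (a : nat -> R) J0 :
  (forall j, (J0 <= j)%N -> `|a j.+1 - a j| <= 2^-1 ^+ j) ->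
  exists l, forall (c : R) J, (forall j, (J <= j)%N -> `|a j.+1 - a j| <= c * 2^-1 ^+ j) ->
    `|l - a J| <= 2 * c * 2^-1 ^+ J.
Proof.
move=> H.
have near i j : (J0 <= i)%N -> (i <= j)%N -> `|a j - a i| <= 2 * 2^-1 ^+ i.
  move=> Ji; have := @geometric_telescope a 1 i _ j; rewrite mulr1; apply => k ik.
  by rewrite mul1r; apply: H; exact: leq_trans ik.
(* The limit is the supremum of these lower estimates; each a_i + 2 * 2^-i is an upper bound of
   them. *)
pose S := [set r | exists2 j, (J0 <= j)%N & r = a j - 2 * 2^-1 ^+ j].
have ubS i : (J0 <= i)%N -> ubound S (a i + 2 * 2^-1 ^+ i).
  move=> Ji _ [j Jj ->]; have p0 k : 0 <= 2^-1 ^+ k :> R by rewrite exprn_ge0.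
  have := p0 i; have := p0 j; have [ij|/ltnW ji] := leqP i j.
    have := near i j Ji ij; rewrite ler_norml => /andP[_]; lra.
  by have := near j i Jj ji; rewrite ler_norml => /andP[+ _]; lra.
exists (sup S) => c J HJ.
have lim i : (J0 <= i)%N -> `|sup S - a i| <= 2 * 2^-1 ^+ i.
  move=> Ji; rewrite ler_norml; apply/andP; split.
    rewrite lerBrDl; apply: ub_le_sup; first by exists (a i + 2 * 2^-1 ^+ i); exact: ubS.
    by exists i.
  by rewrite lerBlDl; apply: ge_sup; [exists (a i - 2 * 2^-1 ^+ i), i|exact: ubS].
apply/ler_addgt0Pr => e e0.
have [N HN] := half_pow_small 2 e0.
pose j := maxn J (maxn J0 N).
rewrite -(subrKA (a j)) addrC; apply: (le_trans (ler_normD _ _)); apply: lerD.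
  by apply: geometric_telescope => //; exact: leq_maxl.
apply: (le_trans (lim j _)); first by rewrite /j !leq_max leqnn orbT.
by apply: HN; rewrite /j !leq_max leqnn !orbT.
Qed.

Lemma complex_geometric_limit (a : nat -> R[i]) J0 :
  (forall j, (J0 <= j)%N -> normc (a j.+1 - a j) <= 2^-1 ^+ j) ->
  exists l, forall (c : R) J, (forall j, (J <= j)%N -> normc (a j.+1 - a j) <= c * 2^-1 ^+ j) ->
    normc (l - a J) <= 4 * c * 2^-1 ^+ J.
Proof.
move=> H.
have [j Jj|lr Hr] := @geometric_limit (fun j => complex.Re (a j)) J0.
  by rewrite -ReB; exact: le_trans (Re_normc _) (H j Jj).
have [j Jj|li Hi] := @geometric_limit (fun j => complex.Im (a j)) J0.
  by rewrite -ImB; exact: le_trans (Im_normc _) (H j Jj).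
exists (lr +i* li) => c J HJ; apply: (le_trans (normc_le _)); rewrite ReB ImB /=.
have h1 := Hr c J; have h2 := Hi c J.
have {}h1 : `|lr - complex.Re (a J)| <= 2 * c * 2^-1 ^+ J.
  by apply: h1 => j Jj; rewrite -ReB; exact: le_trans (Re_normc _) (HJ j Jj).
have {}h2 : `|li - complex.Im (a J)| <= 2 * c * 2^-1 ^+ J.
  by apply: h2 => j Jj; rewrite -ImB; exact: le_trans (Im_normc _) (HJ j Jj).
by apply: (le_trans (lerD h1 h2)); lra.
Qed.

(* The derivatives of u_ converge uniformly; the second order Taylor estimate, uniform in j,
   passes to the limit and identifies the derivatives of the limit. *)
Lemma wbound_complete (u_ : nat -> Rn -> C) : (forall j, smooth (u_ j)) ->
  (forall j p, exists A, wbound p A (u_ j)) ->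
  (forall j, wbound j (2^-1 ^+ j) (u_ j.+1 - u_ j)) ->
  exists u, smooth u /\ forall j, wbound j (4 * 2^-1 ^+ j) (u - u_ j).
Proof.
move=> su uA Hu.
have step s x p j : (size s <= p)%N -> (p <= j)%N ->
    (1 + `|x|) ^+ p * normc (mpartial s (u_ j.+1) x - mpartial s (u_ j) x) <= 2^-1 ^+ j.
  move=> sp pj; have := Hu j x s (leq_trans sp pj); rewrite mpartialB//.
  apply: le_trans; rewrite ler_wpM2r ?normc_ge0// ler_weXn2l//.
  by rewrite lerDl.
have /choice[L HL] : forall sx : seq 'I_n * Rn, exists l, forall (c : R) J,
    (forall j, (J <= j)%N ->
      normc (mpartial sx.1 (u_ j.+1) sx.2 - mpartial sx.1 (u_ j) sx.2) <= c * 2^-1 ^+ j) ->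
    normc (l - mpartial sx.1 (u_ J) sx.2) <= 4 * c * 2^-1 ^+ J.
  move=> [s x]; apply: (@complex_geometric_limit _ (size s)) => j sj /=.
  apply: le_trans (step s x _ j (leqnn _) sj).
  by rewrite ler_peMl ?normc_ge0// weight_ge1.
have {HL}HL s x J : (size s <= J)%N ->
    (1 + `|x|) ^+ J * normc (L (s, x) - mpartial s (u_ J) x) <= 4 * 2^-1 ^+ J.
  move=> sJ; rewrite mulrC -ler_pdivlMr ?weight_gt0//.
  have -> : 4 * 2^-1 ^+ J / (1 + `|x|) ^+ J = 4 * ((1 + `|x|) ^+ J)^-1 * 2^-1 ^+ J.
    by rewrite mulrAC.
  apply: (HL (s, x)) => j Jj; rewrite mulrC ler_pdivlMr ?weight_gt0// mulrC.
  exact: step.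
have HL1 s x J : (size s <= J)%N -> normc (L (s, x) - mpartial s (u_ J) x) <= 4 * 2^-1 ^+ J.
  by move=> sJ; apply: le_trans (HL s x J sJ); rewrite ler_peMl ?normc_ge0// weight_ge1.
have p0 k : 0 <= 2^-1 ^+ k :> R by rewrite exprn_ge0.
have dL s x : cdifferentiable (fun x => L (s, x)) x /\
    forall i, partial i (fun x => L (s, x)) x = L (i :: s, x).
  pose J := (size s).+2.
  have [A HA] := uA J J.
  (* A derivative of u_j is compared with that of u_J through the limit value; each of the two
     passages costs at most 4. *)
  pose K := A + 8.
  have uK t y j : (size t <= J)%N -> (J <= j)%N -> normc (mpartial t (u_ j) y) <= K.
    move=> tJ Jj.
    have tri (a b c : R[i]) : normc a <= normc b + (normc (c - a) + normc (c - b)).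
      have aE : a = b + ((a - c) + (c - b)) by ring.
      rewrite [X in normc X <= _]aE; apply: (le_trans (normcD _ _)).
      by rewrite lerD2l (normcB c a); exact: normcD.
    apply: (le_trans (tri _ (mpartial t (u_ J) y) (L (t, y)))); apply: lerD.
      exact: (wbound_pointwise y HA).
    have le4 k : 4 * 2^-1 ^+ k <= 4 :> R by rewrite ler_piMr// exprn_ile1// invf_le1 ?ler1n.
    have h1 := le_trans (HL1 t y j (leq_trans tJ Jj)) (le4 j).
    have h2 := le_trans (HL1 t y J tJ) (le4 J).
    by apply: (le_trans (lerD h1 h2)); lra.
  apply: (@cdifferentiable_quadratic _ _ _ _ _ (2 * (n%:R * (n%:R * K)))) => v v1.
  apply/ler_addgt0Pr => e e0.
  (* The remainders of the limit and of u_j differ in two function values and [n] derivatives, each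
     off by at most 4 * 2^-j. *)
  have [N HN] := half_pow_small (4 * (2 + n%:R)) e0.
  pose j := maxn J N; have Jj : (J <= j)%N by exact: leq_maxl.
  have sj : (size s <= j)%N by apply: leq_trans Jj; rewrite /J leqW.
  have sj' : (size s < j)%N by apply: leq_trans Jj; rewrite /J.
  have T2 := @complex_taylor2 _ _ (mpartial s (u_ j)) x v K (smooth_mpartial s (su j))
    (fun i k y => uK [:: k, i & s] y j (leqnn _) Jj).
  apply: le_trans (lerD T2 (HN j (leq_maxr _ _))).
  rewrite -[X in normc X](subrK (mpartial s (u_ j) (x + v) - mpartial s (u_ j) x -
    \sum_i (v 0 i)%:C * partial i (mpartial s (u_ j)) x)) addrC.
  apply: (le_trans (normcD _ _)); rewrite lerD2l.
  have -> (a b c a' b' c' : R[i]) : a - b - c - (a' - b' - c') = (a - a') - (b - b') - (c - c').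
    by ring.
  rewrite -sumrB; apply: (le_trans (normcD _ _)); rewrite normcN.
  apply: (@le_trans _ _ ((4 * 2^-1 ^+ j + 4 * 2^-1 ^+ j) + n%:R * (4 * 2^-1 ^+ j))); last first.
    by move: (2^-1 ^+ j) => q; rewrite le_eqVlt; apply/orP; left; apply/eqP; ring.
  apply: lerD.
    by apply: (le_trans (normcD _ _)); rewrite normcN; apply: lerD; exact: HL1.
  apply: (le_trans (normc_sum _ _ _)).
  apply: (@le_trans _ _ (\sum_(i < n) 4 * 2^-1 ^+ j)); last first.
    by rewrite sumr_const card_ord -[leLHS]mulr_natl.
  apply: ler_sum => i _; rewrite -mulrBr normcM normc_real.
  apply: (@le_trans _ _ (1 * (4 * 2^-1 ^+ j))); last by rewrite mul1r.
  apply: ler_pM; [exact: normr_ge0|exact: normc_ge0| |exact: (HL1 (i :: s))].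
  exact: le_trans (coord_le_norm v i) v1.
pose u : Rn -> C := fun x => L ([::], x).
have uL s : mpartial s u = (fun x => L (s, x)).
  by elim: s => //= i s ->; apply/funext => x; exact: (dL s x).2.
have smu : smooth u by move=> s x; rewrite uL; exact: (dL s x).1.
by exists u; split => // j x s sj; rewrite mpartialB// uL; exact: HL.
Qed.

End completeness.

(** * Baire's theorem and uniform bounds for demi-distributions *)

Section equicontinuity.
Variables (R : realType) (n : nat) (E : test_space).
Local Notation Rn := 'rV[R]_n.
Local Notation C := (R[i]^o).
Local Notation T := (testfun R n E).
Implicit Types (P : set T) (u v w x : T).

(** Completeness along rapidly converging sequences, the j-th step being small for the j-th
    seminorm, with a rate of convergence. Baire's argument uses just such sequences. *)
Definition complete_subspace P :=
  [/\ P 0, forall (a : R[i]) v w, P v -> P w -> P (a *: v + w) &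
    forall u_ : nat -> T, (forall j, P (u_ j)) ->
      (forall j, wbound j (2^-1 ^+ j) (u_ j.+1 - u_ j)) ->
      exists2 u, P u & forall j, wbound j (4 * 2^-1 ^+ j) (u - u_ j)].

Lemma testfun_wbound_complete (u_ : nat -> T) :
  (forall j, wbound j (2^-1 ^+ j) (u_ j.+1 - u_ j)) ->
  exists u : Rn -> C, in_S u /\ forall j, wbound j (4 * 2^-1 ^+ j) (u - u_ j).
Proof.
move=> Hu.
have [|j p|u [su uH]] := @wbound_complete R n (fun j => u_ j : Rn -> C) _ _ Hu.
- by move=> j; exact: testfun_smooth.
- exact: testfun_wbound.
exists u; split=> //; apply: wbound_in_S => // p.
have [A HA] := testfun_wbound p (u_ p); exists (4 * 2^-1 ^+ p + A).
rewrite -[u](subrK (u_ p : Rn -> C)); apply: wboundD => //; last exact: testfun_smooth.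
rewrite -[u]scale1r -scaleN1r addrC; apply: smooth_lin => //; last by rewrite scale1r.
exact: testfun_smooth.
Qed.

Lemma complete_subspace_Dm m : (0 < m)%N -> complete_subspace [set u : T | in_Dm m u].
Proof.
move=> m0; split=> [|a v w|u_ um Hu]; first exact: in_Dm0.
  exact: in_Dm_lin.
have [u [uS uH]] := testfun_wbound_complete Hu.
have mu : in_Dm m u.
  split=> [|x mx]; first exact: uS.1.
  apply: ComplexField.Normc.eq0_normc; apply/eqP; rewrite eq_le normc_ge0 andbT.
  apply/ler_addgt0Pr => e e0; rewrite add0r.
  have [N HN] := half_pow_small 4 e0.
  have uN : u_ N x = 0 by exact: (um N).2.
  apply: le_trans (HN N (leqnn N)); rewrite -[u x]subr0 -uN.
  exact: (wbound_pointwise x (uH N) (leq0n N) (s := [::])).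
have uT : u \in test_pred E.
  apply/asboolP; case: (E); first by exists m.
  exact: in_Dm_in_S mu.
by exists (TestFun uT).
Qed.

Lemma complete_subspace_stage m : (0 < m)%N -> complete_subspace [set u : T | stage E m u].
Proof.
move=> m0; have [EE|EE] : E = Dspace \/ E = Sspace by case: (E); [left|right].
  rewrite (_ : mkset _ = [set u : T | in_Dm m u]); first exact: complete_subspace_Dm.
  have sE (w : Rn -> C) : stage E m w = in_Dm m w by rewrite EE.
  by apply/funext => u; rewrite /mkset sE.
have sE (w : Rn -> C) : stage E m w by rewrite EE.
split=> [|a v w _ _|u_ _ Hu]; [exact: sE|exact: sE|].
have [u [uS uH]] := testfun_wbound_complete Hu.
have uT : u \in test_pred E by apply/asboolP; rewrite EE.
by exists (TestFun uT) => //; exact: sE.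
Qed.

Definition seq_continuous_on P (h : T -> C) := forall x, P x -> forall e : R, 0 < e ->
  exists p, exists2 d : R, 0 < d &
    forall v, P v -> wbound p d v -> normc (h (x + v) - h x) < e.

(** Since the radii halve, all later centers stay within 2 d_k of x_k; a far enough center is within
    d_k of the limit. The factor 4 leaves room for both. *)
Lemma nested_balls P (x_ : nat -> T) (p_ : nat -> nat) (d_ : nat -> R) :
  complete_subspace P -> (forall k, P (x_ k)) -> (forall k, 0 < d_ k) ->
  (forall k, (k <= p_ k)%N) -> (forall k, (p_ k <= p_ k.+1)%N) ->
  (forall k, d_ k.+1 <= d_ k / 2) -> (forall k, d_ k <= 2^-1 ^+ k) ->
  (forall k, wbound (p_ k) (d_ k) (x_ k.+1 - x_ k)) ->
  exists2 x, P x & forall k, wbound (p_ k) (4 * d_ k) (x - x_ k).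
Proof.
move=> [P0 Plin Pcomp] Px d0 pk pS dh dk xs.
have pm i k : (i <= k)%N -> (p_ i <= p_ k)%N.
  move/subnKC => <-; elim: (k - i)%N => [|l IH]; first by rewrite addn0.
  by rewrite addnS; apply: (leq_trans IH).
have [|x Pxx Hx] := Pcomp x_ Px.
  by move=> j; apply: wbound_order (pk j) _; exact: wbound_le (dk j) (xs j).
have sT (w : T) : smooth w by exact: testfun_smooth.
have tel i l : wbound (p_ i) (2 * d_ i - 2 * d_ (i + l)%N) (x_ (i + l)%N - x_ i).
  elim: l => [|l IH].
    rewrite addn0 !subrr => y s sp.
    by rewrite mpartial0 ComplexField.Normc.normc0 mulr0.
  rewrite addnS -(subrKA (x_ (i + l)%N)).
  have := wboundD (sT _) (sT _) (wbound_order (pm i (i + l)%N (leq_addr _ _)) (xs (i + l)%N)) IH.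
  by apply: wbound_le; have := dh (i + l)%N; lra.
exists x => // k.
have [N HN] := half_pow_small 4 (d0 k).
pose l := maxn (p_ k) N.
have pl : (p_ k <= k + l)%N by rewrite (leq_trans (leq_maxl _ N))// leq_addl.
have Nl : (N <= k + l)%N by rewrite (leq_trans (leq_maxr (p_ k) N))// leq_addl.
rewrite -(subrKA (x_ (k + l)%N)).
have := wboundD (sT _) (sT _) (wbound_order pl (Hx (k + l)%N)) (tel k l).
by apply: wbound_le; have := HN _ Nl; have := d0 (k + l)%N; have := d0 k; lra.
Qed.

(** If no ball carried a common bound, one could choose shrinking balls, the k-th of which sees some
    |h_j| > k throughout; at their common point the family would be unbounded. *)
Lemma baire_uniform_bound P (h : nat -> T -> C) : complete_subspace P ->
  (forall j, seq_continuous_on P (h j)) ->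
  (forall x, P x -> exists b, forall j, normc (h j x) <= b) ->
  exists2 x0, P x0 & exists p, exists2 d : R, 0 < d & exists N : R,
    forall v, P v -> wbound p d v -> forall j, normc (h j (x0 + v)) <= N.
Proof.
move=> [P0 Plin Pcomp] hc hb; apply: contrapT => /forall2NP nB.
have PD v w : P v -> P w -> P (v + w) by move=> Pv Pw; rewrite -[v]scale1r; exact: Plin.
have PB v w : P v -> P w -> P (v - w) by move=> Pv Pw; rewrite addrC -scaleN1r; exact: Plin.
have big x p (d N : R) : P x -> 0 < d ->
    exists v j, [/\ P v, wbound p d v & N < normc (h j (x + v))].
  move=> Px d0; apply: contrapT => nH; have [//|] := nB x; apply; exists p, d => //.
  exists N => v Pv vd j; rewrite leNgt; apply/negP => Nh; apply: nH.
  by exists v, j.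
have /choice[F HF] : forall s : nat * (T * nat * R), exists s' : T * nat * R,
    P s.2.1.1 -> 0 < s.2.2 ->
    [/\ P s'.1.1, 0 < s'.2, [/\ (s.2.1.2 <= s'.1.2)%N, (s.1 < s'.1.2)%N, s'.2 <= s.2.2 / 2 &
      s'.2 <= 2^-1 ^+ s.1.+1], wbound s.2.1.2 s.2.2 (s'.1.1 - s.2.1.1) &
      exists j, forall w, P w -> wbound s'.1.2 (4 * s'.2) w -> s.1%:R < normc (h j (s'.1.1 + w))].
  move=> [k [[x p] d]] /=.
  have [Px|nPx] := pselect (P x); last by exists (x, p, d).
  have [d0|nd0] := pselect (0 < d); last by exists (x, p, d).
  (* The threshold is k + 1; by continuity of h_j, giving up 1 keeps |h_j| > k on a whole ball. *)
  have [v [j [Pv vd hv]]] := big x p d (k%:R + 1) Px d0.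
  have Pxv := PD _ _ Px Pv.
  have [q [r r0 Hr]] := hc j _ Pxv 1 ltr01.
  (* [r / 4] pays for the factor 4 with which [nested_balls] locates the limit; the other two terms
     are its conditions on the radii. *)
  pose d' := Num.min (r / 4) (Num.min (d / 2) (2^-1 ^+ k.+1)).
  have d'0 : 0 < d' by rewrite !lt_min !divr_gt0 ?exprn_gt0.
  exists (x + v, maxn q (maxn p k.+1), d') => _ _ /=; split=> //.
  - by split; rewrite ?leq_max ?leqnn ?orbT// /d' !ge_min lexx !orbT.
  - by change (wbound p d (x + v - x : T)); rewrite addrC addKr.
  exists j => w Pw wd.
  have {}wd : wbound q r w.
    apply: wbound_order (leq_maxl _ _) _; apply: wbound_le wd.
    by rewrite mulrC -ler_pdivlMr// /d' ge_min lexx.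
  have := Hr w Pw wd; set z := x + v + w => hz.
  have tri (a b : R[i]) : normc a <= normc b + normc (b - a).
    by rewrite -[X in normc X <= _](subrK b) addrC normcB; exact: normcD.
  by have := tri (h j (x + v)) (h j z); lra.
pose st := fix st k := if k is k'.+1 then F (k', st k') else (0 : T, 0%N, 1 : R).
have inv k : P (st k).1.1 /\ 0 < (st k).2.
  by elim: k => [|k [IH1 IH2]]; [split|have [] := HF (k, st k) IH1 IH2].
have HS k := HF (k, st k) (inv k).1 (inv k).2.
(* The shift by one aligns indices: around [x_ k] some |h_j| exceeds k. *)
pose x_ k := (st k.+1).1.1; pose p_ k := (st k.+1).1.2; pose d_ k := (st k.+1).2.
have d0 k : 0 < d_ k by exact: (inv k.+1).2.
have pk k : (k <= p_ k)%N by have [_ _ [_ /ltnW + _ _] _ _] := HS k.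
have pS k : (p_ k <= p_ k.+1)%N by have [_ _ [+ _ _ _] _ _] := HS k.+1.
have dh k : d_ k.+1 <= d_ k / 2 by have [_ _ [_ _ + _] _ _] := HS k.+1.
have dk k : d_ k <= 2^-1 ^+ k.
  have [_ _ [_ _ _ +] _ _] := HS k; move/le_trans; apply.
  by rewrite exprS ler_piMl ?exprn_ge0// invf_le1 ?ler1n.
have xs k : wbound (p_ k) (d_ k) (x_ k.+1 - x_ k) by have [_ _ _ + _] := HS k.+1.
have Px k : P (x_ k) by exact: (inv k.+1).1.
have [x Pxx far] := nested_balls (And3 P0 Plin Pcomp) Px d0 pk pS dh dk xs.
have [b Hb] := hb x Pxx.
pose k := (Num.truncn b).+1.
have [_ _ _ _ [j Hj]] := HS k.
have := Hj (x - x_ k) (PB _ _ Pxx (Px k)) (far k).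
rewrite -/(x_ k) subrKC => bh.
have := Hb j; rewrite leNgt => /negP; apply; apply: lt_trans bh; exact: truncnS_gt.
Qed.

(** The algebraic clause of [demi_distribution] alone; continuity enters separately, relative to a
    subspace. *)
Definition demi_on (gamma : C -> C) (U : set T) (h : T -> C) :=
  forall (x u : T) (t : C), U u -> `|t| <= 1 ->
    exists r s : C, [/\ `|r - 1| <= `|gamma t|, `|s| <= `|gamma t| &
      h (x + t *: u) = r * h x + s * h u].

Lemma demi_increment gamma U h x u (t : C) : demi_on gamma U h -> U u -> normc t <= 1 ->
  normc (h (x + t *: u) - h x) <= normc (gamma t) * (normc (h x) + normc (h u)).
Proof.
move=> dh Uu t1.
have [|r [s [r1 s1 ->]]] := dh x u t Uu; first by rewrite normc_normr lecR.
have -> : r * h x + s * h u - h x = (r - 1) * h x + s * h u by ring.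
apply: (le_trans (normcD _ _)); rewrite !normcM mulrDr.
by apply: lerD; rewrite ler_wpM2r ?normc_ge0// -lecR -!normc_normr.
Qed.

(* Baire bounds the h_j on some ball around x0; the center is moved back to 0 by subtracting
   x0 / L, which lies in U for large L, L times. *)
Lemma demi_uniform_bound P gamma U (h : nat -> T -> C) : complete_subspace P ->
  (forall j, seq_continuous_on P (h j)) ->
  (forall x, P x -> exists b, forall j, normc (h j x) <= b) ->
  (exists p, exists2 e : R, 0 < e & forall v, P v -> wbound p e v -> U v) ->
  (forall j, demi_on gamma U (h j)) ->
  exists p, exists2 d : R, 0 < d & exists N : R,
    forall v, P v -> wbound p d v -> forall j, normc (h j v) <= N.
Proof.
move=> PC hc hb [q [e e0 He]] hd; have [P0 Plin _] := PC.
have [x0 Px0 [p [d d0 [N HN]]]] := baire_uniform_bound PC hc hb.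
exists p, d => //.
have [A HA] := testfun_wbound q x0; have A0 := wbound_ge0 HA.
pose L := (Num.truncn (A / e)).+1.
have L0 : 0 < L%:R :> R by rewrite ltr0n.
pose z := (- (L%:R^-1 : R)%:C : R[i]) *: x0.
have Pz : P z by rewrite -[z]addr0; exact: Plin.
have Uz : U z.
  apply: He => //; apply: wbound_le (wboundZ _ (testfun_smooth x0) HA).
  rewrite normcN normc_real gtr0_norm ?invr_gt0// mulrC ler_pdivrMr// mulrC -ler_pdivrMr//.
  exact: ltW (truncnS_gt _).
have [b Hb] := hb z Pz.
have step i : exists M : R, forall v, P v -> wbound p d v ->
    forall j, normc (h j (x0 + v + z *+ i)) <= M.
  elim: i => [|i [M HM]]; first by exists N => v Pv vd j; rewrite mulr0n addr0 HN.
  exists (M + normc (gamma 1) * (M + b)) => v Pv vd j.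
  rewrite mulrSr addrA -[X in _ + X]scale1r; set x := x0 + v + z *+ i.
  rewrite -[h j _](subrKC (h j x)); apply: (le_trans (normcD _ _)).
  apply: lerD; first exact: HM.
  apply: (le_trans (demi_increment _ (hd j) Uz _)).
    by rewrite ComplexField.Normc.normc1.
  by rewrite ler_wpM2l ?normc_ge0// lerD// HM.
have [M HM] := step L; exists M => v Pv vd j.
have := HM v Pv vd j; rewrite -scaler_nat /z scalerA mulrN.
have -> : (L%:R : R[i]) * (L%:R^-1 : R)%:C = 1.
  by rewrite fmorphV rmorph_nat divff// pnatr_eq0.
by rewrite scaleN1r addrC addKr.
Qed.

End equicontinuity.

(** * Supports and local estimates *)

Section cutoff.
Variables (R : realType) (n : nat).
Local Notation Rn := 'rV[R]_n.
Local Notation C := (R[i]^o).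

Lemma exists_bump_at (c : Rn) (r : R) : 0 < r -> exists phi : Rn -> C, [/\ smooth phi,
  forall x, `|x - c| <= r -> phi x = 1 & forall x, 2 * r < `|x - c| -> phi x = 0].
Proof.
move=> r0; have [phi [sphi phi1 phi0]] := @exists_bump R n.
have ri : `|r^-1| = r^-1 by rewrite gtr0_norm ?invr_gt0.
exists (shiftf (- c) (fun y => phi (r^-1 *: y))); split=> [|x xr|x xr].
- by apply: smooth_shift; exact: smooth_dilation.
- by apply: phi1; rewrite normrZ ri addrC mulrC ler_pdivrMr// mul1r.
- by apply: phi0; rewrite normrZ ri addrC mulrC ltr_pdivlMr.
Qed.

Lemma in_Dm_of_norm (M : R) (u : Rn -> C) : smooth u -> (forall x, M < `|x| -> u x = 0) ->
  forall m : nat, n%:R * M <= m%:R -> in_Dm m u.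
Proof.
move=> su u0 m Mm; split=> // x mx; apply: u0; rewrite ltNge; apply/negP => xM.
move: mx; rewrite ltNge => /negP; apply; apply: norm_euclid.
by apply: le_trans Mm; rewrite ler_wpM2l.
Qed.

Lemma exists_stage (M : R) : exists2 m, (0 < m)%N & n%:R * M <= m%:R :> R.
Proof. by exists (Num.truncn (n%:R * M)).+1 => //; exact: ltW (truncnS_gt _). Qed.

Lemma mem_test_of_norm E (M : R) (u : Rn -> C) : smooth u -> (forall x, M < `|x| -> u x = 0) ->
  mem_test E u.
Proof.
move=> su u0; have [m m0 Mm] := exists_stage M; have mu := in_Dm_of_norm su u0 Mm.
by case: E; [exists m|exact: in_Dm_in_S mu].
Qed.

Lemma exists_cutoff E (M : R) (phi : Rn -> C) (v : testfun R n E) : smooth phi ->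
  (forall x, M < `|x| -> phi x = 0) ->
  exists w : testfun R n E, w = (fun x => phi x * v x) :> (Rn -> C).
Proof.
move=> sphi phi0.
have wT : (fun x => phi x * v x) \in test_pred E.
  apply/asboolP; apply: (@mem_test_of_norm _ M) => [|x Mx].
    by apply: smoothM => //; exact: testfun_smooth.
  by rewrite phi0// mul0r.
by exists (TestFun wT).
Qed.

Lemma smooth_bounded (M : R) (phi : Rn -> C) p : smooth phi ->
  (forall x, M < `|x| -> phi x = 0) ->
  exists A, forall x s, (size s <= p)%N -> normc (mpartial s phi x) <= A.
Proof.
move=> sphi phi0; have Sphi : in_S phi := @mem_test_of_norm Sspace _ _ sphi phi0.
exists (2 ^+ p * normS p phi) => x s sp.
exact: wbound_pointwise (normS_wbound Sphi) sp.
Qed.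

End cutoff.

(** * Annihilation away from the support *)

Section support.
Variables (R : realType) (n : nat) (E : test_space).
Local Notation Rn := 'rV[R]_n.
Local Notation C := (R[i]^o).
Local Notation T := (testfun R n E).
Implicit Types (f : T -> C) (v w : T).

(** This replaces a partition of unity. For a bump phi of the first ball, f (phi v) = 0, and v - phi
    v vanishes on that ball, so the remaining balls suffice for it. *)
Lemma vanish_finite_cover f (l : seq (Rn * R)) : linear f ->
  (forall cr, cr \in l -> 0 < cr.2 /\
    forall v, (forall x, 2 * cr.2 < `|x - cr.1| -> v x = 0) -> f v = 0) ->
  forall v, (forall x, v x != 0 -> exists2 cr, cr \in l & `|x - cr.1| <= cr.2) -> f v = 0.
Proof.
move=> lf; elim: l => [|[c r] l IH] Hl v Hv.
  have -> : v = 0.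
    apply: val_inj; apply/funext => x; apply/eqP/negP => /negP /Hv [cr].
    by rewrite in_nil.
  by have := linear_mapB lf 0 0; rewrite !subrr.
have [/= r0 Hr] := Hl (c, r) (mem_head _ _).
have [phi [sphi phi1 phi0]] := exists_bump_at c r0.
have [w wE] : exists w : T, w = (fun x => phi x * v x) :> (Rn -> C).
  apply: (@exists_cutoff _ _ _ (2 * r + `|c|)) => // x xr; apply: phi0.
  by move: xr; rewrite -ltrBrDr => xr; apply: lt_le_trans xr _; exact: lerB_dist.
have fw : f w = 0 by apply: Hr => x xr; rewrite wE phi0// mul0r.
have : f (v - w) = 0.
  apply: IH => [cr crl|x]; first by apply: Hl; rewrite inE crl orbT.
  have -> : (v - w) x = v x - phi x * v x by rewrite -[LHS]/(v x - w x) wE.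
  move=> vx0; have vx : v x != 0 by apply: contra vx0 => /eqP ->; rewrite mulr0 subrr.
  have [cr] := Hv x vx; rewrite inE => /predU1P[-> /= xr|crl xcr]; last by exists cr.
  by move: vx0; rewrite phi1// mul1r subrr eqxx.
by rewrite (linear_mapB lf) fw subr0.
Qed.

Lemma supp_vanish_ball f (O : set Rn) (c : Rn) : open O -> O c ->
  (forall v, supp v `<=` O -> f v = 0) ->
  exists2 r : R, 0 < r & forall v, (forall x, 2 * r < `|x - c| -> v x = 0) -> f v = 0.
Proof.
move=> oO Oc HO.
have /nbhs_ballP[e /= e0 He] : nbhs c O by apply: open_nbhs_nbhs.
(* The closed ball of radius 2e/3 must lie in the open ball of radius e. *)
exists (e / 3); first by rewrite divr_gt0.
move=> v v0; apply: HO; have cB := @closed_closed_ball_ R Rn c (2 * (e / 3)).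
have vB : [set x | v x != 0] `<=` closed_ball_ (fun x => `|x|) c (2 * (e / 3)).
  by move=> x /= vx; rewrite /closed_ball_ /= distrC leNgt; apply: contra vx => /v0 ->.
move=> x /(closure_subset vB); rewrite -((closure_id _).1 cB) /closed_ball_ /= => xc.
by apply: He; rewrite -ball_normE /ball_ /=; apply: le_lt_trans xc _; lra.
Qed.

(** The shell M + 1 <= |x| <= N is compact and avoids the support, so finitely many balls on which
    [f] vanishes cover it. *)
Lemma vanish_bounded_support f (G : set Rn) (M N : R) : linear f ->
  distr_support f `<=` G -> (forall x, G x -> `|x| <= M) ->
  forall v, (forall x, `|x| < M + 1 -> v x = 0) -> (forall x, N < `|x| -> v x = 0) -> f v = 0.
Proof.
move=> lf fG GM v v0 vN.
pose K : set Rn := [set x | M + 1 <= `|x| /\ `|x| <= N].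
have cK : compact K.
  apply: bounded_closed_compact.
    exists N; split; first exact: num_real.
    by move=> N' NN' x [_ xN]; exact: le_trans xN (ltW NN').
  apply: closedI.
    apply: (@closed_comp _ _ (fun x : Rn => `|x|) [set r | M + 1 <= r]); last exact: closed_ge.
    by move=> x _; exact: norm_continuous.
  apply: (@closed_comp _ _ (fun x : Rn => `|x|) [set r | r <= N]); last exact: closed_le.
  by move=> x _; exact: norm_continuous.
have /choice[r Hr] : forall c : Rn, exists r : R, 0 < r /\
    (K c -> forall w, (forall x, 2 * r < `|x - c| -> w x = 0) -> f w = 0).
  move=> c; have [Kc|nKc] := pselect (K c); last by exists 1.
  have : ~ distr_support f c.
    by move=> /fG/GM; rewrite leNgt => /negP; apply; apply: lt_le_trans Kc.1; rewrite ltrDl.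
  move=> /contrapT[V [oV HV] Vc].
  by have [r r0 H] := supp_vanish_ball oV Vc HV; exists r.
have := cK; rewrite compact_cover => /(_ Rn K (fun c => ball c (r c))).
case=> [c _|x Kx|D DK KD]; first exact: ball_open.
  by exists x => //; apply: ballxx; exact: (Hr x).1.
apply: (vanish_finite_cover (l := [seq (c, r c) | c <- finmap.enum_fset D]) lf).
  move=> _ /mapP[c cD ->]; split; first exact: (Hr c).1.
  by apply: (Hr c).2; apply/set_mem; exact: DK.
move=> x vx.
have Kx : K x.
  split; rewrite leNgt; apply: contra vx; first by move=> /v0 ->.
  by move=> /vN ->.
have [c cD xc] := KD x Kx.
exists (c, r c); first by apply/mapP; exists c.
by move: xc; rewrite -ball_normE /ball_ /= distrC => /ltW.
Qed.

End support.

(** * Estimates by derivatives on a fixed ball *)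

Section local_estimates.
Variables (R : realType) (n : nat) (E : test_space).
Local Notation Rn := 'rV[R]_n.
Local Notation C := (R[i]^o).
Local Notation T := (testfun R n E).
Implicit Types (f : T -> C) (v w : T).

(** The difference v - w vanishes for |x| < j. Beyond, the bound of order p+1 on [v] has one power
    of 1 + |x| to spare, which gives 1/j, while the derivatives of phi(x/j) are bounded uniformly in
    j. *)
Lemma dilated_cutoff_bound (phi : Rn -> C) v p :
  smooth phi -> (forall x, `|x| <= 1 -> phi x = 1) -> (forall x, 2 < `|x| -> phi x = 0) ->
  exists K : R, forall (j : nat) (w : T), (0 < j)%N ->
    w = (fun x => phi (j%:R^-1 *: x) * v x) :> (Rn -> C) -> wbound p (K / j%:R) (v - w).
Proof.
move=> sphi phi1 phi0.
have [A HA] := smooth_bounded p sphi phi0.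
have A0 : 0 <= A by apply: le_trans (HA 0 [::] (leq0n _)); exact: normc_ge0.
have [B HB] := testfun_wbound p.+1 v; have B0 := wbound_ge0 HB.
exists (B + 2 ^+ p * (A * B)) => j w j0 wE.
have jR : 0 < j%:R :> R by rewrite ltr0n.
have ji : `|j%:R^-1 : R| = j%:R^-1 by rewrite gtr0_norm ?invr_gt0.
have ji1 : j%:R^-1 <= 1 :> R by rewrite invf_le1// ler1n.
have K0 : 0 <= B + 2 ^+ p * (A * B) by rewrite addr_ge0// mulr_ge0 ?exprn_ge0// mulr_ge0.
have sj : smooth (fun x => phi (j%:R^-1 *: x)) by exact: smooth_dilation.
move=> x s sp; have [xj|jx] := ltP `|x| j%:R.
  have op : open [set y : Rn | `|y| < j%:R].
    apply: (@open_comp _ _ (fun y : Rn => `|y|) [set r | r < j%:R]); last exact: open_lt.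
    by move=> y _; exact: norm_continuous.
  rewrite (mpartial_near0 s op)//; last first.
    move=> y /= yj; rewrite -[LHS]/(v y - w y) wE phi1 ?mul1r ?subrr//.
    by rewrite normrZ ji mulrC ler_pdivrMr// mul1r ltW.
  by rewrite ComplexField.Normc.normc0 mulr0 divr_ge0.
have vw : mpartial s (v - w) x = mpartial s v x - mpartial s w x.
  rewrite -[LHS]/(mpartial s ((v : Rn -> C) - (w : Rn -> C)) x).
  by rewrite mpartialB; [|exact: testfun_smooth|exact: testfun_smooth].
pose b := B / (1 + `|x|) ^+ p.+1.
have hb t : (size t <= p)%N -> normc (mpartial t v x) <= b.
  move=> tp; rewrite /b ler_pdivlMr ?weight_gt0// mulrC.
  by apply: HB; exact: leqW.
have hw : normc (mpartial s w x) <= 2 ^+ p * (A * b).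
  rewrite wE; apply: (@le_trans _ _ (2 ^+ size s * (A * b))).
    apply: leibniz_bound => // [|t ts|t ts]; first exact: testfun_smooth.
      rewrite mpartial_dilation// normcM normc_real.
      apply: (@le_trans _ _ (1 * A)); last by rewrite mul1r.
      apply: ler_pM; [exact: normr_ge0|exact: normc_ge0| |].
        by rewrite normrX ji exprn_ile1.
      by apply: HA; exact: leq_trans sp.
    by apply: hb; exact: leq_trans sp.
  rewrite ler_wpM2r ?ler_weXn2l ?ler1n//.
  by rewrite mulr_ge0// /b divr_ge0// ltW// weight_gt0.
rewrite vw; apply: (@le_trans _ _ ((1 + `|x|) ^+ p * (b + 2 ^+ p * (A * b)))).
  apply: ler_wpM2l; first exact: weight_ge0.
  by apply: (le_trans (normcD _ _)); rewrite normcN; apply: lerD => //; exact: hb.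
have -> : (1 + `|x|) ^+ p * (b + 2 ^+ p * (A * b)) = (B + 2 ^+ p * (A * B)) / (1 + `|x|).
  have x0 : 1 + `|x| != 0 by rewrite gt_eqF// ltr_pwDl.
  rewrite /b exprS; move: (2 ^+ p) => q; field.
  by rewrite x0 expf_neq0.
rewrite ler_wpM2l// lef_pV2 ?posrE ?ltr_pwDl//.
by apply: (le_trans jx); rewrite lerDr.
Qed.

Lemma stage_cutoff m v w (phi : Rn -> C) : w = (fun x => phi x * v x) :> (Rn -> C) ->
  stage E m v -> stage E m (v - w).
Proof.
rewrite /stage; case: E v w => // v w wE vm.
have wm : in_Dm m w.
  by split; [exact: testfun_smooth|move=> x mx; rewrite wE vm.2// mulr0].
by rewrite addrC -scaleN1r; exact: in_Dm_lin.
Qed.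

(** A function of S need not have bounded support: its cutoffs are annihilated by compactness and
    tend to it, and [f] is continuous. *)
Lemma vanish_support f (G : set Rn) (M : R) : linear f -> continuous f ->
  distr_support f `<=` G -> (forall x, G x -> `|x| <= M) ->
  forall v, (forall x, `|x| < M + 1 -> v x = 0) -> f v = 0.
Proof.
move=> lf cf fG GM v v0.
apply: ComplexField.Normc.eq0_normc; apply/eqP; rewrite eq_le normc_ge0 andbT.
apply/ler_addgt0Pr => e e0; rewrite add0r.
have f0 : f 0 = 0 by rewrite -(subrr (0 : T)) (linear_mapB lf) subrr.
have [m m0 vm] := stage_testfun v.
have : nbhs (0 : T) [set w | normc (f w) < e].
  apply: (cf 0 [set z : C | normc z < e]); apply/nbhs_complexP; exists e => // z.
  by rewrite f0 subr0.
move=> /nbhs_wbound-/(_ _ m0)[p [d d0 Hd]].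
have [phi [sphi phi1 phi0]] := @exists_bump R n.
have [K HK] := dilated_cutoff_bound v p sphi phi1 phi0.
pose j := (Num.truncn (K / d)).+1; have jR : 0 < j%:R :> R by rewrite ltr0n.
have ji : `|j%:R^-1 : R| = j%:R^-1 by rewrite gtr0_norm ?invr_gt0.
have [|x jx|w wE] := @exists_cutoff R n E (2 * j%:R) (fun x => phi (j%:R^-1 *: x)) v.
- exact: smooth_dilation.
- by apply: phi0; rewrite normrZ ji mulrC ltr_pdivlMr.
have fw : f w = 0.
  apply: (vanish_bounded_support (N := 2 * j%:R) lf fG GM) => x xM; rewrite wE.
    by rewrite v0// mulr0.
  by rewrite phi0 ?mul0r// normrZ ji mulrC ltr_pdivlMr.
have -> : f v = f (0 + (v - w)) by rewrite add0r (linear_mapB lf) fw subr0.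
apply/ltW/Hd; first exact: stage_cutoff wE vm.
apply: wbound_le (HK j w _ wE) => //.
by rewrite ler_pdivrMr// mulrC -ler_pdivrMr// ltW// truncnS_gt.
Qed.

Lemma continuous_seq_continuous_on (P : set T) (h : T -> C) m : (0 < m)%N ->
  (forall v, P v -> stage E m v) -> continuous h -> seq_continuous_on P h.
Proof.
move=> m0 Pm ch x Px e e0.
have : nbhs x [set y | normc (h y - h x) < e].
  by apply: (ch x [set z : C | normc (z - h x) < e]); apply/nbhs_complexP; exists e.
move=> /nbhs_wbound-/(_ _ m0)[p [d d0 Hd]].
by exists p, d => // v /Pm vm; exact: Hd.
Qed.

Lemma linear_bound_scale (P : set T) f p (d N : R) : linear f -> 0 < d ->
  (forall (a : R[i]) v, P v -> P (a *: v)) ->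
  (forall v, P v -> wbound p d v -> normc (f v) <= N) ->
  forall A v, P v -> wbound p A v -> normc (f v) <= N / d * A.
Proof.
move=> lf d0 PZ H A v Pv vA; have A0 := wbound_ge0 vA.
have N0 : 0 <= N.
  apply: le_trans (H (0 *: v) (PZ 0 v Pv) _); first exact: normc_ge0.
  rewrite scale0r => x s _; rewrite [mpartial s _](_ : _ = 0); last exact: mpartial0.
  by rewrite ComplexField.Normc.normc0 mulr0 ltW.
apply/ler_addgt0Pr => e e0.
(* [A] may be 0, so [v] is rescaled by a slightly larger [a]; the surplus contributes e N/(N+1) to
   the bound, less than e. *)
pose a := A + e * d / (N + 1).
have c0 : 0 < e * d / (N + 1) by rewrite divr_gt0 ?mulr_gt0// ltr_wpDl.
have a0 : 0 < a by rewrite ltr_wpDl.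
pose t : R := d / a; have t0 : 0 < t by rewrite divr_gt0.
have : normc (f ((t%:C : R[i]) *: v)) <= N.
  apply: H; first exact: PZ.
  apply: wbound_le (wboundZ _ (testfun_smooth v) vA).
  by rewrite normc_real gtr0_norm// /t mulrAC ler_pdivrMr// ler_wpM2l ?(ltW d0)// /a lerDl ltW.
rewrite (linear_mapZ lf) [normc _]normcM normc_real gtr0_norm//.
rewrite mulrC -ler_pdivlMr//; move/le_trans; apply.
rewrite /t invf_div mulrA -subr_ge0.
have -> : N / d * A + e - N * a / d = e / (N + 1).
  by rewrite /a; field; rewrite !gt_eqF// ltr_wpDl.
by rewrite divr_ge0 ?ltW// ltr_wpDl.
Qed.

(** The products of all test functions with one cutoff lie in a single D_m, where uniform
    boundedness applies. Hence [c] and [p] do not depend on the stage of [v]. *)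
Lemma uniform_lbound (f_ : nat -> T -> C) (M : R) : 0 < M ->
  (forall k, usual_distribution (f_ k)) ->
  (forall v, exists b, forall k, normc (f_ k v) <= b) ->
  (forall k v, (forall x, `|x| <= M -> v x = 0) -> f_ k v = 0) ->
  exists c : R, exists p, 0 <= c /\
    forall k A v, lbound (2 * M) p A v -> normc (f_ k v) <= c * A.
Proof.
move=> M0 fd fb fM.
have [chi [schi chi1 chi0]] := exists_bump_at (0 : Rn) M0.
have {}chi1 x : `|x| <= M -> chi x = 1 by rewrite -[x in `|x|]subr0; exact: chi1.
have {}chi0 x : 2 * M < `|x| -> chi x = 0 by rewrite -[x in `|x|]subr0; exact: chi0.
have [m m0 Mm] := exists_stage n (2 * M).
pose P : set T := [set v | in_Dm m v].
have PC : complete_subspace P by exact: complete_subspace_Dm.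
have Pm v : P v -> stage E m v by rewrite /P /stage /mkset; move: (testfun_val v) => u; case: (E).
have PZ (a : R[i]) v : P v -> P (a *: v) by exact: in_Dm_Z.
(* A linear functional satisfies the demi identity with r = 1 and s = t, so [id] and [setT] make
   this the Banach-Steinhaus theorem. *)
have [||||p [d d0 [N HN]]] := @demi_uniform_bound R n E P id setT f_ PC.
- by move=> k; apply: continuous_seq_continuous_on m0 Pm (fd k).2.
- by move=> x _; exact: fb.
- by exists 0%N, 1.
- move=> k x u t _ _; exists 1, t; split; [by rewrite subrr normr0|by []|].
  by rewrite (linear_mapD (fd k).1) (linear_mapZ (fd k).1) mul1r.
have [B HB] := smooth_bounded p schi chi0.
have B0 : 0 <= B by apply: le_trans (HB 0 [::] (leq0n _)); exact: normc_ge0.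
(* The largest weight on the support of the cutoff, times the Leibniz constant, times the bound of
   the derivatives of the cutoff. *)
pose K : R := (1 + 2 * M) ^+ p * (2 ^+ p * B).
have K0 : 0 <= K.
  by rewrite /K mulr_ge0// ?mulr_ge0 ?exprn_ge0// addr_ge0// mulr_ge0// ltW.
have N0 : 0 <= N.
  have [P0 _ _] := PC; apply: le_trans (HN 0 P0 _ 0%N); first exact: normc_ge0.
  move=> x s _; rewrite [mpartial s _](_ : _ = 0); last exact: mpartial0.
  by rewrite ComplexField.Normc.normc0 mulr0 ltW.
exists (N / d * K), p; split; first by rewrite mulr_ge0// divr_ge0// ltW.
move=> k A v vA.
have A0 : 0 <= A.
  apply: le_trans (vA 0 [::] _ (leq0n _)); first exact: normc_ge0.
  by rewrite normr0 mulr_ge0// ltW.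
have [w wE] := exists_cutoff v schi chi0.
have Pw : P w.
  by apply: in_Dm_of_norm Mm => [|x xM]; [exact: testfun_smooth|rewrite wE chi0 ?mul0r].
have -> : f_ k v = f_ k w.
  apply/eqP; rewrite -subr_eq0 -(linear_mapB (fd k).1); apply/eqP/fM => x xM.
  by rewrite -[LHS]/(v x - w x) wE chi1// mul1r subrr.
rewrite -mulrA.
apply: (linear_bound_scale (fd k).1 d0 PZ (fun v Pv vd => HN v Pv vd k) Pw).
move=> x s sp; have [xM|Mx] := leP `|x| (2 * M); last first.
  have op : open [set y : Rn | 2 * M < `|y|].
    apply: (@open_comp _ _ (fun y : Rn => `|y|) [set r | 2 * M < r]); last exact: open_gt.
    by move=> y _; exact: norm_continuous.
  rewrite (mpartial_near0 s op)//; last by move=> y My; rewrite wE chi0// mul0r.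
  by rewrite ComplexField.Normc.normc0 mulr0 mulr_ge0.
rewrite /K -!mulrA; apply: ler_pM; [exact: weight_ge0|exact: normc_ge0| |].
  by rewrite lerXn2r ?nnegrE ?addr_ge0// ?lerD2l// mulr_ge0// ltW.
rewrite wE; apply: (@le_trans _ _ (2 ^+ size s * (B * A))).
  apply: leibniz_bound => // [|t ts|t ts]; first exact: testfun_smooth.
    by apply: HB; exact: leq_trans sp.
  by apply: vA => //; exact: leq_trans sp.
by rewrite ler_wpM2r ?ler_weXn2l ?ler1n// mulr_ge0.
Qed.

End local_estimates.

(** * Convolution *)

Section convolution.
Variables (R : realType) (n : nat) (E : test_space).
Local Notation Rn := 'rV[R]_n.
Local Notation C := (R[i]^o).
Local Notation T := (testfun R n E).
Implicit Types (f : T -> C) (u v w : T).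

Lemma wbound_mpartial p s A (u : Rn -> C) : wbound (p + size s) A u -> wbound p A (mpartial s u).
Proof.
move=> uA x t tp; rewrite -mpartial_cat.
apply: le_trans (uA x (t ++ s) _); last by rewrite size_cat leq_add2r.
by rewrite ler_wpM2r ?normc_ge0// ler_weXn2l ?leq_addr// lerDl.
Qed.

Lemma mpartial_test_pred s u : mpartial s u \in test_pred E.
Proof.
apply/asboolP; have := testfunP u; have := testfun_in_S u.
move: (testfun_val u) => {}u uS; case: (E) => [[m m0 um]|_].
  exists m => //; split; first exact: smooth_mpartial um.1.
  by move=> x; exact: in_Dm_mpartial0.
apply: wbound_in_S => [|p]; first exact: smooth_mpartial uS.1.
by exists (2 ^+ (p + size s) * normS (p + size s) u); apply/wbound_mpartial/normS_wbound.
Qed.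

Definition dtest s u : T := TestFun (mpartial_test_pred s u).

(** Evaluation of a derivative at a point as a functional, so that the general lemmas on linear maps
    apply to it. *)
Definition dval s (y : Rn) u : C := mpartial s u y.

Lemma dval_linear s y : linear (dval s y).
Proof.
move=> a u v; rewrite /dval -[X in mpartial s X y]/(a *: (u : Rn -> C) + v).
by rewrite mpartial_lin//; exact: testfun_smooth.
Qed.

Lemma dval_translate s y x u : dval s y (translate x u) = mpartial s u (x + y).
Proof. by rewrite /dval -[X in mpartial s X y]/(shiftf x u) mpartial_shift. Qed.

Lemma dtest_cons i s u : dtest [:: i] (dtest s u) = dtest (i :: s) u.
Proof. exact: val_inj. Qed.

(** Peetre's inequality 1 + |x| <= (1 + |y|)(1 + |x + y|), raised to the power q. *)
Lemma weight_translate (x y : Rn) (M : R) q : `|y| <= M ->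
  (1 + `|x|) ^+ q <= (1 + M) ^+ q * (1 + `|x + y|) ^+ q.
Proof.
move=> yM; have M0 : 0 <= M := le_trans (normr_ge0 y) yM.
rewrite -exprMn lerXn2r ?nnegrE ?mulr_ge0 ?addr_ge0//.
have : `|x| <= `|x + y| + `|y| by rewrite -{1}(addrK y x); exact: ler_normB.
have : 0 <= M * `|x + y| by rewrite mulr_ge0.
by lra.
Qed.

(** Of the p + q derivatives available, p feed the local seminorm and q the derivative [s]; the
    weight gives the decay of order q in x that a convolution needs to lie in S. *)
Lemma lbound_translate_dtest (x : Rn) s (M : R) p q A u : 0 <= M -> (size s <= q)%N ->
  wbound (p + q) A u ->
  lbound M p ((1 + M) ^+ q * A / (1 + `|x|) ^+ q) (translate x (dtest s u)).
Proof.
move=> M0 sq uA y t yM tp.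
have -> : mpartial t (translate x (dtest s u)) y = mpartial (t ++ s) u (x + y).
  by rewrite mpartial_cat; exact: dval_translate.
rewrite ler_pdivlMr ?weight_gt0// mulrC.
have := uA (x + y) (t ++ s); rewrite size_cat leq_add// => /(_ isT) H.
apply: (@le_trans _ _ ((1 + M) ^+ q * (1 + `|x + y|) ^+ q * normc (mpartial (t ++ s) u (x + y)))).
  by rewrite ler_wpM2r ?normc_ge0// weight_translate.
rewrite -mulrA ler_wpM2l ?exprn_ge0 ?addr_ge0//; apply: le_trans H.
by rewrite ler_wpM2r ?normc_ge0// ler_weXn2l ?leq_addl// lerDl.
Qed.

Definition local_bound (M : R) (p : nat) (c : R) f :=
  forall A v, lbound M p A v -> normc (f v) <= c * A.

Section one_distribution.
Variables (f : T -> C) (M : R) (p : nat) (c : R).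
Hypotheses (lf : linear f) (M0 : 0 <= M) (c0 : 0 <= c) (fb : local_bound M p c f).

(** Differentiation under [f]: the Taylor remainder of the translates of [u] is O(|v|^2) for the
    local seminorm controlling [f]. Two derivatives beyond [p] are spent on Taylor's formula. *)
Lemma partial_conv_fun u x : cdifferentiable (conv_fun f u) x /\
  forall i, partial i (conv_fun f u) x = conv_fun f (dtest [:: i] u) x.
Proof.
have [A HA] := testfun_wbound p.+2 u.
apply: (@cdifferentiable_quadratic _ _ _ _ _ (c * (2 * (n%:R * (n%:R * A))))) => v v1.
pose w := translate (x + v) u - translate x u -
  \sum_i ((v 0 i)%:C : R[i]) *: translate x (dtest [:: i] u).
have -> : conv_fun f u (x + v) - conv_fun f u x -
    \sum_i (v 0 i)%:C * conv_fun f (dtest [:: i] u) x = f w.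
  rewrite /w !(linear_mapB lf) (linear_map_sum lf); congr (_ - _).
  by apply: eq_bigr => i _; rewrite (linear_mapZ lf).
rewrite -mulrA; apply: fb => y s yM sp.
have lin := dval_linear s y.
rewrite -/(dval s y w) /w !(linear_mapB lin) (linear_map_sum lin) !dval_translate.
have -> : x + v + y = x + y + v by rewrite addrAC.
have su := testfun_smooth u.
rewrite (eq_bigr (fun i => (v 0 i)%:C * partial i (mpartial s u) (x + y))); last first.
  move=> i _; rewrite (linear_mapZ lin) dval_translate -mpartial_partial//.
apply: complex_taylor2; first exact: smooth_mpartial.
by move=> i j z; apply: (wbound_pointwise z HA (s := [:: j, i & s])); rewrite /= !ltnS.
Qed.

Lemma mpartial_conv_fun s u : mpartial s (conv_fun f u) = conv_fun f (dtest s u).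
Proof.
elim: s => [|i s IH]; first by congr conv_fun; exact: val_inj.
by rewrite /= IH; apply/funext => x; rewrite (partial_conv_fun _ x).2 dtest_cons.
Qed.

Lemma smooth_conv_fun u : smooth (conv_fun f u).
Proof. by move=> s x; rewrite mpartial_conv_fun; exact: (partial_conv_fun _ x).1. Qed.

Lemma conv_fun_wbound q A u : wbound (p + q) A u ->
  wbound q (c * ((1 + M) ^+ q * A)) (conv_fun f u).
Proof.
move=> uA x s sq; rewrite mpartial_conv_fun mulrC -ler_pdivlMr ?weight_gt0// -mulrA.
by apply: fb; exact: lbound_translate_dtest.
Qed.

Lemma conv_fun_in_Dm (m m' : nat) u : n%:R * (m%:R + M) <= m'%:R :> R -> in_Dm m u ->
  in_Dm m' (conv_fun f u).
Proof.
move=> mm um; apply: (@in_Dm_of_norm _ _ (m%:R + M)) => // [|x xm].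
  exact: smooth_conv_fun.
apply: ComplexField.Normc.eq0_normc; apply/eqP; rewrite eq_le normc_ge0 andbT.
(* On the ball seen by [f] the translate vanishes with all its derivatives, so the local estimate
   applies with A = 0. *)
rewrite -(mulr0 c); apply: fb => y s yM _.
rewrite -/(dval s y (translate x u)) dval_translate (in_Dm_mpartial0 s um).
  by rewrite ComplexField.Normc.normc0.
rewrite ltNge; apply/negP => /euclid_ball xym.
have : `|x| <= `|x + y| + `|y| by rewrite -{1}(addrK y x); exact: ler_normB.
by move: xm; rewrite ltNge => /negP + h; apply; apply: (le_trans h); exact: lerD.
Qed.

Lemma mem_test_conv_fun u : mem_test E (conv_fun f u).
Proof.
have [m m0 um] := stage_testfun u.
have [m' m'0 mm] := exists_stage n (m%:R + M : R).
have H := @conv_fun_in_Dm m m' u mm; have Sf : in_S (conv_fun f u).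
  apply: wbound_in_S => [|q]; first exact: smooth_conv_fun.
  have [A HA] := testfun_wbound (p + q) u.
  by exists (c * ((1 + M) ^+ q * A)); exact: conv_fun_wbound.
move: (conv_fun f u) Sf H => h Sf; move: um; rewrite /stage.
by move: (testfun_val u) => w; case: (E) => // wm H; exists m' => //; exact: H.
Qed.

Lemma to_test_conv_fun u : to_test E (conv_fun f u) = conv_fun f u :> (Rn -> C).
Proof. by apply: insubdK; apply/asboolP; exact: mem_test_conv_fun. Qed.

Lemma stage_conv (m m' : nat) u : n%:R * (m%:R + M) <= m'%:R :> R -> stage E m u ->
  stage E m' (to_test E (conv_fun f u)).
Proof.
move=> mm; rewrite to_test_conv_fun; have := @conv_fun_in_Dm m m' u mm.
by rewrite /stage; move: (conv_fun f u) (testfun_val u) => h w; case: (E).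
Qed.

(** A convergent sequence is bounded, hence lies in one stage, and so do its convolutions; there
    [wbound] tests neighborhoods. *)
Lemma bounded_support_multiplier : convolution_multiplier f.
Proof.
split=> [u|u_ uc V nV]; first exact: mem_test_conv_fun.
have [[m m0 um] _] := tvs_bounded_wbound (cvg_tvs_bounded uc).
have [m' m'0 mm] := exists_stage n (m%:R + M : R).
have [q [e e0 He]] := nbhs_wbound nV m'0.
pose K := c * (1 + M) ^+ q.
have K0 : 0 <= K by rewrite mulr_ge0// exprn_ge0// addr_ge0.
pose d := e / (K + 1); have d0 : 0 < d by rewrite divr_gt0// ltr_wpDl.
have d20 : 0 < d / 2 ^+ (p + q) by rewrite divr_gt0// exprn_gt0.
have [N _ HN] := uc _ (test_nbhs0 (@nbhs0_base_normS R n E (p + q) _ d20)).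
exists N => // k /HN /= uk; rewrite -[to_test _ _]add0r; apply: He.
  by apply: stage_conv mm _; apply: um; exists k.
have ud : wbound (p + q) d (u_ k).
  apply: wbound_le (normS_wbound (testfun_in_S (u_ k))).
  by rewrite mulrC -ler_pdivlMr ?exprn_gt0// ltW.
rewrite to_test_conv_fun; apply: wbound_le (conv_fun_wbound ud).
rewrite mulrA -/K /d mulrA ler_pdivrMr ?ltr_wpDl//.
by rewrite mulrDr mulr1 mulrC lerDl ltW.
Qed.

End one_distribution.

End convolution.

(** * Finite nets and uniform convergence *)

Section finite_nets.
Variables (R : realType).

(** Pigeonhole: each value is rounded to a cell of width e, giving finitely many codes, and one
    point of [K] is kept for each code that occurs. *)
Lemma finite_net (I : finType) (X : choiceType) (K : set X) (phi : I -> X -> R) (A e : R) :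
  0 < e -> (forall x i, K x -> `|phi i x| <= A) ->
  exists F : seq X, (forall y, y \in F -> K y) /\
    forall x, K x -> exists2 y, y \in F & forall i, `|phi i x - phi i y| <= e.
Proof.
move=> e0 KA.
pose m := Num.truncn (2 * A / e).
pose code x : {ffun I -> 'I_m.+1} := [ffun i => inord (Num.truncn ((phi i x + A) / e))].
have /choice[r Hr] : forall c, exists o : option X,
    if o is Some x then K x /\ code x = c else forall x, K x -> code x != c.
  move=> c; have [[x [Kx xc]]|nx] := pselect (exists x, K x /\ code x = c).
    by exists (Some x).
  by exists None => x Kx; apply/negP => /eqP xc; apply: nx; exists x.
exists (pmap r (enum {ffun I -> 'I_m.+1})); split=> [y|x Kx].
  by rewrite mem_pmap => /mapP[c _]; have := Hr c; case: (r c) => // z [Kz _] [->].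
have := Hr (code x); case rx: (r (code x)) => [y|]; last by move/(_ x Kx); rewrite eqxx.
move=> [Ky yx]; exists y.
  by rewrite mem_pmap; apply/mapP; exists (code x); rewrite ?mem_enum.
move=> i; have val z : K z ->
    let c := Num.truncn ((phi i z + A) / e) in
    nat_of_ord (code z i) = c /\ c%:R * e <= phi i z + A < c.+1%:R * e.
  move=> Kz; have := KA z i Kz; rewrite ler_norml => /andP[h1 h2] /=; split.
    rewrite ffunE inordK// ltnS; apply: le_truncn.
    by rewrite ler_pM2r ?invr_gt0// mulr2n mulrDl mul1r lerD2r.
  have z0 : 0 <= (phi i z + A) / e by rewrite divr_ge0 ?(ltW e0)// -lerBlDr sub0r.
  by have := truncn_itv z0; rewrite ler_pdivlMr// ltr_pdivrMr.
have [xE /andP[x1 x2]] := val x Kx; have [yE /andP[y1 y2]] := val y Ky.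
move: y1 y2; rewrite -yE yx => y1 y2.
move: x1 x2 y1 y2; rewrite -xE; move: (nat_of_ord (code x i)) => c.
rewrite -[c.+1%:R]natr1 mulrDl mul1r; move: (c%:R * e) (phi i x) (phi i y) => q a b x1 x2 y1 y2.
by rewrite ler_norml; apply/andP; split; lra.
Qed.

Lemma eventually_all (X : eqType) (F : seq X) (P : nat -> X -> Prop) :
  (forall x, x \in F -> exists N, forall k, (N <= k)%N -> P k x) ->
  exists N, forall k, (N <= k)%N -> forall x, x \in F -> P k x.
Proof.
elim: F => [|x F IH] H; first by exists 0%N.
have [N1 H1] := H x (mem_head _ _).
have [y yF|N2 H2] := IH; first by apply: H; rewrite inE yF orbT.
exists (maxn N1 N2) => k; rewrite geq_max => /andP[k1 k2] y.
by rewrite inE => /predU1P[->|]; [exact: H1|exact: H2].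
Qed.

Lemma bounded_all (X : eqType) (F : seq X) (h : nat -> X -> R) :
  (forall x, x \in F -> exists b, forall k, h k x <= b) ->
  exists b, forall k x, x \in F -> h k x <= b.
Proof.
elim: F => [|x F IH] H; first by exists 0.
have [b1 H1] := H x (mem_head _ _).
have [y yF|b2 H2] := IH; first by apply: H; rewrite inE yF orbT.
exists (Num.max b1 b2) => k y; rewrite inE le_max => /predU1P[->|yF]; first by rewrite H1.
by rewrite H2// orbT.
Qed.

End finite_nets.

(** * Precompactness of bounded sets of test functions *)

Section test_nets.
Variables (R : realType) (n : nat) (E : test_space).
Local Notation Rn := 'rV[R]_n.
Local Notation C := (R[i]^o).
Local Notation T := (testfun R n E).
Implicit Types (f : T -> C) (u v w : T).

Lemma ball_net (M e : R) : 0 < e -> exists F : seq Rn, (forall y, y \in F -> `|y| <= M) /\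
  forall x : Rn, `|x| <= M -> exists2 y, y \in F & `|x - y| <= e.
Proof.
move=> e0.
have [x i xM|F [F1 F2]] := @finite_net R 'I_n Rn [set x | `|x| <= M] (fun i x => x 0 i) M e e0.
  exact: le_trans (coord_le_norm x i) xM.
exists F; split=> // x xM; have [y yF xy] := F2 x xM; exists y => //.
by apply: norm_rV_le => [|i]; [exact: ltW|have := xy i; rewrite !mxE].
Qed.

Lemma segment_ball (x y : Rn) (M t : R) : `|x| <= M -> `|y| <= M -> 0 <= t <= 1 ->
  `|x + t *: (y - x)| <= M.
Proof.
move=> xM yM /andP[t0 t1].
have -> : x + t *: (y - x) = (1 - t) *: x + t *: y.
  by rewrite scalerBr scalerBl scale1r addrA addrAC.
apply: (le_trans (ler_normD _ _)); rewrite !normrZ (ger0_norm t0) ger0_norm ?subr_ge0//.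
have -> : M = (1 - t) * M + t * M by ring.
by apply: lerD; apply: ler_wpM2l => //; rewrite subr_ge0.
Qed.

(** The Arzela-Ascoli argument. Derivatives of order at most p are compared at the points of a net
    of the ball, and the bound at order p+1 makes them equi-Lipschitz between these points. *)
Lemma lbound_net (K : set T) (M e A : R) p : 0 < e ->
  (forall v, K v -> lbound M p.+1 A v) ->
  exists F : seq T, (forall w, w \in F -> K w) /\
    forall v, K v -> exists2 w, w \in F & lbound M p e (v - w).
Proof.
move=> e0 KA.
(* The Lipschitz constant is 2 n |A|, so a displacement by [d] costs at most e/4; two displacements
   and e/2 at the net point make e. *)
pose d : R := e / (8 * (n%:R * `|A| + 1)).
have nA : 0 < n%:R * `|A| + 1 :> R by rewrite ltr_wpDl// mulr_ge0.
have d0 : 0 < d by rewrite divr_gt0// mulr_gt0.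
have [X [X1 X2]] := ball_net M d0.
(* A finite index type: a list of at most p directions, a net point, and real or imaginary part. *)
pose I := ({k : 'I_p.+1 & k.-tuple 'I_n} * 'I_(size X) * bool)%type.
pose phi (i : I) v := (if i.2 then @complex.Re R else @complex.Im R)
  (mpartial (tagged i.1.1) v (nth 0 X i.1.2)).
have e4 : 0 < e / 4 by rewrite divr_gt0.
have [v [[[k t] j] b] Kv|F [F1 F2]] := @finite_net R I T K phi A (e / 4) e4.
  have H : normc (mpartial t v (nth 0 X j)) <= A.
    apply: (KA v Kv); first by apply: X1; rewrite mem_nth.
    by rewrite size_tuple; exact: ltnW (ltn_ord k).
  by rewrite /phi /=; case: b; [exact: le_trans (Re_normc _) H|exact: le_trans (Im_normc _) H].
exists F; split=> // v Kv; have [w wF vw] := F2 v Kv; exists w => // y s yM sp.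
have [x xX yx] := X2 y yM.
have xM := X1 x xX.
have lip u : K u -> normc (mpartial s u y - mpartial s u x) <= e / 4.
  move=> Ku; rewrite -[y in mpartial s u y](subrKC x).
  apply: (le_trans (complex_lipschitz (K := `|A|) _ _)) => [z|t i t01|].
  - exact: testfun_smooth.
  - apply: le_trans (ler_norm A); apply: (KA u Ku _ (i :: s)) => //.
    exact: segment_ball.
  apply: (@le_trans _ _ (2 * (n%:R * `|A| * d))).
    by rewrite ler_wpM2l// ler_wpM2l// mulr_ge0.
  rewrite /d; have -> : 2 * (n%:R * `|A| * (e / (8 * (n%:R * `|A| + 1)))) =
      e / 4 * (n%:R * `|A| / (n%:R * `|A| + 1)) by field; rewrite gt_eqF.
  by rewrite ler_piMr ?(ltW e4)// ler_pdivrMr// mul1r lerDl.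
have at_x : normc (mpartial s v x - mpartial s w x) <= e / 2.
  have jX : (index x X < size X)%N by rewrite index_mem.
  have kp : (size s < p.+1)%N by rewrite ltnS.
  pose t : {k : 'I_p.+1 & k.-tuple 'I_n} :=
    Tagged (fun k : 'I_p.+1 => k.-tuple 'I_n) (in_tuple s : (Ordinal kp).-tuple 'I_n).
  have h1 := vw (t, Ordinal jX, true); have h2 := vw (t, Ordinal jX, false).
  move: h1 h2; rewrite /phi /= !nth_index// => h1 h2.
  apply: (le_trans (normc_le _)); rewrite ReB ImB.
  by apply: (le_trans (lerD h1 h2)); lra.
have -> : mpartial s (v - w) y = mpartial s v y - mpartial s w y.
  rewrite -[LHS]/(mpartial s ((v : Rn -> C) - (w : Rn -> C)) y).
  by rewrite mpartialB; [|exact: testfun_smooth|exact: testfun_smooth].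
have tri (a b a' b' : R[i]) : normc (a - b) <= normc (a - a') + (normc (a' - b') + normc (b - b')).
  have -> : a - b = (a - a') + ((a' - b') - (b - b')) by ring.
  apply: (le_trans (normcD _ _)); rewrite lerD2l.
  by apply: (le_trans (normcD _ _)); rewrite normcN.
apply: (le_trans (tri _ _ (mpartial s v x) (mpartial s w x))).
by apply: (le_trans (lerD (lip v Kv) (lerD at_x (lip w (F1 w wF))))); lra.
Qed.

Lemma wbound_net (B : set T) p (e : R) : 0 < e ->
  (forall q, exists A, forall v, B v -> wbound q A v) ->
  exists F : seq T, (forall w, w \in F -> B w) /\
    forall v, B v -> exists2 w, w \in F & wbound p e (v - w).
Proof.
move=> e0 BA; have [A0 HA0] := BA p.+1; pose A := `|A0|.
have HA v : B v -> wbound p.+1 A v by move=> /HA0; apply: wbound_le; exact: ler_norm.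
(* Beyond this radius the difference of two members of [B], bounded by 2A at order p+1, is below e
   at order p; inside, the local net is used. *)
pose M := 2 * A / e; have Age0 : 0 <= A by exact: normr_ge0.
have M0 : 0 <= M by exact: divr_ge0 (mulr_ge0 _ Age0) (ltW e0).
have c0 : 0 < (1 + M) ^+ p by rewrite exprn_gt0// ltr_pwDl.
have [|F [F1 F2]] := lbound_net (K := B) (M := M) (A := A) (p := p) (divr_gt0 e0 c0).
  by move=> v Bv; apply: wbound_lbound; exact: HA.
exists F; split=> // v Bv; have [w wF vw] := F2 v Bv; exists w => // x s sp.
have [xM|Mx] := leP `|x| M.
  apply: (@le_trans _ _ ((1 + M) ^+ p * (e / (1 + M) ^+ p))).
    apply: ler_pM; [exact: weight_ge0|exact: normc_ge0| |exact: vw].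
    by rewrite lerXn2r ?nnegrE ?addr_ge0// lerD2l.
  by rewrite mulrC divfK// gt_eqF.
have H := wboundB (testfun_smooth v) (testfun_smooth w) (HA v Bv) (HA w (F1 w wF)).
have {}H := H x s (leqW sp).
have x1 : 0 < 1 + `|x| by rewrite ltr_pwDl.
rewrite -(ler_pM2l x1) mulrA -exprS; apply: (le_trans H).
have : 2 * A < `|x| * e by rewrite -ltr_pdivrMr.
rewrite (mulr2n 1) mulrDl mul1r => /ltW/le_trans; apply.
by rewrite mulrDl mul1r lerDr ltW.
Qed.

Lemma lboundZ (M : R) p A (a : R[i]) u : lbound M p A u -> lbound M p (normc a * A) (a *: u).
Proof.
move=> uA x s xM sp.
have -> : mpartial s (a *: u) x = a * mpartial s u x.
  rewrite -/(dval s x (a *: u)) (linear_mapZ (@dval_linear R n E s x))//.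
by rewrite normcM ler_wpM2l ?normc_ge0// uA.
Qed.

(* The weighted translates (1 + |x|)^q *: d^s xi (x + .), over all x and xi in B, are bounded
   for the local seminorms controlling the f_k, hence have finite nets for these. *)
Lemma conv_fun_uniform_cvg (f_ : nat -> T -> C) f (M : R) p (c : R) (B : set T) :
  0 <= M -> 0 <= c -> linear f -> (forall k, linear (f_ k)) ->
  local_bound M p c f -> (forall k, local_bound M p c (f_ k)) ->
  (forall v, f_ k v @[k --> \oo] --> f v) ->
  (forall q, exists A, forall v, B v -> wbound q A v) ->
  forall q (e : R), 0 < e -> exists N, forall k, (N <= k)%N -> forall v, B v ->
    wbound q e (to_test E (conv_fun (f_ k) v) - to_test E (conv_fun f v)).
Proof.
move=> M0 c0 lf lf_ fb fb_ fc BA q e e0.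
pose scaled (x : Rn) s v : T := (((1 + `|x|) ^+ q)%:C : R[i]) *: translate x (dtest s v).
pose K : set T := [set u | exists x s v, [/\ (size s <= q)%N, B v & u = scaled x s v]].
have [A HA] := BA (p.+1 + q)%N.
have KA u : K u -> lbound M p.+1 ((1 + M) ^+ q * A) u.
  move=> [x [s [v [sq Bv ->]]]].
  have := lboundZ ((1 + `|x|) ^+ q)%:C (lbound_translate_dtest x M0 sq (HA v Bv)).
  rewrite normc_real ger0_norm ?weight_ge0// mulrC divfK// gt_eqF// weight_gt0//.
(* Chosen so that 2 c d <= e/2, and meaningful even for c = 0. *)
pose d := e / (4 * c + 2); have d0 : 0 < d by rewrite divr_gt0// ltr_wpDl// mulr_ge0.
have [F [F1 F2]] := lbound_net d0 KA.
have [w wF|N HN] := @eventually_all _ F (fun k w => normc (f_ k w - f w) <= e / 2).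
  have [|N HN] := (cvg_complexP _ _).1 (fc w) (e / 2); first by rewrite divr_gt0.
  by exists N => k /HN /ltW.
exists N => k Nk v Bv x s sq.
have close u : K u -> normc (f_ k u - f u) <= e.
  move=> Ku; have [w wF uw] := F2 u Ku.
  have -> : f_ k u - f u = (f_ k (u - w) - f (u - w)) + (f_ k w - f w).
    by rewrite (linear_mapB (lf_ k)) (linear_mapB lf); ring.
  apply: (le_trans (normcD _ _)).
  apply: (@le_trans _ _ ((c * d + c * d) + e / 2)).
    apply: lerD; last exact: HN.
    apply: (le_trans (normcD _ _)); rewrite normcN.
    by apply: lerD; [exact: fb_|exact: fb].
  have -> : c * d + c * d = e / 2 * (4 * c / (4 * c + 2)).
    by rewrite /d; field; rewrite gt_eqF// ltr_wpDl// mulr_ge0.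
  suff : e / 2 * (4 * c / (4 * c + 2)) <= e / 2 by lra.
  rewrite ler_piMr ?divr_ge0 ?(ltW e0)// ler_pdivrMr; last by rewrite ltr_wpDl// mulr_ge0.
  by rewrite mul1r lerDl.
have -> : mpartial s (to_test E (conv_fun (f_ k) v) - to_test E (conv_fun f v)) x =
    f_ k (translate x (dtest s v)) - f (translate x (dtest s v)).
  rewrite -/(dval s x _) (linear_mapB (@dval_linear R n E s x)) /dval.
  rewrite (to_test_conv_fun (lf_ k) M0 (fb_ k)) (to_test_conv_fun lf M0 fb).
  by rewrite (mpartial_conv_fun (lf_ k) (fb_ k)) (mpartial_conv_fun lf fb).
have Ks : K (scaled x s v) by exists x, s, v.
have := close _ Ks; rewrite /scaled (linear_mapZ (lf_ k)) (linear_mapZ lf) -scalerBr.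
by rewrite [normc _]normcM normc_real ger0_norm ?weight_ge0.
Qed.

End test_nets.

Section limits.
Variables (R : realType) (n : nat) (E : test_space).
Local Notation Rn := 'rV[R]_n.
Local Notation C := (R[i]^o).
Local Notation T := (testfun R n E).
Implicit Types (u v w : T).

Lemma cvg_seq_bounded (z_ : nat -> C) (z : C) : z_ @ \oo --> z ->
  exists b : R, forall k, normc (z_ k) <= b.
Proof.
move=> /cvg_complexP/(_ 1 ltr01)[N HN].
have [|b Hb] := @bounded_all R _ (iota 0 N) (fun _ k => normc (z_ k)).
  by move=> k _; exists (normc (z_ k)).
exists (Num.max b (normc z + 1)) => k; rewrite le_max; have [kN|Nk] := ltnP k N.
  by rewrite Hb ?mem_iota ?add0n.
apply/orP; right; rewrite -[z_ k](subrKC z).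
by apply: (le_trans (normcD _ _)); rewrite lerD2l ltW// HN.
Qed.

Lemma linear_limit (f_ : nat -> T -> C) (f : T -> C) : (forall k, linear (f_ k)) ->
  (forall v, f_ k v @[k --> \oo] --> f v) -> linear f.
Proof.
move=> lf fc a u v; apply/eqP; rewrite -subr_eq0; apply/eqP/ComplexField.Normc.eq0_normc.
apply/eqP; rewrite eq_le normc_ge0 andbT; apply/ler_addgt0Pr => e e0; rewrite add0r.
pose d := e / (normc a + 2).
have d0 : 0 < d by rewrite divr_gt0// ltr_wpDl// normc_ge0.
have [N1 H1] := (cvg_complexP _ _).1 (fc (a *: u + v)) d d0.
have [N2 H2] := (cvg_complexP _ _).1 (fc u) d d0.
have [N3 H3] := (cvg_complexP _ _).1 (fc v) d d0.
pose k := maxn N1 (maxn N2 N3).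
have scE (z : C) : a *: z = a * z by [].
have {}H1 := H1 k (leq_maxl _ _).
have {}H2 : normc (f_ k u - f u) < d by apply: H2; rewrite /k !leq_max leqnn orbT.
have {}H3 : normc (f_ k v - f v) < d by apply: H3; rewrite /k !leq_max leqnn !orbT.
have -> : f (a *: u + v) - (a *: f u + f v) =
    a * (f_ k u - f u) + (f_ k v - f v) - (f_ k (a *: u + v) - f (a *: u + v)).
  by rewrite (lf k) !scE; ring.
apply: (@le_trans _ _ ((normc a * d + d) + d)).
  apply: (le_trans (normcD _ _)); rewrite normcN; apply: lerD; last exact: ltW.
  apply: (le_trans (normcD _ _)); apply: lerD; last exact: ltW.
  by rewrite normcM ler_wpM2l ?normc_ge0// ltW.
have -> : normc a * d + d + d = (normc a + 2) * d by ring.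
by rewrite /d mulrC divfK// gt_eqF// ltr_wpDl// normc_ge0.
Qed.

Lemma local_bound_limit (f_ : nat -> T -> C) (f : T -> C) (M : R) p c :
  (forall k, local_bound M p c (f_ k)) ->
  (forall v, f_ k v @[k --> \oo] --> f v) -> local_bound M p c f.
Proof.
move=> fb fc A v vA; apply/ler_addgt0Pr => e e0.
have [N HN] := (cvg_complexP _ _).1 (fc v) e e0.
rewrite -[f v](subrKC (f_ N v)); apply: (le_trans (normcD _ _)).
by apply: lerD; [exact: fb|rewrite normcB ltW// HN].
Qed.

Lemma C0_small (gamma : C -> C) (e : R) : C0 gamma -> 0 < e ->
  exists t : R, [/\ 0 < t, t <= 1 & normc (gamma t%:C) < e].
Proof.
move=> [gc _ _] e0.
have : nbhs (0 : C) [set t | normc (gamma t) < e].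
  apply: (gc [set z : C | normc z < e]); apply/nbhs_complexP; exists e => // z.
  by rewrite subr0.
move=> /nbhs_complexP[d d0 Hd]; exists (Num.min (d / 2) 1); split.
- by rewrite lt_min divr_gt0/=.
- by rewrite ge_min lexx orbT.
apply: Hd; rewrite subr0 normc_real ger0_norm; last by rewrite le_min ler01 divr_ge0// ltW.
by rewrite gt_min; apply/orP; left; rewrite ltr_pdivrMr// mulr2n mulrDr mulr1 ltrDl.
Qed.

End limits.

(** * The joint limit of f_k * g_m *)

Section convergence.
Variables (R : realType) (n : nat) (E : test_space).
Local Notation Rn := 'rV[R]_n.
Local Notation C := (R[i]^o).
Local Notation T := (testfun R n E).
Implicit Types (u v w : T).

(** With x a net point of f * B near f * v, the error splits into the increments of g_j from x to
    f_k * v and of g from x to f * v, and the difference g_j x - g x; each is at most e/4. *)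
Lemma demi_conv_uniform_cvg (U : set T) (gamma : C -> C) (f_ : nat -> T -> C) (f : T -> C)
    (g_ : nat -> T -> C) (g : T -> C) (M : R) p (c : R) (B : set T) :
  nbhs (0 : T) U -> C0 gamma ->
  0 <= M -> 0 <= c -> linear f -> (forall k, linear (f_ k)) ->
  local_bound M p c f -> (forall k, local_bound M p c (f_ k)) ->
  (forall v, f_ k v @[k --> \oo] --> f v) ->
  demi_distribution gamma U g -> (forall k, demi_distribution gamma U (g_ k)) ->
  (forall v, g_ k v @[k --> \oo] --> g v) -> tvs_bounded B ->
  forall e : R, 0 < e -> exists N, forall k j, (N <= k)%N -> (N <= j)%N -> forall v, B v ->
    normc (conv_demi (f_ k) (g_ j) v - conv_demi f g v) < e.
Proof.
move=> nU gamma0 M0 c0 lf lf_ fb fb_ fc gd gd_ gc bB e e0.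
have [[m m0 Bm] BA] := tvs_bounded_wbound bB.
have [m' m'0 mm] := exists_stage n (m%:R + M : R).
pose P : set T := [set v | stage E m' v].
have PC : complete_subspace P by exact: complete_subspace_stage.
have [P0 Plin _] := PC.
have PB v w : P v -> P w -> P (v - w) by move=> Pv Pw; rewrite addrC -scaleN1r; exact: Plin.
(* The limit [g] joins the family at index 0, so that it shares all uniform estimates. *)
pose h j : T -> C := if j is j'.+1 then g_ j' else g.
have hd j : demi_distribution gamma U (h j) by case: j.
have hb x : exists b : R, forall j, normc (h j x) <= b.
  have [b Hb] := cvg_seq_bounded (gc x).
  exists (Num.max (normc (g x)) b) => -[|j] /=; first by rewrite le_max lexx.
  by rewrite le_max Hb orbT.
have [p2 [e2 e20 HU]] := nbhs_wbound nU m'0.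
have [||||p1 [d1 d10 [N1 HN1]]] := @demi_uniform_bound R n E P gamma U h PC.
- move=> j; have [ch _ _] := hd j.
  exact: (@continuous_seq_continuous_on R n E P (h j) m' m'0 (fun v Pv => Pv) ch).
- by move=> x _; exact: hb.
- by exists p2, e2 => // v Pv ve; rewrite -[v]add0r; exact: HU.
- by move=> j; have [] := hd j.
pose q := maxn p1 p2; pose d := Num.min d1 e2.
have d0 : 0 < d by rewrite lt_min d10.
have small v : P v -> wbound q d v -> U v /\ forall j, normc (h j v) <= N1.
  move=> Pv vd; split.
    rewrite -[v]add0r; apply: HU => //; apply: wbound_order (leq_maxr p1 p2) _.
    by apply: wbound_le vd; rewrite ge_min lexx orbT.
  apply: HN1 => //; apply: wbound_order (leq_maxl p1 p2) _.
  by apply: wbound_le vd; rewrite ge_min lexx.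
(* A small increment is [t] times a vector of [U] on which all h_j are bounded by [N1]; the demi
   identity turns [t] into [gamma t]. *)
have step (t : R) x y j : 0 < t -> t <= 1 -> P x -> P y -> wbound q (t * d) (y - x) ->
    normc (h j y - h j x) <= normc (gamma t%:C) * (normc (h j x) + N1).
  move=> t0 t1 Px Py xy; pose v := (t^-1%:C : R[i]) *: (y - x).
  have Pv : P v by rewrite -[v]addr0; apply: Plin => //; exact: PB.
  have [|Uv vN] := small v Pv.
    apply: wbound_le (wboundZ _ (testfun_smooth (y - x)) xy).
    by rewrite normc_real gtr0_norm ?invr_gt0// mulKf// gt_eqF.
  have -> : y = x + (t%:C : C) *: v.
    rewrite /v scalerA -(rmorphM (real_complex R)) divff ?gt_eqF//.
    by rewrite rmorph1 scale1r subrKC.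
  have [_ _ hdj] := hd j.
  apply: (le_trans (demi_increment x hdj Uv _)); first by rewrite normc_real gtr0_norm.
  by rewrite ler_wpM2l ?normc_ge0// lerD2l.
pose cf v : T := to_test E (conv_fun f v).
have Pcf v : B v -> P (cf v) by move=> /Bm; exact: (stage_conv lf M0 fb mm).
pose B' : set T := cf @` B.
have PB' x : B' x -> P x by move=> [v Bv <-]; exact: Pcf.
have B'A r : exists A, forall x, B' x -> wbound r A x.
  have [A HA] := BA (p + r)%N; exists (c * ((1 + M) ^+ r * A)) => _ [v Bv <-].
  by rewrite /cf (to_test_conv_fun lf M0 fb); apply: (conv_fun_wbound lf M0 fb); exact: HA.
(* Pointwise bounds at the points of a finite net spread to all of f * B by the increment estimate
   with t = 1. *)
have [b Hb] : exists b : R, forall x j, B' x -> normc (h j x) <= b.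
  have [F [F1 F2]] := wbound_net q d0 B'A.
  have [x _|b Hb] := @bounded_all R _ F (fun j x => normc (h j x)); first exact: hb.
  exists (normc (gamma 1) * (b + N1) + b) => x j Bx; have [y yF xy] := F2 x Bx.
  have := @step 1 y x j ltr01 (lexx _) (PB' y (F1 y yF)) (PB' x Bx); rewrite mul1r => /(_ xy) H.
  rewrite -[h j x](subrK (h j y)); apply: (le_trans (normcD _ _)).
  apply: lerD; last exact: Hb.
  by apply: (le_trans H); rewrite ler_wpM2l ?normc_ge0// lerD2r Hb.
have b0 : 0 <= `|b| + `|N1| + 1 by rewrite addr_ge0// addr_ge0.
have b0' : 0 < `|b| + `|N1| + 1 by rewrite ltr_wpDl// addr_ge0.
have [t [t0 t1 gt]] := C0_small gamma0 (divr_gt0 (divr_gt0 e0 (ltr0n R 4)) b0').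
have inc x y j : B' x -> P y -> wbound q (t * d) (y - x) -> normc (h j y - h j x) <= e / 4.
  move=> Bx Py xy; apply: (le_trans (step t x y j t0 t1 (PB' x Bx) Py xy)).
  apply: (@le_trans _ _ (normc (gamma t%:C) * (`|b| + `|N1| + 1))).
    rewrite ler_wpM2l ?normc_ge0// -addrA lerD//; first by apply: le_trans (ler_norm b); exact: Hb.
    by apply: (le_trans (ler_norm _)); rewrite lerDl.
  by rewrite -ler_pdivlMr// ltW.
(* Half the tolerance, because f_k * v is reached from the net point through f * v. *)
have td0 : 0 < t * d / 2 by rewrite divr_gt0// mulr_gt0.
have [F [F1 F2]] := wbound_net q td0 B'A.
have [x xF|N2 HN2] := @eventually_all _ F (fun j x => normc (g_ j x - g x) <= e / 4).
  have [|N HN] := (cvg_complexP _ _).1 (gc x) (e / 4); first by rewrite divr_gt0.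
  by exists N => j /HN /ltW.
have [N3 HN3] := conv_fun_uniform_cvg M0 c0 lf lf_ fb fb_ fc BA q td0.
exists (maxn N2 N3) => k j; rewrite !geq_max => /andP[_ k3] /andP[j2 _] v Bv.
have B'x : B' (cf v) by exists v.
have [x xF vx] := F2 _ B'x; have B'x' := F1 x xF.
have fkv := HN3 k k3 v Bv.
rewrite /conv_demi; set y := to_test E (conv_fun (f_ k) v) in fkv *.
have Py : P y by rewrite /y; apply: (stage_conv (lf_ k) M0 (fb_ k) mm); exact: Bm.
have yx : wbound q (t * d) (y - x).
  have -> : y - x = (y - cf v) + (cf v - x) by rewrite subrKA.
  have := wboundD (testfun_smooth (y - cf v)) (testfun_smooth (cf v - x)) fkv vx.
  by rewrite -splitr.
have xv : wbound q (t * d) (cf v - x).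
  by apply: wbound_le vx; rewrite ler_pdivrMr// ler_peMr ?ler1n// mulr_ge0// ltW.
have h1 : normc (g_ j y - g_ j x) <= e / 4 := inc x y j.+1 B'x' Py yx.
have h2 : normc (g (cf v) - g x) <= e / 4 := inc x (cf v) 0%N B'x' (PB' _ B'x) xv.
have h3 := HN2 j j2 x xF.
have -> : g_ j y - g (cf v) = (g_ j y - g_ j x) + ((g_ j x - g x) - (g (cf v) - g x)) by ring.
apply: (le_lt_trans (normcD _ _)).
apply: (@le_lt_trans _ _ (e / 4 + (e / 4 + e / 4))); last by lra.
by apply: lerD => //; apply: (le_trans (normcD _ _)); rewrite normcN; exact: lerD.
Qed.

End convergence.

Theorem theorem4p6 (R : realType) (n : nat) (E : test_space)
    (U : set (testfun R n E)) (gamma : R[i]^o -> R[i]^o)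
    (f_ : nat -> testfun R n E -> R[i]^o) (f : testfun R n E -> R[i]^o)
    (G : set 'rV[R]_n)
    (g_ : nat -> testfun R n E -> R[i]^o) (g : testfun R n E -> R[i]^o) :
  (0 < n)%N ->
  nbhs (0 : testfun R n E) U ->
  C0 gamma ->
  (forall k, usual_distribution (f_ k)) ->
  (forall xi, f_ k xi @[k --> \oo] --> f xi) ->
  bounded_set G ->
  (forall k, distr_support (f_ k) `<=` G) ->
  demi_distribution gamma U g ->
  (forall k, demi_distribution gamma U (g_ k)) ->
  (forall xi, g_ k xi @[k --> \oo] --> g xi) ->
  [/\ usual_distribution f,
      forall k, convolution_multiplier (f_ k),
      convolution_multiplier f &
      [/\ forall B : set (testfun R n E), tvs_bounded B ->
            forall eps : R[i], 0 < eps -> \forall k \near \oo & m \near \oo,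
              forall xi, B xi ->
                `|conv_demi (f_ k) (g_ m) xi - conv_demi f g xi| < eps,
          forall B : set (testfun R n E), tvs_bounded B ->
            forall eps : R[i], 0 < eps -> \forall k \near \oo,
              forall xi, B xi ->
                `|conv_demi (f_ k) (g_ k) xi - conv_demi f g xi| < eps &
          forall (xi_ : nat -> testfun R n E) (xi : testfun R n E),
            xi_ @ \oo --> xi ->
            conv_demi (f_ k) (g_ k) (xi_ k) @[k --> \oo] --> conv_demi f g xi]].
Proof.
move=> _ nU gamma0 fd fc bG fG gd gd_ gc.
have lf_ k : linear (f_ k) := (fd k).1.
have lf : linear f := linear_limit lf_ fc.
have [M [M0 GM]] : exists M : R, 0 < M /\ forall x, G x -> `|x| <= M.
  have [M [_ HM]] := bG; exists (`|M| + 1); split; first by rewrite ltr_wpDl.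
  by apply: HM; apply: le_lt_trans (ler_norm M) _; rewrite ltrDl.
have M10 : 0 < M + 1 by rewrite addr_gt0.
(* Vanishing on the support alone would not force f_k v = 0, since derivatives transverse to it may
   be seen; hence the radius M + 1 in place of M. *)
have [c [p [c0 fb_]]] := uniform_lbound M10 fd (fun v => cvg_seq_bounded (fc v))
  (fun k v v0 => vanish_support (lf_ k) (fd k).2 (fG k) GM (fun x xM => v0 x (ltW xM))).
have fb := local_bound_limit fb_ fc.
have M20 : 0 <= 2 * (M + 1) by rewrite mulr_ge0// ltW.
have fM := bounded_support_multiplier lf M20 c0 fb.
have unif B : tvs_bounded B -> forall eps : R[i], 0 < eps -> exists N,
    forall k j, (N <= k)%N -> (N <= j)%N -> forall v, B v ->
      `|conv_demi (f_ k) (g_ j) v - conv_demi f g v| < eps.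
  move=> bB eps e0; have [e e0' epsE] := normc_num (ltW e0).
  have {}e0' : 0 < e by move: e0; rewrite epsE ltcR.
  have [N HN] := demi_conv_uniform_cvg nU gamma0 M20 c0 lf lf_ fb fb_ fc gd gd_ gc bB e0'.
  by exists N => k j Nk Nj v Bv; rewrite normc_normr epsE ltcR; exact: HN.
split=> [||//|].
- by split=> //; exact: continuous_of_lbound lf fb.
- by move=> k; exact: bounded_support_multiplier (lf_ k) M20 c0 (fb_ k).
split=> [B bB eps e0|B bB eps e0|xi_ xi xic].
- have [N HN] := unif B bB eps e0.
  exists ([set k | (N <= k)%N], [set k | (N <= k)%N]); first by split; exists N.
  by move=> [k j] /= [Nk Nj] v; exact: HN.
- by have [N HN] := unif B bB eps e0; exists N => // k Nk v; exact: HN.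
apply/cvg_complexP => e e0.
(* Uniformity on the bounded range of [xi_] compares f_k * g_k with f * g at xi_k; there remains the
   sequential continuity of f * g. *)
have [N1 HN1] := demi_conv_uniform_cvg nU gamma0 M20 c0 lf lf_ fb fb_ fc gd gd_ gc
  (cvg_tvs_bounded xic) (divr_gt0 e0 (ltr0n R 2)).
(* Linearity of convolution with [f] moves the convergence to 0, where the multiplier property is
   stated. *)
have cfB u v : to_test E (conv_fun f u) - to_test E (conv_fun f v) =
    to_test E (conv_fun f (u - v)).
  apply: val_inj; apply/funext => x.
  change (to_test E (conv_fun f u) x - to_test E (conv_fun f v) x =
    to_test E (conv_fun f (u - v)) x).
  rewrite !(to_test_conv_fun lf M20 fb) /conv_fun -(linear_mapB lf).
  by congr f; exact: val_inj.
have gcf : conv_demi f g (xi_ k) @[k --> \oo] --> conv_demi f g xi.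
  have xi0 : (xi_ k - xi) @[k --> \oo] --> (0 : testfun R n E).
    move=> A [V bV VA]; apply: (xic [set x | A (x - xi)]); exists V => // v Vv /=.
    by rewrite addrC addKr -[v]add0r; exact: VA.
  have [cg _ _] := gd; move=> A /cg[V bV VA].
  have [N _ HN] := fM.2 _ xi0 V (test_nbhs0 bV).
  exists N => // k /HN /= Vk; have := VA _ Vk.
  by rewrite -cfB addrC subrK.
have [N2 HN2] := (cvg_complexP _ _).1 gcf (e / 2) (divr_gt0 e0 (ltr0n R 2)).
exists (maxn N1 N2) => k; rewrite geq_max => /andP[k1 k2].
rewrite (splitr e) -(subrKA (conv_demi f g (xi_ k))).
apply: (le_lt_trans (normcD _ _)); apply: ltrD; last exact: HN2.
by apply: HN1 => //; exists k.
Qed.
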